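(* Let $a,b,c,d\in\mathbb R$ satisfy $a^2+c^2>0$ and $\Delta:=ad-bc\ne0$. With $\rho,\chi,\xi(s),\xi_0,\gamma,\mathbf d,J_\chi,u_\pm,C_\pm$ and the three-dimensional clothoid $r(s)$ (with signed curvature $cs+d$ and torsion $as+b$) as defined in the context, set $$b_\pm=\rho^{-3/2}\Big\{c\,C_\pm-c\,J_\chi(\xi_0)-a\big(\xi_0\gamma(\xi_0)-\chi\,\mathbf d(\xi_0)\big)\Big\}\in\mathbb R^3 .$$ Then, as $s\to\pm\infty$ (upper signs for $s\to+\infty$, lower signs for $s\to-\infty$), $$r(s)=b_\pm+u_\pm\left[\frac a\rho\left(s+\frac{ab+cd}{\rho^2}\right)-\frac{c\Delta}{\rho^3}\log\left|\sqrt\rho\left(s+\frac{ab+cd}{\rho^2}\right)\right|\right]+O(|s|^{-1}).$$ Consequently, $$\operatorname{dist}\big(r(s),\,b_\pm+\mathbb R u_\pm\big)=O(|s|^{-1})\qquad (s\to\pm\infty).$$ Moreover, the angle $\Theta\in[0,\pi]$ between the two asymptotic directions $u_+$ and $u_-$ satisfies $$\cos\Theta=2e^{-\pi\chi^2/2}-1,\qquad \Theta=2\arccos\!\left(e^{-\pi\chi^2/4}\right).$$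
   Context: For $v=(v_1,v_2,v_3)\in\mathbb R^3$ write $v^\perp:=v_1+\mathrm i v_2\in\mathbb C$ and $(v)_3:=v_3$; a vector is thus specified by $v^\perp$ and $(v)_3$. Parameters: $\Delta=ad-bc$, $\rho=\sqrt{a^2+c^2}$, $\chi=-\Delta/\rho^{3/2}$, $\xi(s)=\sqrt\rho\left(s+\frac{ab+cd}{\rho^2}\right)$, $\xi_0=\xi(0)$. For real $\xi$: $\mu=\frac12+\frac{\mathrm i\chi^2}{8}$, $\zeta=\frac{\mathrm i\xi^2}{2}$, $U(\xi)={}_1F_1(\mu;\tfrac12;\zeta)$, $V(\xi)={}_1F_1(\mu;\tfrac32;\zeta)$ (Kummer's confluent hypergeometric function), and $$\psi_1(\xi)=e^{-\zeta/2}U(\xi),\qquad \psi_2(\xi)=\frac{\mathrm i\chi\xi}{2}e^{-\zeta/2}V(\xi).$$ The vector-valued functions $\gamma,\mathbf d:\mathbb R\to\mathbb R^3$ are $$\gamma^\perp=-2\psi_1\psi_2,\quad \gamma_3=|\psi_1|^2-|\psi_2|^2,\qquad \mathbf d^\perp=-(\psi_1^2-\psi_2^2),\quad (\mathbf d)_3=-2\operatorname{Re}(\overline{\psi_1}\psi_2).$$ $J_\chi:\mathbb R\to\mathbb R^3$ is the primitive with $J_\chi'(\xi)=-\mathbf d(\xi)$ and $J_\chi(0)=0$. The curve $r:\mathbb R\to\mathbb R^3$ is $$r(s)=\rho^{-3/2}\int_{\xi_0}^{\xi(s)}\big(a\,\gamma(\eta)-c\,\mathbf d(\eta)\big)\,d\eta=\rho^{-3/2}\Big[c\,J_\chi(\xi)+a\big(\xi\gamma(\xi)-\chi\,\mathbf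 d(\xi)\big)\Big]_{\xi_0}^{\xi(s)},$$ where $[f]_{\xi_0}^{\xi(s)}=f(\xi(s))-f(\xi_0)$; it is a unit-speed curve with signed curvature $cs+d$ and torsion $as+b$ (signed coefficients in the smoothly continued Frenet equations). Limiting directions $u_\pm\in\mathbb R^3$: $$(u_\pm)^\perp=\pm\frac{\chi\pi e^{-\pi\chi^2/8}e^{-\pi\mathrm i/4}}{\sqrt2\,\Gamma(\frac12+\frac{\mathrm i\chi^2}{8})\,\Gamma(1-\frac{\mathrm i\chi^2}{8})},\qquad (u_\pm)_3=e^{-\pi\chi^2/4}.$$ With $\Psi=\Gamma'/\Gamma$ the digamma function, the constants $C_\pm\in\mathbb R^3$ are $$(C_\pm)^\perp=\pm\frac{\chi\pi e^{-\pi\chi^2/8}e^{-\pi\mathrm i/4}}{\sqrt2\,\Gamma(\frac12+\frac{\mathrm i\chi^2}{8})\,\Gamma(1-\frac{\mathrm i\chi^2}{8})}\left[\frac{\mathrm i}{\chi}-\frac\chi4\left\{2\log2+\Psi\!\left(1-\frac{\mathrm i\chi^2}{8}\right)+\Psi\!\left(\frac12+\frac{\mathrm i\chi^2}{8}\right)\right\}\right],$$ $$(C_\pm)_3=\frac\chi4\left[\left(1-e^{-\pi\chi^2/4}\right)\left\{\log2+\operatorname{Re}\Psi\!\left(1-\frac{\mathrm i\chi^2}{8}\right)\right\}-\left(1+e^{-\pi\chi^2/4}\right)\left\{\log2+\operatorname{Re}\Psi\!\left(\frac12+\frac{\mathrm i\chi^2}{8}\right)\right\}\right].$$ *)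

(* Defs.v *)
From Stdlib Require Export Reals Factorial.
From Coquelicot Require Export Coquelicot.
Open Scope R_scope.

(* A vector (v1, v2, v3) is stored as the pair ((v1, v2), v3); since [C] is
   [R * R], its first component is v1 + i v2.  The [norm] of this product
   module is the Euclidean norm. *)
Definition R3 : NormedModule R_AbsRing :=
  prod_NormedModule R_AbsRing
    (prod_NormedModule R_AbsRing R_NormedModule R_NormedModule) R_NormedModule.

Definition vec (z : C) (t : R) : R3 := (z, t).
Definition perp (v : R3) : C := fst v.
Definition third (v : R3) : R := snd v.

Definition inner (u v : R3) : R :=
  Re (perp u) * Re (perp v) + Im (perp u) * Im (perp v) + third u * third v.

Definition angle (u v : R3) : R := acos (inner u v / (norm u * norm v)).

Definition line (p u : R3) : R3 -> Prop :=
  fun y => exists t : R, y = plus p (scal t u).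

Definition dist_to (x : R3) (E : R3 -> Prop) : R :=
  real (Glb_Rbar (fun t => exists y : R3, E y /\ t = norm (minus x y))).

(* [R3] has no declared completeness instance, hence the split into a complex
   and a real integral. *)
Definition RInt3 (f : R -> R3) (x y : R) : R3 :=
  vec (RInt (V := C_R_CompleteNormedModule) (fun t => perp (f t)) x y)
      (RInt (fun t => third (f t)) x y).

Definition is_bigO {T : Type} {V : NormedModule R_AbsRing}
    (F : (T -> Prop) -> Prop) (f : T -> V) (g : T -> R) : Prop :=
  exists K : R, F (fun x => norm (f x) <= K * Rabs (g x)).

Definition Cexp (z : C) : C := (exp (Re z) * cos (Im z), exp (Re z) * sin (Im z)).

Definition CSeries (f : nat -> C) : C :=
  (Series (fun n => Re (f n)), Series (fun n => Im (f n))).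

(* Rising factorial z (z + 1) ... (z + n - 1). *)
Fixpoint pochhammer (z : C) (n : nat) : C :=
  match n with
  | O => 1
  | S m => (pochhammer z m * (z + INR m))%C
  end.

Definition kummer (alpha beta z : C) : C :=
  CSeries (fun n =>
    (pochhammer alpha n / pochhammer beta n * (z ^ n / INR (fact n)))%C).

(* Euler's integral of t^(z-1) e^(-t), with the principal power of t > 0; it is
   meaningful for Re z > 0, and only evaluated there below. *)
Definition CGamma (z : C) : C :=
  RInt_gen (V := C_R_CompleteNormedModule)
    (fun t : R => (Cexp ((z - 1) * ln t) * exp (- t))%C)
    (at_right 0) (Rbar_locally p_infty).

Definition digamma (z : C) : C := (C_derive CGamma z / CGamma z)%C.

Definition Delta_abcd (a b c d : R) : R := a * d - b * c.
Definition rho (a c : R) : R := sqrt (a ^ 2 + c ^ 2).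
Definition chi (a b c d : R) : R := - Delta_abcd a b c d / Rpower (rho a c) (3 / 2).
Definition xi (a b c d s : R) : R :=
  sqrt (rho a c) * (s + (a * b + c * d) / rho a c ^ 2).

Definition mu (k : R) : C := (1 / 2 + Ci * k ^ 2 / 8)%C.
Definition zeta (x : R) : C := (Ci * x ^ 2 / 2)%C.

(* In what follows [k] is the parameter chi and [x] the variable xi. *)
Definition psi1 (k x : R) : C :=
  (Cexp (- zeta x / 2) * kummer (mu k) (1 / 2) (zeta x))%C.
Definition psi2 (k x : R) : C :=
  (Ci * k * x / 2 * Cexp (- zeta x / 2) * kummer (mu k) (3 / 2) (zeta x))%C.

Definition gamma (k x : R) : R3 :=
  vec (- (2 * psi1 k x * psi2 k x))%C (Cmod (psi1 k x) ^ 2 - Cmod (psi2 k x) ^ 2).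
Definition dvec (k x : R) : R3 :=
  vec (- (psi1 k x ^ 2 - psi2 k x ^ 2))%C (- 2 * Re (Cconj (psi1 k x) * psi2 k x)%C).

Definition J (k x : R) : R3 := RInt3 (fun y => opp (dvec k y)) 0 x.

Definition clothoid (a b c d s : R) : R3 :=
  let k := chi a b c d in
  scal (Rpower (rho a c) (- (3 / 2)))
    (RInt3 (fun y => minus (scal a (gamma k y)) (scal c (dvec k y)))
       (xi a b c d 0) (xi a b c d s)).

(* The sign sg is 1 for the limit at +oo and -1 for the limit at -oo. *)
Definition u_perp (sg k : R) : C :=
  (sg * (k * PI * exp (- (PI * k ^ 2 / 8))%R * Cexp (- (PI * Ci / 4)) /
     (sqrt 2 * CGamma (1 / 2 + Ci * k ^ 2 / 8) * CGamma (1 - Ci * k ^ 2 / 8))))%C.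

Definition u_dir (sg k : R) : R3 := vec (u_perp sg k) (exp (- (PI * k ^ 2 / 4))).

Definition C_const (sg k : R) : R3 :=
  vec
    (u_perp sg k *
      (Ci / k - k / 4 * (2 * ln 2 + digamma (1 - Ci * k ^ 2 / 8)
                                  + digamma (1 / 2 + Ci * k ^ 2 / 8))))%C
    (k / 4 *
      ((1 - exp (- (PI * k ^ 2 / 4))) *
         (ln 2 + Re (digamma (1 - Ci * k ^ 2 / 8)%C))
       - (1 + exp (- (PI * k ^ 2 / 4))) *
         (ln 2 + Re (digamma (1 / 2 + Ci * k ^ 2 / 8)%C)))).

Definition b_const (sg a b c d : R) : R3 :=
  let k := chi a b c d in
  let x0 := xi a b c d 0 in
  scal (Rpower (rho a c) (- (3 / 2)))
    (minus (minus (scal c (C_const sg k)) (scal c (J k x0)))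
       (scal a (minus (scal x0 (gamma k x0)) (scal k (dvec k x0))))).

(* Main.v *)
(* Put kap = chi^2 / 8.  Then w1 = psi1 and w2 = psi2 / (i chi / 2) solve the Landau-Zener system
   w1' = i x/2 w1 - 2 kap w2, w2' = w1 - i x/2 w2, which conserves |w1|^2 + 2 kap |w2|^2 and forces
   w1 ~ A e^(i theta), w2 ~ B e^(- i theta) with theta = x^2/4 + kap log (x^2/2).  With the normal n, the frame satisfies
   gamma' = chi n, d' = xi n, n' = - chi gamma - xi d; integrating by parts,
   xi gamma - chi d = xi u + O(1/xi) and J = C + chi u log xi + O(1/xi), where u and C are still unknown.

   The transform of e^(i (1/4 - tau/2) x^2) w against e^(- eps x^2/2), tau in {0, 1}, solves a first-order linear
   equation in eps, hence is known in closed form from its behaviour as eps -> oo.  Its behaviour as eps -> 0 is a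
   Gamma integral times the amplitude, so A and B are quotients of the Gaussian constant g by Gamma values.  The
   conservation law |A|^2 + 2 kap |B|^2 = 1, read at kap and - kap, yields |A|^2, |B|^2 and g^2 = pi/2, hence u.

   The derivative of (w1, w2) with respect to the parameter is, by variation of constants, a combination of w and the
   components of J; treating it in the same way brings in Gamma', and the digamma values in C result.  The other end
   follows by parity in xi. *)

Require Import Defs.
From Stdlib Require Import Lra Lia.
Open Scope R_scope.

(** * Calculus of complex-valued functions of a real variable *)

(** This is a connection problem: the solution is known at 0 and wanted at infinity. The Gaussian
    weight links the two ends, since eps -> oo sees only the value at 0 and eps -> 0 only the
    leading behaviour at infinity. The factor e^(i (1/4 - tau/2) x^2) cancels the quadratic phase of
    one component, w1 for tau = 1 and w2 for tau = 0; what remains of it is a pure power of x^2/2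
    (with a logarithm for the parameter derivative), whose transform is a Gamma integral. The
    conservation law is one equation for |A| and |B|, with g unknown as well. Replacing kap by - kap
    changes neither |Gamma(1/2 + i kap)| nor |Gamma(1 - i kap)|, which gives the second equation,
    and kap -> 0 with Gamma(1) = 1 gives g. The constants of integration of J are invisible to w
    itself. They enter the derivative of w in kap, whose amplitudes are formally dA/dkap and
    dB/dkap; hence the logarithmic derivatives of Gamma. This derivative is written down as an
    explicit solution of the variational system, so that nothing is ever differentiated in kap. *)

Definition cderiv (f : R -> C) (x : R) (l : C) : Prop :=
  is_derive (fun t => Re (f t)) x (Re l) /\ is_derive (fun t => Im (f t)) x (Im l).

Definition ccont (f : R -> C) (x : R) : Prop :=
  continuous (fun t => Re (f t)) x /\ continuous (fun t => Im (f t)) x.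

Definition clim (f : R -> C) (F : (R -> Prop) -> Prop) (l : C) : Prop :=
  forall eps : R, 0 < eps -> F (fun x => Cmod (f x - l)%C < eps).

Lemma C_ext (z w : C) : Re z = Re w -> Im z = Im w -> z = w.
Proof. destruct z, w; simpl; congruence. Qed.

Lemma is_derive_eq (f : R -> R) (x l l' : R) : is_derive f x l -> l = l' -> is_derive f x l'.
Proof. intros H <-; exact H. Qed.

Lemma cderiv_eq f x l l' : cderiv f x l -> l = l' -> cderiv f x l'.
Proof. intros H <-; exact H. Qed.

Lemma cderiv_ext f g x l : (forall t, f t = g t) -> cderiv f x l -> cderiv g x l.
Proof.
  intros E [H1 H2]; split.
  - apply is_derive_ext with (2 := H1); intros t; now rewrite E.
  - apply is_derive_ext with (2 := H2); intros t; now rewrite E.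
Qed.

Lemma cderiv_const c x : cderiv (fun _ => c) x 0.
Proof. split; simpl; apply @is_derive_const. Qed.

Lemma cderiv_RtoC (f : R -> R) x l : is_derive f x l -> cderiv (fun t => RtoC (f t)) x l.
Proof. intros H; split; simpl; [exact H | apply @is_derive_const]. Qed.

Lemma cderiv_plus f g x a b :
  cderiv f x a -> cderiv g x b -> cderiv (fun t => f t + g t)%C x (a + b)%C.
Proof.
  intros [H1 H2] [H3 H4]; split.
  - exact (is_derive_plus _ _ _ _ _ H1 H3).
  - exact (is_derive_plus _ _ _ _ _ H2 H4).
Qed.

Lemma cderiv_opp f x a : cderiv f x a -> cderiv (fun t => - f t)%C x (- a)%C.
Proof.
  intros [H1 H2]; split.
  - exact (is_derive_opp _ _ _ H1).
  - exact (is_derive_opp _ _ _ H2).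
Qed.

Lemma cderiv_minus f g x a b :
  cderiv f x a -> cderiv g x b -> cderiv (fun t => f t - g t)%C x (a - b)%C.
Proof. intros H1 H2; apply cderiv_plus; [exact H1 | now apply cderiv_opp]. Qed.

Lemma cderiv_mult f g x a b :
  cderiv f x a -> cderiv g x b -> cderiv (fun t => f t * g t)%C x (a * g x + f x * b)%C.
Proof.
  intros [H1 H2] [H3 H4]; split.
  - eapply is_derive_eq.
    + exact (is_derive_minus _ _ _ _ _
        (is_derive_mult _ _ _ _ _ H1 H3 Rmult_comm) (is_derive_mult _ _ _ _ _ H2 H4 Rmult_comm)).
    + unfold minus, plus, opp, mult; simpl. unfold Re, Im. ring.
  - eapply is_derive_eq.
    + exact (is_derive_plus _ _ _ _ _
        (is_derive_mult _ _ _ _ _ H1 H4 Rmult_comm) (is_derive_mult _ _ _ _ _ H2 H3 Rmult_comm)).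
    + unfold minus, plus, opp, mult; simpl. unfold Re, Im. ring.
Qed.

Lemma cderiv_scal c f x a : cderiv f x a -> cderiv (fun t => c * f t)%C x (c * a)%C.
Proof.
  intros H. eapply cderiv_eq. apply cderiv_mult; [apply cderiv_const | exact H]. cbv beta. ring.
Qed.

Lemma cderiv_conj f x a : cderiv f x a -> cderiv (fun t => Cconj (f t)) x (Cconj a).
Proof.
  intros [H1 H2]; split; [exact H1 |].
  exact (is_derive_opp _ _ _ H2).
Qed.

Lemma cderiv_comp f (g : R -> R) x l d :
  cderiv f (g x) l -> is_derive g x d -> cderiv (fun t => f (g t)) x (d * l)%C.
Proof.
  intros [H1 H2] Hg; split.
  - eapply is_derive_eq. exact (is_derive_comp _ _ _ _ _ H1 Hg).
    unfold scal; simpl; unfold mult; simpl. unfold Re; simpl; ring.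
  - eapply is_derive_eq. exact (is_derive_comp _ _ _ _ _ H2 Hg).
    unfold scal; simpl; unfold mult; simpl. unfold Im; simpl; ring.
Qed.

Lemma cderiv_Cexp f x a : cderiv f x a -> cderiv (fun t => Cexp (f t)) x (a * Cexp (f x))%C.
Proof.
  intros [H1 H2].
  assert (E : is_derive (fun t => exp (Re (f t))) x (Re a * exp (Re (f x)))).
  { exact (is_derive_comp exp _ _ _ _ (is_derive_exp _) H1). }
  assert (Cd : is_derive (fun t => cos (Im (f t))) x (Im a * - sin (Im (f x)))).
  { exact (is_derive_comp cos _ _ _ _ (is_derive_cos _) H2). }
  assert (Sd : is_derive (fun t => sin (Im (f t))) x (Im a * cos (Im (f x)))).
  { exact (is_derive_comp sin _ _ _ _ (is_derive_sin _) H2). }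
  split.
  - eapply is_derive_eq. exact (is_derive_mult _ _ _ _ _ E Cd Rmult_comm).
    unfold plus, mult; simpl. unfold Re, Im. ring.
  - eapply is_derive_eq. exact (is_derive_mult _ _ _ _ _ E Sd Rmult_comm).
    unfold plus, mult; simpl. unfold Re, Im. ring.
Qed.

Lemma cderiv_ccont f x l : cderiv f x l -> ccont f x.
Proof.
  intros [H1 H2]; split.
  - apply @ex_derive_continuous. eexists; exact H1.
  - apply @ex_derive_continuous. eexists; exact H2.
Qed.

Lemma ccont_mult f g x : ccont f x -> ccont g x -> ccont (fun t => f t * g t)%C x.
Proof.
  intros [H1 H2] [H3 H4]; split.
  - exact (continuous_minus _ _ _ (continuous_mult _ _ _ H1 H3) (continuous_mult _ _ _ H2 H4)).
  - exact (continuous_plus _ _ _ (continuous_mult _ _ _ H1 H4) (continuous_mult _ _ _ H2 H3)).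
Qed.

Lemma ccont_plus f g x : ccont f x -> ccont g x -> ccont (fun t => f t + g t)%C x.
Proof.
  intros [H1 H2] [H3 H4]; split.
  - exact (continuous_plus _ _ _ H1 H3).
  - exact (continuous_plus _ _ _ H2 H4).
Qed.

Lemma ccont_const c x : ccont (fun _ => c) x.
Proof. eapply cderiv_ccont, cderiv_const. Qed.

Lemma ccont_opp f x : ccont f x -> ccont (fun t => - f t)%C x.
Proof. intros [H1 H2]; split; [exact (continuous_opp _ _ H1) | exact (continuous_opp _ _ H2)]. Qed.

Lemma ccont_minus f g x : ccont f x -> ccont g x -> ccont (fun t => f t - g t)%C x.
Proof. intros H1 H2. apply ccont_plus; [|apply ccont_opp]; assumption. Qed.

Lemma ccont_conj f x : ccont f x -> ccont (fun t => Cconj (f t)) x.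
Proof. intros [H1 H2]; split; [exact H1 | exact (continuous_opp _ _ H2)]. Qed.

Lemma Cmod_Re (z : C) : Rabs (Re z) <= Cmod z.
Proof. eapply Rle_trans; [|apply Rmax_Cmod]. apply Rmax_l. Qed.

Lemma Cmod_Im (z : C) : Rabs (Im z) <= Cmod z.
Proof. eapply Rle_trans; [|apply Rmax_Cmod]. apply Rmax_r. Qed.

Lemma Cmod_sqr (z : C) : Cmod z ^ 2 = Re z ^ 2 + Im z ^ 2.
Proof. unfold Cmod. rewrite pow2_sqrt; [reflexivity | unfold Re, Im; nra]. Qed.

Lemma Cmod_le_abs (z : C) : Cmod z <= Rabs (Re z) + Rabs (Im z).
Proof.
  apply Rsqr_incr_0_var; [|generalize (Rabs_pos (Re z)) (Rabs_pos (Im z)); lra].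
  rewrite !Rsqr_pow2, Cmod_sqr, <- (pow2_abs (Re z)), <- (pow2_abs (Im z)).
  generalize (Rabs_pos (Re z)) (Rabs_pos (Im z)); nra.
Qed.

Lemma Cmod_minus (z w : C) : Cmod (z - w)%C <= Cmod z + Cmod w.
Proof. eapply Rle_trans; [apply Cmod_triangle|]. rewrite Cmod_opp; lra. Qed.

Lemma Cconj_RtoC (x : R) : Cconj x = x.
Proof. apply C_ext; simpl; ring. Qed.

Lemma Cmod_RtoC (x : R) : 0 <= x -> Cmod x = x.
Proof. intros H. rewrite Cmod_R, Rabs_pos_eq; auto. Qed.

Lemma Cmod_Ci : Cmod Ci = 1.
Proof. unfold Cmod, Ci; simpl. replace (0 * (0 * 1) + 1 * (1 * 1)) with 1 by ring. apply sqrt_1. Qed.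

Lemma Cexp_add (z w : C) : Cexp (z + w)%C = (Cexp z * Cexp w)%C.
Proof.
  apply C_ext; unfold Cexp, Re, Im; simpl; rewrite exp_plus.
  - rewrite cos_plus; ring.
  - rewrite sin_plus; ring.
Qed.

Lemma Cexp_0 : Cexp 0 = 1%C.
Proof. apply C_ext; unfold Cexp; simpl; rewrite exp_0, ?cos_0, ?sin_0; ring. Qed.

Lemma Cmod_Cexp (z : C) : Cmod (Cexp z) = exp (Re z).
Proof.
  apply Rsqr_inj; [apply Cmod_ge_0 | left; apply exp_pos |].
  rewrite !Rsqr_pow2, Cmod_sqr. unfold Cexp; simpl.
  generalize (sin2_cos2 (Im z)); unfold Rsqr; intros H.
  replace (_ + _) with (exp (Re z) * exp (Re z) * (sin (Im z) * sin (Im z) + cos (Im z) * cos (Im z))) by ring.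
  rewrite H; ring.
Qed.

Lemma Cexp_neq_0 (z : C) : Cexp z <> 0%C.
Proof. apply Cmod_gt_0. rewrite Cmod_Cexp. apply exp_pos. Qed.

Lemma Cexp_RtoC (x : R) : Cexp x = RtoC (exp x).
Proof. apply C_ext; unfold Cexp; simpl; rewrite ?cos_0, ?sin_0; ring. Qed.

Lemma Cconj_Cexp (z : C) : Cconj (Cexp z) = Cexp (Cconj z).
Proof. apply C_ext; unfold Cexp, Cconj, Re, Im; simpl; rewrite ?cos_neg, ?sin_neg; ring. Qed.

Lemma is_derive_nonneg_le (f df : R -> R) (a b : R) : a <= b ->
  (forall x, a <= x <= b -> is_derive f x (df x)) ->
  (forall x, a <= x <= b -> 0 <= df x) -> f a <= f b.
Proof.
  intros Hab Hd Hp.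
  destruct (MVT_gen f a b df) as (c & Hc & E).
  - intros x Hx. rewrite Rmin_left, Rmax_right in Hx by lra. apply Hd; lra.
  - intros x Hx. rewrite Rmin_left, Rmax_right in Hx by lra.
    apply derivable_continuous_pt. exists (df x). apply is_derive_Reals, Hd; lra.
  - rewrite Rmin_left, Rmax_right in Hc by lra. specialize (Hp c Hc).
    assert (0 <= df c * (b - a)) by (apply Rmult_le_pos; lra). lra.
Qed.

Lemma is_derive_zero_eq (f df : R -> R) (a b : R) : a <= b ->
  (forall x, a <= x <= b -> is_derive f x (df x)) ->
  (forall x, a <= x <= b -> df x = 0) -> f a = f b.
Proof.
  intros Hab Hd Hp. apply Rle_antisym.
  - apply is_derive_nonneg_le with df; auto. intros; rewrite Hp; auto; lra.
  - apply Ropp_le_cancel.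
    apply (is_derive_nonneg_le (fun x => - f x) (fun x => - df x)); auto.
    + intros x Hx. exact (is_derive_opp _ _ _ (Hd x Hx)).
    + intros x Hx; rewrite Hp; auto; lra.
Qed.

Lemma cderiv_zero_eq (f df : R -> C) (a b : R) : a <= b ->
  (forall x, a <= x <= b -> cderiv f x (df x)) ->
  (forall x, a <= x <= b -> df x = 0%C) -> f a = f b.
Proof.
  intros Hab Hd Hp. apply C_ext.
  - apply (is_derive_zero_eq (fun t => Re (f t)) (fun t => Re (df t))); auto.
    intros; apply Hd; auto. intros x Hx; now rewrite Hp.
  - apply (is_derive_zero_eq (fun t => Im (f t)) (fun t => Im (df t))); auto.
    intros; apply Hd; auto. intros x Hx; now rewrite Hp.
Qed.

(* [f - K / x ^ n] increases and [f + K / x ^ n] decreases. *)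
Lemma limit_of_derive_bound (f df : R -> R) (K a : R) (n : nat) : 0 < a -> 0 <= K ->
  (forall x, a <= x -> is_derive f x (df x)) ->
  (forall x, a <= x -> Rabs (df x) <= K / x ^ S (S n)) ->
  exists l, forall x, a <= x -> Rabs (f x - l) <= K / x ^ S n.
Proof.
  intros Ha HK Hd Hb.
  assert (Hp : forall x, a <= x -> is_derive (fun t => K / t ^ S n) x (- (INR (S n) * K / x ^ S (S n)))).
  { intros x Hx. assert (x <> 0) by lra. assert (x ^ n <> 0) by now apply pow_nonzero. auto_derive.
    - change (x ^ S n <> 0). now apply pow_nonzero.
    - simpl pow. change (match n with 0%nat => 1 | S _ => INR n + 1 end) with (INR (S n)). generalize (INR (S n)); intros N. field. split; assumption. }
  assert (HS : forall x, a <= x -> K / x ^ S (S n) <= INR (S n) * K / x ^ S (S n)).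
  { intros x Hx. unfold Rdiv. apply Rmult_le_compat_r.
    left; apply Rinv_0_lt_compat, pow_lt; lra. rewrite S_INR. generalize (pos_INR n); nra. }
  assert (Hinc : forall x y, a <= x -> x <= y -> f x - K / x ^ S n <= f y - K / y ^ S n).
  { intros x y Hx Hxy.
    apply (is_derive_nonneg_le (fun t => f t - K / t ^ S n) (fun t => df t - - (INR (S n) * K / t ^ S (S n)))); auto.
    - intros t Ht. apply @is_derive_minus; [apply Hd | apply Hp]; lra.
    - intros t Ht. generalize (Hb t ltac:(lra)) (HS t ltac:(lra)); intros H1 H2.
      apply Rabs_le_between in H1. lra. }
  assert (Hdec : forall x y, a <= x -> x <= y -> f y + K / y ^ S n <= f x + K / x ^ S n).
  { intros x y Hx Hxy. apply Ropp_le_cancel.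
    apply (is_derive_nonneg_le (fun t => - (f t + K / t ^ S n)) (fun t => - (df t + - (INR (S n) * K / t ^ S (S n))))); auto.
    - intros t Ht. apply @is_derive_opp. apply @is_derive_plus; [apply Hd | apply Hp]; lra.
    - intros t Ht. generalize (Hb t ltac:(lra)) (HS t ltac:(lra)); intros H1 H2.
      apply Rabs_le_between in H1. lra. }
  assert (Hpos : forall x, a <= x -> 0 <= K / x ^ S n).
  { intros x Hx. apply Rdiv_le_0_compat; [lra | apply pow_lt; lra]. }
  assert (Hle : forall x y, a <= x -> a <= y -> f x - K / x ^ S n <= f y + K / y ^ S n).
  { intros x y Hx Hy. destruct (Rle_dec x y).
    - generalize (Hinc x y Hx r) (Hpos y Hy); lra.
    - generalize (Hdec y x Hy ltac:(lra)) (Hpos x Hx); lra. }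
  destruct (completeness (fun v => exists x, a <= x /\ v = f x - K / x ^ S n)) as [l [Hl1 Hl2]].
  - exists (f a + K / a ^ S n). intros v (x & Hx & ->). apply Hle; lra.
  - exists (f a - K / a ^ S n), a; split; [lra | reflexivity].
  - exists l. intros x Hx. apply Rabs_le_between'. split.
    + enough (l <= f x + K / x ^ S n) by lra. apply Hl2. intros v (y & Hy & ->). now apply Hle.
    + enough (f x - K / x ^ S n <= l) by lra. apply Hl1. now exists x.
Qed.

Lemma exp_le_compat x y : x <= y -> exp x <= exp y.
Proof. intros [H | ->]; [left; now apply exp_increasing | right; reflexivity]. Qed.

Lemma exp_pow_INR x n : exp x ^ n = exp (INR n * x).
Proof.
  induction n as [|n IH]; [simpl; rewrite Rmult_0_l, exp_0; reflexivity |].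
  rewrite S_INR. simpl. rewrite IH, <- exp_plus. f_equal; ring.
Qed.

Lemma Cmult_cancel_r (c a b : C) : c <> 0%C -> (a * c = b * c)%C -> a = b.
Proof. intros Hc E. replace a with (a * c / c)%C by (now field). rewrite E. now field. Qed.

Lemma at_right_0_iff (P : R -> Prop) :
  at_right 0 P <-> exists d, 0 < d /\ forall x, 0 < x < d -> P x.
Proof.
  split.
  - intros [d Hd]. exists d; split; [apply cond_pos|]. intros x Hx. apply Hd; [|lra].
    unfold ball; simpl; unfold AbsRing_ball, abs, minus, plus, opp; simpl.
    rewrite Rabs_pos_eq; lra.
  - intros (d & Hd & H). exists (mkposreal d Hd). intros x Hx H0. apply H.
    unfold ball in Hx; simpl in Hx; unfold AbsRing_ball, abs, minus, plus, opp in Hx; simpl in Hx.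
    apply Rabs_def2 in Hx; lra.
Qed.

Lemma clim_const (F : (R -> Prop) -> Prop) {FF : Filter F} c : clim (fun _ => c) F c.
Proof.
  intros eps He. apply filter_forall. intros _. replace (c - c)%C with (RtoC 0) by ring.
  now rewrite Cmod_0.
Qed.

Lemma clim_plus (F : (R -> Prop) -> Prop) {FF : Filter F} f g a b :
  clim f F a -> clim g F b -> clim (fun x => f x + g x)%C F (a + b)%C.
Proof.
  intros H1 H2 eps He.
  assert (He2 : 0 < eps / 2) by lra.
  refine (filter_imp _ _ _ (filter_and _ _ (H1 _ He2) (H2 _ He2))).
  intros x [Ha Hb]. replace (f x + g x - (a + b))%C with ((f x - a) + (g x - b))%C by ring.
  eapply Rle_lt_trans; [apply Cmod_triangle|]. lra.
Qed.

Lemma clim_mult (F : (R -> Prop) -> Prop) {FF : Filter F} f g a b :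
  clim f F a -> clim g F b -> clim (fun x => f x * g x)%C F (a * b)%C.
Proof.
  intros H1 H2 eps He.
  set (M := 1 + Cmod a + Cmod b).
  assert (HM : 1 <= M) by (unfold M; generalize (Cmod_ge_0 a) (Cmod_ge_0 b); lra).
  assert (He' : 0 < Rmin 1 (eps / (2 * M))).
  { apply Rmin_glb_lt; [lra | apply Rdiv_lt_0_compat; lra]. }
  refine (filter_imp _ _ _ (filter_and _ _ (H1 _ He') (H2 _ He'))).
  intros x [Ha Hb].
  generalize (Rmin_l 1 (eps / (2 * M))) (Rmin_r 1 (eps / (2 * M))); intros Hm1 Hm2.
  replace (f x * g x - a * b)%C with ((f x - a) * (g x - b) + ((f x - a) * b + a * (g x - b)))%C by ring.
  eapply Rle_lt_trans; [apply Cmod_triangle|].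
  eapply Rle_lt_trans; [apply Rplus_le_compat_l, Cmod_triangle|]. rewrite !Cmod_mult.
  set (u := Cmod (f x - a)%C) in *. set (v := Cmod (g x - b)%C) in *.
  assert (0 <= u) by apply Cmod_ge_0. assert (0 <= v) by apply Cmod_ge_0.
  generalize (Cmod_ge_0 a) (Cmod_ge_0 b); intros Pa Pb.
  set (d := eps / (2 * M)) in *.
  assert (Hd : d * M = eps / 2) by (unfold d; field; lra).
  assert (u * v <= d) by nra.
  assert (u * Cmod b <= d * Cmod b) by nra.
  assert (Cmod a * v <= d * Cmod a) by nra.
  assert (d * M = d + d * Cmod a + d * Cmod b) by (unfold M; ring). lra.
Qed.

Lemma clim_scal (F : (R -> Prop) -> Prop) {FF : Filter F} c f a :
  clim f F a -> clim (fun x => c * f x)%C F (c * a)%C.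
Proof. intros H. apply clim_mult; auto. now apply clim_const. Qed.

Lemma clim_ext_loc (F : (R -> Prop) -> Prop) {FF : Filter F} f g a :
  F (fun x => f x = g x) -> clim f F a -> clim g F a.
Proof.
  intros H1 H2 eps He. refine (filter_imp _ _ _ (filter_and _ _ H1 (H2 eps He))).
  intros x [E H]. now rewrite <- E.
Qed.

Lemma clim_minus (F : (R -> Prop) -> Prop) {FF : Filter F} f g a b :
  clim f F a -> clim g F b -> clim (fun x => f x - g x)%C F (a - b)%C.
Proof.
  intros H1 H2. replace (a - b)%C with (a + (-(1)) * b)%C by ring.
  apply clim_ext_loc with (f := fun x => (f x + (-(1)) * g x)%C); auto.
  - apply filter_forall. intros; ring.
  - apply clim_plus; auto. now apply clim_scal.
Qed.

Lemma clim_unique (F : (R -> Prop) -> Prop) {FF : ProperFilter F} f a b :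
  clim f F a -> clim f F b -> a = b.
Proof.
  intros H1 H2. destruct (Req_dec (Cmod (a - b)%C) 0) as [E | E].
  - apply Cmod_eq_0 in E. replace a with (a - b + b)%C by ring. rewrite E; ring.
  - exfalso. assert (Hp : 0 < Cmod (a - b)%C) by (generalize (Cmod_ge_0 (a - b)%C); lra).
    assert (Hp2 : 0 < Cmod (a - b)%C / 2) by lra.
    destruct (filter_ex _ (filter_and _ _ (H1 _ Hp2) (H2 _ Hp2))) as [x [Ha Hb]].
    assert (Cmod (a - b)%C <= Cmod (f x - b)%C + Cmod (f x - a)%C).
    { replace (a - b)%C with ((f x - b) - (f x - a))%C by ring. apply Cmod_minus. }
    lra.
Qed.

(** * Improper integrals on the half line *)

(** The integral over (0, oo) is recorded through a primitive with limits at both ends, so that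
    linearity, substitution and the fundamental theorem become limit statements about the primitive.
    [RInt_gen] is met only where [CGamma] is unfolded. *)
Definition is_CInt (f : R -> C) (l : C) : Prop :=
  exists (F : R -> C) (l0 : C),
    (forall x, 0 < x -> cderiv F x (f x)) /\
    clim F (at_right 0) l0 /\ clim F (Rbar_locally p_infty) (l0 + l)%C.

Lemma is_CInt_ext f g l : (forall x, 0 < x -> f x = g x) -> is_CInt f l -> is_CInt g l.
Proof.
  intros E (F & l0 & H1 & H2 & H3). exists F, l0; split; [|split]; auto.
  intros x Hx. rewrite <- E; auto.
Qed.

Lemma is_CInt_plus f g a b : is_CInt f a -> is_CInt g b -> is_CInt (fun x => f x + g x)%C (a + b)%C.
Proof.
  intros (F & l & H1 & H2 & H3) (G & m & H4 & H5 & H6).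
  exists (fun x => F x + G x)%C, (l + m)%C; split; [|split].
  - intros x Hx. apply cderiv_plus; auto.
  - apply clim_plus; auto; typeclasses eauto.
  - replace (l + m + (a + b))%C with (l + a + (m + b))%C by ring.
    apply clim_plus; auto; typeclasses eauto.
Qed.

Lemma is_CInt_scal c f a : is_CInt f a -> is_CInt (fun x => c * f x)%C (c * a)%C.
Proof.
  intros (F & l & H1 & H2 & H3).
  exists (fun x => c * F x)%C, (c * l)%C; split; [|split].
  - intros x Hx. apply cderiv_scal; auto.
  - apply clim_scal; auto; typeclasses eauto.
  - replace (c * l + c * a)%C with (c * (l + a))%C by ring.
    apply clim_scal; auto; typeclasses eauto.
Qed.

Lemma is_CInt_minus f g a b : is_CInt f a -> is_CInt g b -> is_CInt (fun x => f x - g x)%C (a - b)%C.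
Proof.
  intros H1 H2. replace (a - b)%C with (a + (-(1)) * b)%C by ring.
  eapply is_CInt_ext; [|apply is_CInt_plus; [exact H1 | apply is_CInt_scal; exact H2]].
  intros; simpl; ring.
Qed.

Lemma is_CInt_FTC F f l0 l1 : (forall x, 0 < x -> cderiv F x (f x)) ->
  clim F (at_right 0) l0 -> clim F (Rbar_locally p_infty) l1 -> is_CInt f (l1 - l0)%C.
Proof.
  intros H1 H2 H3. exists F, l0; split; [|split]; auto.
  now replace (l0 + (l1 - l0))%C with l1 by ring.
Qed.

(** Two primitives of one integrand differ by a constant on (0, oo), and this constant cancels
    between the two ends. *)
Lemma is_CInt_unique f a b : is_CInt f a -> is_CInt f b -> a = b.
Proof.
  intros (F & l & H1 & H2 & H3) (G & m & H4 & H5 & H6).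
  set (c := (F 1 - G 1)%C).
  assert (Hc : forall x, 0 < x -> (F x - G x)%C = c).
  { intros x Hx. unfold c.
    destruct (Rle_dec x 1).
    - apply (cderiv_zero_eq (fun x => (F x - G x)%C) (fun x => (f x - f x)%C)); auto.
      intros; apply cderiv_minus; [apply H1 | apply H4]; lra. intros; ring.
    - symmetry. apply (cderiv_zero_eq (fun x => (F x - G x)%C) (fun x => (f x - f x)%C)); auto; try lra.
      intros; apply cderiv_minus; [apply H1 | apply H4]; lra. intros; ring. }
  assert (E0 : (l - m)%C = c).
  { apply (clim_unique (at_right 0) (fun x => F x - G x)%C).
    - apply clim_minus; auto; typeclasses eauto.
    - apply clim_ext_loc with (f := fun _ => c).
      + typeclasses eauto.
      + apply at_right_0_iff. exists 1; split; [lra|]. intros; symmetry; apply Hc; lra.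
      + apply clim_const; typeclasses eauto. }
  assert (E1 : (l + a - (m + b))%C = c).
  { apply (clim_unique (Rbar_locally p_infty) (fun x => F x - G x)%C).
    - apply clim_minus; auto; typeclasses eauto.
    - apply clim_ext_loc with (f := fun _ => c).
      + typeclasses eauto.
      + exists 0. intros; symmetry; apply Hc; lra.
      + apply clim_const; typeclasses eauto. }
  replace a with (l + a - (m + b) - (l - m) + b)%C by ring. rewrite E0, E1; ring.
Qed.

Lemma clim_comp (F G : (R -> Prop) -> Prop) f (g : R -> R) l :
  clim f G l -> filterlim g F G -> clim (fun x => f (g x)) F l.
Proof. intros H1 H2 eps He. apply (H2 _ (H1 eps He)). Qed.

Lemma is_CInt_subst f l (g dg : R -> R) : is_CInt f l ->
  (forall x, 0 < x -> 0 < g x) -> (forall x, 0 < x -> is_derive g x (dg x)) ->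
  filterlim g (at_right 0) (at_right 0) -> filterlim g (Rbar_locally p_infty) (Rbar_locally p_infty) ->
  is_CInt (fun x => dg x * f (g x))%C l.
Proof.
  intros (F & l0 & H1 & H2 & H3) Hp Hd L0 L1.
  exists (fun x => F (g x)), l0; split; [|split].
  - intros x Hx. apply cderiv_comp; auto.
  - now apply clim_comp with (at_right 0).
  - now apply clim_comp with (Rbar_locally p_infty).
Qed.

Lemma is_CInt_scale f l lam : 0 < lam -> is_CInt f l -> is_CInt (fun x => lam * f (lam * x)%R)%C l.
Proof.
  intros Hl H. apply (is_CInt_subst f l (fun x => lam * x) (fun _ => lam)); auto.
  - intros; now apply Rmult_lt_0_compat.
  - intros; auto_derive; auto; ring.
  - intros P HP. apply at_right_0_iff in HP. destruct HP as (d & Hd & HP).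
    apply at_right_0_iff. exists (d / lam); split; [now apply Rdiv_lt_0_compat|].
    intros x Hx. apply HP. split; [apply Rmult_lt_0_compat; lra|].
    apply Rmult_lt_reg_r with (/ lam). now apply Rinv_0_lt_compat.
    replace (lam * x * / lam) with x by (field; lra). apply Hx.
  - intros P [M HP]. exists (M / lam). intros x Hx. apply HP.
    apply Rmult_lt_reg_r with (/ lam). now apply Rinv_0_lt_compat.
    replace (lam * x * / lam) with x by (field; lra). apply Hx.
Qed.

(** The substitution t = eps x^2/2, which carries a Gamma integral into a Gaussian transform. *)
Lemma is_CInt_sqr f l eps : 0 < eps -> is_CInt f l ->
  is_CInt (fun x => (eps * x)%R * f (eps * (x ^ 2 / 2))%R)%C l.
Proof.
  intros Hl H. apply (is_CInt_subst f l (fun x => eps * (x ^ 2 / 2)) (fun x => eps * x)); auto.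
  - intros; apply Rmult_lt_0_compat; auto. nra.
  - intros; auto_derive; auto; field.
  - intros P HP. apply at_right_0_iff in HP. destruct HP as (d & Hd & HP).
    apply at_right_0_iff. exists (Rmin 1 (d / eps)).
    assert (0 < d / eps) by now apply Rdiv_lt_0_compat.
    split; [apply Rmin_glb_lt; lra|].
    intros x Hx. generalize (Rmin_l 1 (d / eps)) (Rmin_r 1 (d / eps)); intros M1 M2.
    apply HP. split; [apply Rmult_lt_0_compat; nra|].
    replace d with (eps * (d / eps)) by (field; lra). apply Rmult_lt_compat_l; nra.
  - intros P [M HP]. exists (Rmax 2 (M / eps)). intros x Hx.
    generalize (Rmax_l 2 (M / eps)) (Rmax_r 2 (M / eps)); intros M1 M2. apply HP.
    replace M with (eps * (M / eps)) by (field; lra). apply Rmult_lt_compat_l; nra.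
Qed.

(** * Domination by one explicit integrable majorant *)

Definition Wroot (y : R) : R := Rpower y (1 / 4).
Definition Wprim (y : R) : R := - / (1 + Wroot y).
(* [Wmaj] is of order y^(-3/4) at 0 and y^(-5/4) at infinity, with an explicit primitive. *)
Definition Wmaj (y : R) : R := Wroot y / (4 * y * (1 + Wroot y) ^ 2).

Lemma Wroot_pos y : 0 < Wroot y.
Proof. apply exp_pos. Qed.

Lemma is_derive_Wprim y : 0 < y -> is_derive Wprim y (Wmaj y).
Proof.
  intros Hy. generalize (Wroot_pos y); intros Hp.
  assert (HR : is_derive Wroot y (Wroot y / (4 * y))).
  { unfold Wroot, Rpower. auto_derive; auto. field; lra. }
  unfold Wprim.
  eapply is_derive_eq. apply @is_derive_opp. apply is_derive_inv; [|lra].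
  apply @is_derive_plus; [apply @is_derive_const | exact HR].
  unfold plus, opp, zero, Wmaj; simpl. field. split; lra.
Qed.

Lemma Wprim_bounds y : -1 <= Wprim y <= 0.
Proof.
  unfold Wprim. generalize (Wroot_pos y); intros Hp.
  assert (0 < / (1 + Wroot y)) by (apply Rinv_0_lt_compat; lra).
  assert (/ (1 + Wroot y) <= / 1) by (apply Rinv_le_contravar; lra). lra.
Qed.

Lemma monotone_limits (H : R -> R) (B : R) :
  (forall x y, 0 < x -> x <= y -> H x <= H y) -> (forall x, 0 < x -> Rabs (H x) <= B) ->
  exists l0 l1, filterlim H (at_right 0) (locally l0) /\ filterlim H (Rbar_locally p_infty) (locally l1).
Proof.
  intros Hm Hb.
  destruct (completeness (fun v => exists x, 0 < x /\ v = - H x)) as [m0 [M1 M2]].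
  { exists B. intros v (x & Hx & ->). generalize (Hb x Hx); intros E. apply Rabs_le_between in E; lra. }
  { exists (- H 1), 1; split; [lra | auto]. }
  destruct (completeness (fun v => exists x, 0 < x /\ v = H x)) as [m1 [N1 N2]].
  { exists B. intros v (x & Hx & ->). generalize (Hb x Hx); intros E. apply Rabs_le_between in E; lra. }
  { exists (H 1), 1; split; [lra | auto]. }
  exists (- m0), m1; split.
  - intros P [d Hd].
    destruct (Classical_Prop.classic (exists x, 0 < x /\ m0 - d < - H x)) as [(x & Hx & Hx2) | Hn].
    + apply at_right_0_iff. exists x; split; auto. intros t Ht. apply Hd.
      unfold ball; simpl; unfold AbsRing_ball, abs, minus, plus, opp; simpl.
      assert (- H t <= m0) by (apply M1; exists t; split; [lra|auto]).
      generalize (Hm t x ltac:(lra) ltac:(lra)); intros. apply Rabs_def1; lra.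
    + exfalso. assert (m0 <= m0 - d).
      { apply M2. intros v (x & Hx & ->). apply Rnot_lt_le. intros Hlt. apply Hn. now exists x. }
      generalize (cond_pos d); lra.
  - intros P [d Hd].
    destruct (Classical_Prop.classic (exists x, 0 < x /\ m1 - d < H x)) as [(x & Hx & Hx2) | Hn].
    + exists x. intros t Ht. apply Hd.
      unfold ball; simpl; unfold AbsRing_ball, abs, minus, plus, opp; simpl.
      assert (H t <= m1) by (apply N1; exists t; split; [lra|auto]).
      generalize (Hm x t ltac:(lra) ltac:(lra)); intros. apply Rabs_def1; lra.
    + exfalso. assert (m1 <= m1 - d).
      { apply N2. intros v (x & Hx & ->). apply Rnot_lt_le. intros Hlt. apply Hn. now exists x. }
      generalize (cond_pos d); lra.
Qed.

(** Since f = ((f + g) - (g - f)) / 2, a function that is not monotone gets its limit from two that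
    are. *)
Lemma rlim_half (Fi : (R -> Prop) -> Prop) {PF : Filter Fi} (f g : R -> R) a b :
  filterlim (fun x => f x + g x) Fi (locally a) -> filterlim (fun x => g x - f x) Fi (locally b) ->
  filterlim f Fi (locally ((a - b) / 2)).
Proof.
  intros Ha Hb P [d Hd].
  generalize (Ha _ (locally_ball _ d)) (Hb _ (locally_ball _ d)); intros H1 H2.
  unfold filtermap, ball in H1, H2; simpl in H1, H2; unfold AbsRing_ball, abs, minus, plus, opp in H1, H2; simpl in H1, H2.
  change (Fi (fun x => P (f x))). apply (filter_imp (fun x => Rabs (f x + g x + - a) < d /\ Rabs (g x - f x + - b) < d)); [|exact (@filter_and R Fi PF _ _ H1 H2)].
  intros x [E1 E2]. apply Hd.
  unfold ball; simpl; unfold AbsRing_ball, abs, minus, plus, opp; simpl.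
  apply Rabs_def2 in E1. apply Rabs_def2 in E2. apply Rabs_def1; lra.
Qed.

Lemma is_derive_RInt_pos (f : R -> R) (x : R) : 0 < x -> (forall t, 0 < t -> continuous f t) ->
  is_derive (fun y => RInt f 1 y) x (f x).
Proof.
  intros Hx Hc. apply @is_derive_RInt with (a := 1).
  - exists (mkposreal x Hx). intros y Hy.
    unfold ball in Hy; simpl in Hy; unfold AbsRing_ball, abs, minus, plus, opp in Hy; simpl in Hy.
    apply Rabs_def2 in Hy. apply @RInt_correct, @ex_RInt_continuous. intros z Hz. apply Hc.
    assert (0 < Rmin 1 y) by (apply Rmin_glb_lt; lra). lra.
  - now apply Hc.
Qed.

(** With G a primitive of the majorant, F + K G and K G - F both increase and are bounded, so F
    converges at both ends. As G takes values in [-1, 0], the total increment of F is at most K. The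
    scale [lam] leaves this bound unchanged, which makes the later estimates uniform in eps, with
    [lam] = sqrt eps. *)
Lemma dominated_primitive (f : R -> R) (K lam : R) : 0 < lam -> 0 <= K ->
  (forall t, 0 < t -> continuous f t) ->
  (forall t, 0 < t -> Rabs (f t) <= K * (lam * Wmaj (lam * t))) ->
  exists (F : R -> R) (l0 l1 : R), (forall x, 0 < x -> is_derive F x (f x)) /\
   filterlim F (at_right 0) (locally l0) /\ filterlim F (Rbar_locally p_infty) (locally l1) /\
   Rabs (l1 - l0) <= K.
Proof.
  intros Hl HK Hc Hb.
  set (G := fun t => Wprim (lam * t)).
  assert (HG : forall t, 0 < t -> is_derive G t (lam * Wmaj (lam * t))).
  { intros t Ht.
    assert (D : is_derive (fun t => lam * t) t lam) by (auto_derive; auto; ring).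
    exact (is_derive_comp Wprim (fun t => lam * t) t _ _ (is_derive_Wprim _ (Rmult_lt_0_compat _ _ Hl Ht)) D). }
  set (F := fun y => RInt f 1 y).
  assert (HF : forall t, 0 < t -> is_derive F t (f t)) by (intros; now apply is_derive_RInt_pos).
  assert (HGb : forall t, -1 <= G t <= 0) by (intros; apply Wprim_bounds).
  assert (Hp : forall x y, 0 < x -> x <= y -> F x + K * G x <= F y + K * G y).
  { intros x y Hx Hxy.
    apply (is_derive_nonneg_le (fun t => F t + K * G t) (fun t => f t + K * (lam * Wmaj (lam * t)))); auto.
    - intros t Ht. apply @is_derive_plus; [apply HF; lra|]. apply is_derive_scal, HG; lra.
    - intros t Ht. generalize (Hb t ltac:(lra)); intros E; apply Rabs_le_between in E; lra. }
  assert (Hq : forall x y, 0 < x -> x <= y -> K * G x - F x <= K * G y - F y).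
  { intros x y Hx Hxy.
    apply (is_derive_nonneg_le (fun t => K * G t - F t) (fun t => K * (lam * Wmaj (lam * t)) - f t)); auto.
    - intros t Ht. apply @is_derive_minus; [|apply HF; lra]. apply is_derive_scal, HG; lra.
    - intros t Ht. generalize (Hb t ltac:(lra)); intros E; apply Rabs_le_between in E; lra. }
  assert (F1 : F 1 = 0) by (unfold F; apply @RInt_point).
  assert (Hbd : forall x y, 0 < x -> x <= y -> Rabs (F y - F x) <= K).
  { intros x y Hx Hy. generalize (Hp x y Hx Hy) (Hq x y Hx Hy) (HGb x) (HGb y); intros.
    apply Rabs_le. split; nra. }
  destruct (monotone_limits (fun x => F x + K * G x) (2 * K)) as (a0 & a1 & A0 & A1); auto.
  { intros x Hx. assert (Rabs (F x) <= K).
    { destruct (Rle_dec x 1).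
      - generalize (Hbd x 1 Hx r). rewrite F1. intros E. apply Rabs_le_between in E. apply Rabs_le; lra.
      - generalize (Hbd 1 x ltac:(lra) ltac:(lra)). rewrite F1. intros E. now replace (F x) with (F x - 0) by ring. }
    apply Rabs_le_between in H. generalize (HGb x); intros. apply Rabs_le; nra. }
  destruct (monotone_limits (fun x => K * G x - F x) (2 * K)) as (b0 & b1 & B0 & B1); auto.
  { intros x Hx. assert (Rabs (F x) <= K).
    { destruct (Rle_dec x 1).
      - generalize (Hbd x 1 Hx r). rewrite F1. intros E. apply Rabs_le_between in E. apply Rabs_le; lra.
      - generalize (Hbd 1 x ltac:(lra) ltac:(lra)). rewrite F1. intros E. now replace (F x) with (F x - 0) by ring. }
    apply Rabs_le_between in H. generalize (HGb x); intros. apply Rabs_le; nra. }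
  assert (HL : forall (Fi : (R -> Prop) -> Prop) {PF : Filter Fi} a b,
     filterlim (fun x => F x + K * G x) Fi (locally a) -> filterlim (fun x => K * G x - F x) Fi (locally b) ->
     filterlim F Fi (locally ((a - b) / 2))).
  { intros Fi PF a b Ha Hb'.
    exact (rlim_half Fi F (fun x => K * G x) a b Ha Hb'). }
  exists F, ((a0 - b0) / 2), ((a1 - b1) / 2). split; [|split; [|split]]; auto.
  - apply HL; auto; typeclasses eauto.
  - apply HL; auto; typeclasses eauto.
  - apply le_epsilon. intros eps He.
    assert (L0 : filterlim F (at_right 0) (locally ((a0 - b0) / 2))) by (apply HL; auto; typeclasses eauto).
    assert (L1 : filterlim F (Rbar_locally p_infty) (locally ((a1 - b1) / 2))) by (apply HL; auto; typeclasses eauto).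
    assert (He2 : 0 < eps / 2) by lra.
    specialize (L0 _ (locally_ball _ (mkposreal _ He2))). specialize (L1 _ (locally_ball _ (mkposreal _ He2))).
    unfold filtermap, ball in L0, L1; simpl in L0, L1; unfold AbsRing_ball, abs, minus, plus, opp in L0, L1; simpl in L0, L1.
    apply at_right_0_iff in L0. destruct L0 as (d & Hd & L0). destruct L1 as [M L1].
    set (x := Rmin (d / 2) 1). assert (0 < x) by (apply Rmin_glb_lt; lra).
    assert (x <= d / 2) by apply Rmin_l. assert (x <= 1) by apply Rmin_r.
    set (y := Rmax (M + 1) 1). assert (M + 1 <= y) by apply Rmax_l. assert (1 <= y) by apply Rmax_r.
    specialize (L0 x ltac:(lra)). specialize (L1 y ltac:(lra)).
    generalize (Hbd x y ltac:(lra) ltac:(lra)); intros E.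
    apply Rabs_le_between in E. apply Rabs_def2 in L0. apply Rabs_def2 in L1. apply Rabs_le. lra.
Qed.

Lemma clim_pair (Fi : (R -> Prop) -> Prop) {PF : Filter Fi} f (a b : R) :
  filterlim (fun x => Re (f x)) Fi (locally a) -> filterlim (fun x => Im (f x)) Fi (locally b) ->
  clim f Fi (a, b).
Proof.
  intros H1 H2 eps He. assert (He2 : 0 < eps / 2) by lra.
  specialize (H1 _ (locally_ball _ (mkposreal _ He2))). specialize (H2 _ (locally_ball _ (mkposreal _ He2))).
  unfold filtermap, ball in H1, H2; simpl in H1, H2; unfold AbsRing_ball, abs, minus, plus, opp in H1, H2; simpl in H1, H2.
  refine (filter_imp _ _ _ (filter_and _ _ H1 H2)). intros x [Ha Hb].
  eapply Rle_lt_trans; [apply Cmod_le_abs|]. unfold Re, Im in *; simpl. unfold Rminus in *. lra.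
Qed.

Lemma is_CInt_dom (f : R -> C) (K lam : R) : 0 < lam -> 0 <= K ->
  (forall t, 0 < t -> ccont f t) ->
  (forall t, 0 < t -> Cmod (f t) <= K * (lam * Wmaj (lam * t))) ->
  exists l, is_CInt f l /\ Cmod l <= 2 * K.
Proof.
  intros Hl HK Hc Hb.
  destruct (dominated_primitive (fun t => Re (f t)) K lam) as (F & l0 & l1 & D & L0 & L1 & B); auto.
  { intros; now apply Hc. }
  { intros. eapply Rle_trans; [apply Cmod_Re|]. auto. }
  destruct (dominated_primitive (fun t => Im (f t)) K lam) as (G & m0 & m1 & D' & L0' & L1' & B'); auto.
  { intros; now apply Hc. }
  { intros. eapply Rle_trans; [apply Cmod_Im|]. auto. }
  exists ((l1 - l0)%R, (m1 - m0)%R). split.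
  - exists (fun x => (F x, G x)), (l0, m0). split; [|split].
    + intros x Hx; split; simpl; auto.
    + apply clim_pair; auto; typeclasses eauto.
    + replace ((l0, m0) + ((l1 - l0)%R, (m1 - m0)%R))%C with (l1, m1) by (apply C_ext; simpl; ring).
      apply clim_pair; auto; typeclasses eauto.
  - eapply Rle_trans; [apply Cmod_le_abs|]. simpl; lra.
Qed.

(** Every quantitative estimate below has this form: the difference of two known integrals is the
    integral of a small integrand. The factor 2 adds the real and the imaginary part. *)
Lemma is_CInt_bound (f : R -> C) (K lam : R) l : 0 < lam -> 0 <= K ->
  (forall t, 0 < t -> ccont f t) ->
  (forall t, 0 < t -> Cmod (f t) <= K * (lam * Wmaj (lam * t))) ->
  is_CInt f l -> Cmod l <= 2 * K.
Proof.
  intros Hl HK Hc Hb H. destruct (is_CInt_dom f K lam) as (l' & H1 & H2); auto.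
  now rewrite (is_CInt_unique _ _ _ H H1).
Qed.

Lemma is_CInt_RInt_gen (f : R -> C) l : (forall t, 0 < t -> ccont f t) -> is_CInt f l ->
  RInt_gen (V := C_R_CompleteNormedModule) f (at_right 0) (Rbar_locally p_infty) = l.
Proof.
  intros Hc (F & l0 & D & L0 & L1).
  apply @is_RInt_gen_unique; [typeclasses eauto .. |].
  intros P [d Hd].
  assert (He2 : 0 < d / 2) by (generalize (cond_pos d); lra).
  generalize (L0 _ He2) (L1 _ He2); intros M0 M1.
  apply at_right_0_iff in M0. destruct M0 as (e & He & M0). destruct M1 as [M M1].
  apply (Filter_prod _ _ _ (fun x => 0 < x < e) (fun x => Rmax M 0 < x)).
  - apply at_right_0_iff. now exists e.
  - now exists (Rmax M 0).
  - intros x y Hx Hy. generalize (Rmax_l M 0) (Rmax_r M 0); intros R1 R2.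
    exists (F y - F x)%C. split.
    + simpl. apply (is_RInt_fct_extend_pair f x y (Re (F y) - Re (F x)) (Im (F y) - Im (F x))).
      * apply (is_RInt_derive (fun t => Re (F t)) (fun t => Re (f t))).
        -- intros t Ht. apply D. assert (0 < Rmin x y) by (apply Rmin_glb_lt; lra). lra.
        -- intros t Ht. apply Hc. assert (0 < Rmin x y) by (apply Rmin_glb_lt; lra). lra.
      * apply (is_RInt_derive (fun t => Im (F t)) (fun t => Im (f t))).
        -- intros t Ht. apply D. assert (0 < Rmin x y) by (apply Rmin_glb_lt; lra). lra.
        -- intros t Ht. apply Hc. assert (0 < Rmin x y) by (apply Rmin_glb_lt; lra). lra.
    + apply Hd. specialize (M0 x Hx). specialize (M1 y ltac:(lra)).
      assert (HH : Cmod (F y - F x - l)%C < d).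
      { replace (F y - F x - l)%C with ((F y - (l0 + l)) - (F x - l0))%C by ring.
        eapply Rle_lt_trans; [apply Cmod_minus|]. lra. }
      generalize (Cmod_Re (F y - F x - l)%C) (Cmod_Im (F y - F x - l)%C); intros.
      unfold Re, Im in *.
      split; unfold ball; simpl; unfold AbsRing_ball, abs, minus, plus, opp; simpl in *; unfold Rminus in *; lra.
Qed.

(** The 16 is 4 * 4: with r = y^(1/4), (1 + r)^2 <= 4 for y <= 1, and (1 + r)^2 <= 4 r^2 with r <= y
    for y >= 1. *)
Lemma Wmaj_dom (h : R -> R) (K : R) :
  (forall y, 0 < y <= 1 -> h y <= K * Rpower y (- (3 / 4))) ->
  (forall y, 1 <= y -> h y <= K / y ^ 2) -> 0 <= K ->
  forall y, 0 < y -> h y <= 16 * K * Wmaj y.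
Proof.
  intros H1 H2 HK y Hy. generalize (Wroot_pos y); intros Hr.
  assert (E4 : Wroot y = y * Rpower y (- (3 / 4))).
  { rewrite <- (Rpower_1 y) at 2 by auto. rewrite <- Rpower_plus. unfold Wroot. f_equal. lra. }
  unfold Wmaj. destruct (Rle_dec y 1) as [Hy1 | Hy1].
  - eapply Rle_trans; [apply H1; lra|].
    assert (Hr1 : Wroot y <= 1).
    { unfold Wroot. apply Rle_trans with (Rpower y 0); [|rewrite Rpower_O; lra]. unfold Rpower. apply exp_le_compat.
      assert (ln y <= 0) by (rewrite <- ln_1; apply ln_le; lra). nra. }
    set (q := Rpower y (- (3 / 4))) in *. assert (Hq : 0 < q) by apply exp_pos.
    replace (16 * K * (Wroot y / (4 * y * (1 + Wroot y) ^ 2))) with (K * (q * (4 / (1 + Wroot y) ^ 2))).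
    2:{ rewrite E4. field. rewrite <- E4. split; lra. }
    apply Rmult_le_compat_l; auto. rewrite <- (Rmult_1_r q) at 1. apply Rmult_le_compat_l; [lra|].
    apply Rmult_le_reg_r with ((1 + Wroot y) ^ 2). nra.
    unfold Rdiv. rewrite Rmult_assoc, Rinv_l by nra. nra.
  - eapply Rle_trans; [apply H2; lra|].
    assert (Hr1 : 1 <= Wroot y).
    { unfold Wroot. apply Rle_trans with (Rpower y 0); [rewrite Rpower_O; lra|]. apply Rle_Rpower; lra. }
    assert (Hr2 : Wroot y <= y).
    { unfold Wroot. rewrite <- (Rpower_1 y) at 2 by auto. apply Rle_Rpower; lra. }
    set (r := Wroot y) in *.
    replace (16 * K * (r / (4 * y * (1 + r) ^ 2))) with (K * (4 * r / (y * (1 + r) ^ 2))).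
    2:{ field. split; lra. }
    unfold Rdiv at 1. apply Rmult_le_compat_l; auto.
    apply Rmult_le_reg_r with (y ^ 2 * (y * (1 + r) ^ 2)). { apply Rmult_lt_0_compat; [nra|]. apply Rmult_lt_0_compat; nra. }
    replace (/ y ^ 2 * (y ^ 2 * (y * (1 + r) ^ 2))) with (y * (1 + r) ^ 2) by (field; lra).
    replace (4 * r / (y * (1 + r) ^ 2) * (y ^ 2 * (y * (1 + r) ^ 2))) with (4 * r * y ^ 2) by (field; split; lra).
    apply Rle_trans with (y * (4 * r ^ 2)). { apply Rmult_le_compat_l; nra. }
    assert (0 <= 4 * r * y * (y - r)). { apply Rmult_le_pos; [|lra]. apply Rmult_le_pos; lra. } nra.
Qed.

(** With N = n + 1, raise u/N <= e^(u/N) to the power N. *)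
Lemma pow_le_exp (n : nat) (u : R) : 0 <= u -> u ^ S n <= INR (S n) ^ S n * exp u.
Proof.
  intros Hu. assert (Hn : 0 < INR (S n)) by (apply lt_0_INR; lia).
  replace (exp u) with (exp (u / INR (S n)) ^ S n).
  - rewrite <- Rpow_mult_distr. apply pow_incr. split; auto.
    assert (u / INR (S n) <= exp (u / INR (S n))). { generalize (exp_ineq1_le (u / INR (S n))); lra. }
    apply Rle_trans with (INR (S n) * (u / INR (S n))). right; field; lra.
    apply Rmult_le_compat_l; lra.
  - rewrite exp_pow_INR. f_equal. field. lra.
Qed.

Lemma Rpower_le_neg (y a b : R) : 0 < y <= 1 -> b <= a -> Rpower y a <= Rpower y b.
Proof.
  intros Hy Hab. unfold Rpower. apply exp_le_compat.
  assert (ln y <= 0) by (rewrite <- ln_1; apply ln_le; lra). nra.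
Qed.

Lemma Rpower_ge_1_neg (y a : R) : 0 < y <= 1 -> a <= 0 -> 1 <= Rpower y a.
Proof. intros. rewrite <- (Rpower_O y) by lra. apply Rpower_le_neg; lra. Qed.

Lemma gauss_poly (eps : R) (n : nat) : 0 < eps ->
  exists K, 0 <= K /\ forall y, 0 <= y -> exp (- (eps * (y ^ 2 / 2))) * (1 + y) ^ n <= K.
Proof.
  intros He.
  (* Chosen so that 1 + y <= c (1 + u) for u = eps y^2/2: the polynomial in y becomes a power of 1 +
     u, which e^(1 + u) absorbs. *)
  set (c := 2 + 2 / eps). assert (Hc : 0 < c). { unfold c. assert (0 < 2 / eps) by (apply Rdiv_lt_0_compat; lra). lra. }
  exists (c ^ S n * (INR (S n) ^ S n * exp 1)). split.
  { apply Rmult_le_pos; [apply pow_le; lra|]. apply Rmult_le_pos; [apply pow_le, pos_INR | left; apply exp_pos]. }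
  intros y Hy. set (u := eps * (y ^ 2 / 2)). assert (Hu : 0 <= u) by (unfold u; apply Rmult_le_pos; nra).
  apply Rle_trans with (exp (- u) * (c ^ S n * (INR (S n) ^ S n * exp (1 + u)))).
  - apply Rmult_le_compat_l; [left; apply exp_pos|].
    apply Rle_trans with ((1 + y) ^ S n). { simpl. assert (0 <= (1 + y) ^ n) by (apply pow_le; lra). nra. }
    apply Rle_trans with ((c * (1 + u)) ^ S n).
    + apply pow_incr. split; [lra|].
      assert (y ^ 2 = 2 / eps * u) by (unfold u; field; lra).
      assert (c * (1 + u) = 2 + 2 / eps + 2 * u + y ^ 2) by (rewrite H; unfold c; ring).
      assert (0 < 2 / eps) by (apply Rdiv_lt_0_compat; lra). nra.
    + rewrite Rpow_mult_distr. apply Rmult_le_compat_l; [apply pow_le; lra|]. apply pow_le_exp; lra.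
  - rewrite exp_plus. right.
    transitivity (exp (- u) * exp u * (c ^ S n * (INR (S n) ^ S n * exp 1))). ring.
    rewrite <- exp_plus, Rplus_opp_l, exp_0. ring.
Qed.

Lemma gauss_maj (eps : R) (n : nat) : 0 < eps ->
  exists K, 0 <= K /\ forall y, 0 < y -> exp (- (eps * (y ^ 2 / 2))) * (1 + y) ^ n <= K * Wmaj y.
Proof.
  (* Two more powers than asked for supply the decay y^(-2) at infinity. *)
  intros He. destruct (gauss_poly eps (S (S n)) He) as (K & HK & HB).
  exists (16 * K); split; [lra|].
  apply Wmaj_dom; auto.
  - intros y Hy. apply Rle_trans with (K * 1).
    + rewrite Rmult_1_r. eapply Rle_trans; [|apply (HB y); lra].
      apply Rmult_le_compat_l; [left; apply exp_pos|]. apply Rle_pow; [lra|lia].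
    + apply Rmult_le_compat_l; auto. apply Rpower_ge_1_neg; lra.
  - intros y Hy. apply Rmult_le_reg_r with (y ^ 2). nra.
    unfold Rdiv. rewrite (Rmult_assoc K), Rinv_l, Rmult_1_r by nra.
    eapply Rle_trans; [|apply (HB y); lra]. rewrite Rmult_assoc.
    apply Rmult_le_compat_l; [left; apply exp_pos|].
    assert (0 <= (1 + y) ^ n) by (apply pow_le; lra).
    assert (0 <= (1 + y) ^ n * ((1 + y) ^ 2 - y ^ 2)) by (apply Rmult_le_pos; nra).
    simpl pow in *. lra.
Qed.

(** One constant serves all exponents: -3/4 is the singularity of [Wmaj] at 0, and the exponents met
    later, 1/2 and 2 Re z - 3/2 with 1/2 <= Re z <= 1, lie well inside the range. *)
Lemma gauss_rpower : exists K, 0 <= K /\ forall a y, - (3 / 4) <= a <= 1 -> 0 < y ->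
  exp (- (y ^ 2 / 2)) * Rpower y a <= K * Wmaj y.
Proof.
  destruct (gauss_poly 1 3 ltac:(lra)) as (K & HK & HB).
  exists (16 * (K + 1)); split; [lra|]. intros a y Ha.
  revert y. apply Wmaj_dom; try lra.
  - intros y Hy. assert (0 < Rpower y a) by apply exp_pos.
    assert (Rpower y a <= Rpower y (- (3 / 4))) by (apply Rpower_le_neg; lra).
    assert (exp (- (y ^ 2 / 2)) <= 1). { rewrite <- exp_0. apply exp_le_compat. nra. }
    assert (0 < exp (- (y ^ 2 / 2))) by apply exp_pos. nra.
  - intros y Hy. apply Rmult_le_reg_r with (y ^ 2). nra.
    unfold Rdiv. rewrite (Rmult_assoc (K + 1)), Rinv_l, Rmult_1_r by nra.
    apply Rle_trans with K; [|lra].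
    eapply Rle_trans; [|apply (HB y); lra]. rewrite Rmult_1_l, Rmult_assoc.
    apply Rmult_le_compat_l; [left; apply exp_pos|].
    assert (Rpower y a <= y). { rewrite <- (Rpower_1 y) at 2 by lra. apply Rle_Rpower; lra. }
    assert (0 < Rpower y a) by apply exp_pos.
    assert (y * y ^ 2 <= (1 + y) ^ 3) by nra. nra.
Qed.

Lemma log_poly (c : R) : 0 < c -> exists K, 1 <= K /\ forall u, 0 <= u -> 1 + u ^ 2 <= K * exp (c * u).
Proof.
  intros Hc. exists (1 + 4 / c ^ 2).
  assert (0 < 4 / c ^ 2) by (apply Rdiv_lt_0_compat; nra). split; [lra|]. intros u Hu.
  generalize (pow_le_exp 1 (c * u) ltac:(nra)). change (INR 2 ^ 2) with ((1 + 1) ^ 2). intros E.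
  assert (1 <= exp (c * u)) by (generalize (exp_ineq1_le (c * u)); nra).
  assert (u ^ 2 = (c * u) ^ 2 / c ^ 2) by (field; lra).
  assert (u ^ 2 <= 4 / c ^ 2 * exp (c * u)).
  { rewrite H1. unfold Rdiv. rewrite (Rmult_comm 4), Rmult_assoc, Rmult_comm. apply Rmult_le_compat_l.
    left; apply Rinv_0_lt_compat; nra. lra. }
  nra.
Qed.

(** Here b stands for Re z - 1. The strip 1/2 <= Re z <= 1 is widened by 1/8 on both sides to leave
    room for increments of z, and the logarithm costs another factor t^(-1/8) near 0, which exhausts
    the exponent -3/4. The weight 1 + ln^2 covers the integrand, its derivative in z and the
    quadratic remainder. *)
Lemma gamma_maj : exists K, 0 <= K /\ forall b t, - (5 / 8) <= b <= 1 / 8 -> 0 < t ->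
  exp (- t) * Rpower t b * (1 + ln t ^ 2) <= K * Wmaj t.
Proof.
  destruct (log_poly (1 / 8) ltac:(lra)) as (K1 & HK1 & B1).
  set (K := 256 * K1). exists (16 * K); split; [unfold K; lra|]. intros b t Hb.
  revert t. apply Wmaj_dom; try (unfold K; lra).
  - intros t Ht.
    assert (Hl : ln t <= 0) by (rewrite <- ln_1; apply ln_le; lra).
    generalize (B1 (- ln t) ltac:(lra)). replace ((- ln t) ^ 2) with (ln t ^ 2) by ring. intros E.
    assert (0 < Rpower t b) by apply exp_pos.
    assert (exp (- t) <= 1). { rewrite <- exp_0. apply exp_le_compat. lra. }
    assert (0 < exp (- t)) by apply exp_pos.
    apply Rle_trans with (Rpower t b * (K1 * exp (1 / 8 * - ln t))).
    { assert (0 <= Rpower t b * (1 + ln t ^ 2)) by nra.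
      apply Rle_trans with (1 * (Rpower t b * (1 + ln t ^ 2))); [rewrite Rmult_assoc; apply Rmult_le_compat_r; auto|].
      rewrite Rmult_1_l. apply Rmult_le_compat_l; lra. }
    replace (Rpower t b * (K1 * exp (1 / 8 * - ln t))) with (K1 * Rpower t (b - 1 / 8)).
    2:{ unfold Rminus. rewrite Rpower_plus. unfold Rpower at 2. replace (- (1 / 8) * ln t) with (1 / 8 * - ln t) by ring. ring. }
    assert (Rpower t (b - 1 / 8) <= Rpower t (- (3 / 4))) by (apply Rpower_le_neg; lra).
    assert (0 < Rpower t (- (3 / 4))) by apply exp_pos. unfold K. nra.
  - intros t Ht. apply Rmult_le_reg_r with (t ^ 2). nra.
    unfold Rdiv. rewrite (Rmult_assoc K), Rinv_l, Rmult_1_r by nra.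
    assert (Hl : 0 <= ln t) by (rewrite <- ln_1; apply ln_le; lra).
    generalize (B1 (ln t) ltac:(lra)). intros E.
    assert (Hr : exp (1 / 8 * ln t) <= t).
    { change (Rpower t (1 / 8) <= t). rewrite <- (Rpower_1 t) at 2 by lra. apply Rle_Rpower; lra. }
    assert (Hb' : Rpower t b <= t). { rewrite <- (Rpower_1 t) at 2 by lra. apply Rle_Rpower; lra. }
    assert (0 < Rpower t b) by apply exp_pos. assert (0 < exp (- t)) by apply exp_pos.
    generalize (pow_le_exp 3 t ltac:(lra)). intros E4.
    (* The bound e^(-t) t^4 <= 256 is the origin of the 256 in [K]; the four powers are t for t^b, t
       for the logarithm and t^2 for the required decay. *)
    replace (INR 4 ^ 4) with 256 in E4 by (simpl; ring).
    apply Rle_trans with (exp (- t) * (t * (K1 * t)) * t ^ 2).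
    { apply Rmult_le_compat_r; [nra|]. rewrite Rmult_assoc. apply Rmult_le_compat_l; [lra|].
      apply Rmult_le_compat; nra. }
    apply Rle_trans with (exp (- t) * (K1 * (256 * exp t))).
    { rewrite Rmult_assoc. apply Rmult_le_compat_l; [lra|].
      replace (t * (K1 * t) * t ^ 2) with (K1 * t ^ 4) by ring. apply Rmult_le_compat_l; lra. }
    right. transitivity (K * (exp (- t) * exp t)). unfold K; ring.
    rewrite <- exp_plus, Rplus_opp_l, exp_0. ring.
Qed.

(** * The Gamma function and its derivative *)

Lemma cderiv_ln (z : C) t : 0 < t -> cderiv (fun t => z * ln t)%C t (z * (/ t)%R)%C.
Proof. intros Ht. apply cderiv_scal, cderiv_RtoC. auto_derive; auto. field; lra. Qed.

Lemma ccont_cpow z t : 0 < t -> ccont (fun t => Cexp (z * ln t))%C t.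
Proof. intros Ht. eapply cderiv_ccont, cderiv_Cexp, cderiv_ln, Ht. Qed.

Lemma ccont_ln t : 0 < t -> ccont (fun t => RtoC (ln t)) t.
Proof. intros Ht. eapply cderiv_ccont, cderiv_RtoC. auto_derive; auto. Qed.

Lemma ccont_exp_opp t : ccont (fun t => RtoC (exp (- t))) t.
Proof. eapply cderiv_ccont, cderiv_RtoC. auto_derive; auto. Qed.

Lemma Cmod_cpow z t : Cmod (Cexp (z * ln t))%C = Rpower t (Re z).
Proof. rewrite Cmod_Cexp. unfold Rpower, Re, Im; simpl. f_equal; ring. Qed.

Definition gamma_integrand (z : C) (t : R) : C := (Cexp ((z - 1) * ln t) * exp (- t))%C.

Lemma Cmod_gamma_integrand z t : Cmod (gamma_integrand z t) = exp (- t) * Rpower t (Re z - 1).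
Proof.
  unfold gamma_integrand. rewrite Cmod_mult, Cmod_cpow, Cmod_RtoC by (left; apply exp_pos).
  rewrite Rmult_comm. reflexivity.
Qed.

Lemma ccont_gamma_integrand z t : 0 < t -> ccont (gamma_integrand z) t.
Proof. intros. apply ccont_mult; [now apply ccont_cpow | apply ccont_exp_opp]. Qed.

Lemma is_CInt_Gamma z : 3 / 8 <= Re z <= 9 / 8 -> is_CInt (gamma_integrand z) (CGamma z).
Proof.
  intros Hz. destruct gamma_maj as (K & HK & HB).
  destruct (is_CInt_dom (gamma_integrand z) K 1) as (l & H1 & _); try lra.
  - intros; now apply ccont_gamma_integrand.
  - intros t Ht. rewrite Cmod_gamma_integrand, !Rmult_1_l.
    eapply Rle_trans; [|apply (HB (Re z - 1)); lra].
    rewrite <- (Rmult_1_r (_ * _)) at 1. apply Rmult_le_compat_l; [|nra].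
    apply Rmult_le_pos; left; apply exp_pos.
  - replace (CGamma z) with l; auto. symmetry. apply (is_CInt_RInt_gen (gamma_integrand z)); auto.
    intros; now apply ccont_gamma_integrand.
Qed.

(** The remainder is bounded by exponentials on purpose: for x = h ln t they only shift the exponent
    of t by h and - h, and [gamma_maj] is uniform in that exponent. *)
Lemma exp_taylor2 x : Rabs (exp x - 1 - x) <= x ^ 2 * (exp x + exp (- x)).
Proof.
  generalize (exp_ineq1_le x) (exp_ineq1_le (- x)) (exp_pos x) (exp_pos (- x)); intros.
  assert (E : exp x * exp (- x) = 1) by (rewrite <- exp_plus, Rplus_opp_r; apply exp_0).
  assert (exp x - 1 <= x * exp x) by nra.
  rewrite Rabs_pos_eq by lra.
  destruct (Rle_dec 0 x); [|nra].
  apply Rle_trans with (x * (x * exp x)); [nra|]. assert (0 <= x ^ 2 * exp (- x)) by nra. nra.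
Qed.

(** Differentiation under the integral sign with a quadratic remainder, along real increments h.
    [C_derive] takes its limit along the horizontal line through z, so this is the derivative that
    [digamma] refers to. *)
Lemma is_CInt_Gamma' z : 1 / 2 <= Re z <= 1 ->
  exists G, is_CInt (fun t => gamma_integrand z t * ln t)%C G /\
   exists K, forall h, Rabs h <= 1 / 8 -> Cmod (CGamma (z + h) - CGamma z - h * G)%C <= K * h ^ 2.
Proof.
  intros Hz. destruct gamma_maj as (K & HK & HB).
  assert (Hc : forall t, 0 < t -> ccont (fun t => gamma_integrand z t * ln t)%C t).
  { intros; apply ccont_mult; [now apply ccont_gamma_integrand | now apply ccont_ln]. }
  destruct (is_CInt_dom (fun t => gamma_integrand z t * ln t)%C K 1) as (G & H1 & _); try lra; auto.
  - intros t Ht. rewrite Cmod_mult, Cmod_gamma_integrand, !Rmult_1_l, Cmod_R.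
    eapply Rle_trans; [|apply (HB (Re z - 1)); lra].
    apply Rmult_le_compat_l. apply Rmult_le_pos; left; apply exp_pos.
    rewrite <- (pow2_abs (ln t)). generalize (Rabs_pos (ln t)); nra.
  - exists G; split; auto. exists (2 * (2 * K)). intros h Hh.
    assert (Hh2 := Hh). apply Rabs_le_between in Hh2.
    assert (I : is_CInt (fun t => gamma_integrand (z + h) t - gamma_integrand z t - h * (gamma_integrand z t * ln t))%C
       (CGamma (z + h) - CGamma z - h * G)%C).
    { repeat apply is_CInt_minus.
      - apply is_CInt_Gamma. unfold Re in *; simpl; lra.
      - apply is_CInt_Gamma. lra.
      - now apply is_CInt_scal. }

    replace (2 * (2 * K) * h ^ 2) with (2 * (2 * K * h ^ 2)) by ring. apply (is_CInt_bound _ (2 * K * h ^ 2) 1 _) with (5 := I); try lra.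
    + nra.
    + intros; apply ccont_minus; [apply ccont_minus; now apply ccont_gamma_integrand |].
      apply ccont_mult; [apply ccont_const | auto].
    + intros t Ht.
      assert (E : Cexp ((z + h - 1) * ln t) = (Cexp ((z - 1) * ln t) * exp (h * ln t))%C).
      { rewrite <- Cexp_RtoC, <- Cexp_add. f_equal. rewrite RtoC_mult. ring. }
      replace (_ - _ - _)%C with (gamma_integrand z t * (exp (h * ln t) - 1 - h * ln t)%R)%C.
      2:{ unfold gamma_integrand. rewrite E, !RtoC_minus, RtoC_mult. ring. }
      rewrite Cmod_mult, Cmod_gamma_integrand, Cmod_R, Rmult_1_l.
      eapply Rle_trans. { apply Rmult_le_compat_l; [apply Rmult_le_pos; left; apply exp_pos | apply exp_taylor2]. }
      generalize (HB (Re z - 1 + h) t ltac:(lra) Ht) (HB (Re z - 1 + - h) t ltac:(lra) Ht).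
      rewrite !Rpower_plus. unfold Rpower at 2 4. rewrite <- Ropp_mult_distr_l.
      set (P := exp (- t) * Rpower t (Re z - 1)). intros B1 B2.
      assert (0 < exp (- t)) by apply exp_pos. assert (0 < Rpower t (Re z - 1)) by apply exp_pos.
      assert (0 < P) by (unfold P; nra). rewrite <- Rmult_assoc in B1, B2. fold P in B1, B2.
      generalize (exp_pos (h * ln t)) (exp_pos (- (h * ln t))); intros E1 E2. rewrite ?Rmult_1_l.
      set (e1 := exp (h * ln t)) in *. set (e2 := exp (- (h * ln t))) in *.
      assert (P * (e1 + e2) * ln t ^ 2 <= 2 * K * Wmaj t). { assert (0 <= P * e1) by nra. assert (0 <= P * e2) by nra. nra. }
      replace (P * ((h * ln t) ^ 2 * (e1 + e2))) with (h ^ 2 * (P * (e1 + e2) * ln t ^ 2)) by ring.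
      apply Rle_trans with (h ^ 2 * (2 * K * Wmaj t)). apply Rmult_le_compat_l; nra. right; ring.
Qed.

Lemma C_derive_Gamma z : 1 / 2 <= Re z <= 1 -> is_CInt (fun t => gamma_integrand z t * ln t)%C (C_derive CGamma z).
Proof.
  intros Hz. destruct (is_CInt_Gamma' z Hz) as (G & HG & K & HK).
  replace (C_derive CGamma z) with G; auto. symmetry.
  assert (HL : forall h, 0 < Rabs h <= 1 / 8 ->
     Cmod ((CGamma (z + h) - CGamma z) / h - G)%C <= Rabs K * Rabs h).
  { intros h Hh. assert (h <> 0) by (intros ->; rewrite Rabs_R0 in Hh; lra).
    assert (RtoC h <> 0%C) by (intros E; apply RtoC_inj in E; auto).
    replace ((CGamma (z + h) - CGamma z) / h - G)%C with ((CGamma (z + h) - CGamma z - h * G) / h)%C by (field; auto).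
    rewrite Cmod_div by auto. rewrite Cmod_R.
    apply Rmult_le_reg_r with (Rabs h); [lra|].
    unfold Rdiv; rewrite Rmult_assoc, Rinv_l, Rmult_1_r by lra.
    eapply Rle_trans; [apply HK; lra|]. rewrite Rmult_assoc. replace (Rabs h * Rabs h) with (h ^ 2).
    2:{ rewrite <- (pow2_abs h). ring. } apply Rmult_le_compat_r; [nra | apply Rle_abs]. }
  assert (HE : forall x, ((x, snd z) : C) = (z + (x - Re z)%R)%C).
  { intros x. apply C_ext; unfold Re, Im; simpl; ring. }
  assert (HL2 : forall eps : posreal, exists d : posreal, forall x, Rabs (x - Re z) < d -> x <> Re z ->
     Cmod ((CGamma (x, snd z) - CGamma z) / ((x, snd z) - z) - G)%C < eps).
  { intros eps. assert (Hd : 0 < Rmin (1 / 8) (eps / (1 + Rabs K))).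
    { apply Rmin_glb_lt; [lra|]. apply Rdiv_lt_0_compat; [apply cond_pos | generalize (Rabs_pos K); lra]. }
    exists (mkposreal _ Hd). simpl. intros x Hx Hne.
    generalize (Rmin_l (1 / 8) (eps / (1 + Rabs K))) (Rmin_r (1 / 8) (eps / (1 + Rabs K))); intros M1 M2.
    rewrite HE. replace (z + (x - Re z)%R - z)%C with (RtoC (x - Re z)) by ring.
    assert (0 < Rabs (x - Re z)) by (apply Rabs_pos_lt; lra).
    eapply Rle_lt_trans. apply HL; lra.
    apply Rle_lt_trans with ((1 + Rabs K) * Rabs (x - Re z)). nra.
    replace (pos eps) with ((1 + Rabs K) * (eps / (1 + Rabs K))) by (field; generalize (Rabs_pos K); lra).
    apply Rmult_lt_compat_l; [generalize (Rabs_pos K); lra | lra]. }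
  unfold C_derive, C_lim. apply C_ext; unfold Re, Im; simpl.
  - rewrite (is_lim_unique _ _ (Re G)); auto. apply is_lim_spec. intros eps. destruct (HL2 eps) as [d Hd].
    exists d. intros x Hx Hne. eapply Rle_lt_trans; [|apply (Hd x); auto].
    apply (Cmod_Re ((CGamma (x, snd z) - CGamma z) / ((x, snd z) - z) - G)%C).
  - rewrite (is_lim_unique _ _ (Im G)); auto. apply is_lim_spec. intros eps. destruct (HL2 eps) as [d Hd].
    exists d. intros x Hx Hne. eapply Rle_lt_trans; [|apply (Hd x); auto].
    apply (Cmod_Im ((CGamma (x, snd z) - CGamma z) / ((x, snd z) - z) - G)%C).
Qed.

Lemma clim_at_right_rpower f a K e : 0 < e ->
  (forall x, 0 < x <= 1 -> Cmod (f x - a)%C <= K * Rpower x e) -> clim f (at_right 0) a.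
Proof.
  intros He H eps Heps. apply at_right_0_iff.
  (* The solution of (1 + |K|) d^e = eps; adding 1 keeps the denominator positive. *)
  set (d := Rpower (eps / (1 + Rabs K)) (/ e)).
  assert (HK : 0 < 1 + Rabs K) by (generalize (Rabs_pos K); lra).
  assert (Hq : 0 < eps / (1 + Rabs K)) by (apply Rdiv_lt_0_compat; lra).
  exists (Rmin 1 d). split. { apply Rmin_glb_lt; [lra | apply exp_pos]. }
  intros x Hx. generalize (Rmin_l 1 d) (Rmin_r 1 d); intros M1 M2.
  eapply Rle_lt_trans; [apply H; lra|].
  assert (Hp : 0 < Rpower x e) by apply exp_pos.
  assert (Hlt : Rpower x e < eps / (1 + Rabs K)).
  { replace (eps / (1 + Rabs K)) with (Rpower d e). apply Rlt_Rpower_l; lra.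
    unfold d. rewrite Rpower_mult, Rinv_l by lra. now apply Rpower_1. }
  apply Rle_lt_trans with ((1 + Rabs K) * Rpower x e). { generalize (Rle_abs K); nra. }
  replace eps with ((1 + Rabs K) * (eps / (1 + Rabs K))) by (field; lra).
  apply Rmult_lt_compat_l; lra.
Qed.

Lemma clim_at_right_lin f a K :
  (forall x, 0 < x <= 1 -> Cmod (f x - a)%C <= K * x) -> clim f (at_right 0) a.
Proof.
  intros H. apply (clim_at_right_rpower f a K 1); [lra|]. intros x Hx. rewrite Rpower_1 by lra. auto.
Qed.

Lemma clim_infty_rpower f a K e : 0 < e ->
  (forall x, 1 <= x -> Cmod (f x - a)%C <= K * Rpower x (- e)) -> clim f (Rbar_locally p_infty) a.
Proof.
  intros He H.
  assert (HC : clim (fun y => f (/ y)) (at_right 0) a).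
  { apply (clim_at_right_rpower _ a K e); auto. intros x Hx.
    eapply Rle_trans. apply H. { rewrite <- Rinv_1. apply Rinv_le_contravar; lra. }
    right. f_equal. unfold Rpower. rewrite ln_Rinv by lra. f_equal; ring. }
  intros eps Heps. specialize (HC eps Heps). apply at_right_0_iff in HC. destruct HC as (d & Hd & HC).
  exists (/ d). intros x Hx. assert (0 < / d) by now apply Rinv_0_lt_compat.
  specialize (HC (/ x)). rewrite Rinv_inv in HC. apply HC. split. apply Rinv_0_lt_compat; lra.
  rewrite <- (Rinv_inv d). apply Rinv_lt_contravar; nra.
Qed.

Lemma clim_infty_inv f a K :
  (forall x, 1 <= x -> Cmod (f x - a)%C <= K / x) -> clim f (Rbar_locally p_infty) a.
Proof.
  intros H. apply (clim_infty_rpower f a K 1); [lra|]. intros x Hx.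
  rewrite Rpower_Ropp, Rpower_1 by lra. auto.
Qed.

Lemma exp_opp_le_inv t : 0 < t -> exp (- t) <= / t.
Proof.
  intros Ht. rewrite exp_Ropp. apply Rinv_le_contravar; auto. generalize (exp_ineq1_le t); lra.
Qed.

Lemma CGamma_1 : CGamma 1 = 1%C.
Proof.
  assert (H1 := is_CInt_Gamma 1 ltac:(simpl; lra)).
  apply is_CInt_unique with (1 := H1).
  replace (RtoC 1) with (0 - (- (1)))%C by ring.
  apply is_CInt_FTC with (fun t => RtoC (- exp (- t))).
  - intros t Ht. eapply cderiv_eq. apply cderiv_RtoC. auto_derive; [auto | reflexivity].
    unfold gamma_integrand. replace ((0 - - (1) - 1) * ln t)%C with (RtoC 0) by ring. rewrite Cexp_0.
    rewrite Cmult_1_l. f_equal. ring.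
  - apply (clim_at_right_lin _ _ 1). intros x Hx.
    replace (_ - _)%C with (RtoC (1 - exp (- x))) by (rewrite RtoC_minus, RtoC_opp; ring).
    rewrite Cmod_R. assert (exp (- x) <= 1) by (rewrite <- exp_0; apply exp_le_compat; lra).
    rewrite Rabs_pos_eq by lra. generalize (exp_ineq1_le (- x)); lra.
  - apply (clim_infty_inv _ _ 1). intros x Hx. unfold Cminus. rewrite Copp_0, Cplus_0_r, Cmod_R, Rabs_Ropp.
    rewrite Rabs_pos_eq by (left; apply exp_pos). unfold Rdiv; rewrite Rmult_1_l. apply exp_opp_le_inv; lra.
Qed.

(** The squared modulus is 2 - 2 cos s = 4 sin^2(s/2). *)
Lemma Cmod_Cexp_Ci_sub_1 (s : R) : Cmod (Cexp (Ci * s) - 1)%C <= Rabs s.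
Proof.
  apply Rsqr_incr_0_var; [|apply Rabs_pos].
  rewrite !Rsqr_pow2, Cmod_sqr, pow2_abs. unfold Cexp, Re, Im; simpl.
  replace (0 * s - 1 * 0) with 0 by ring. replace (0 * 0 + 1 * s) with s by ring. rewrite exp_0.
  assert (Hs : forall x, 0 <= x -> sin x <= x).
  { intros x [Hx | <-]; [left; now apply sin_lt_x | rewrite sin_0; lra]. }
  assert (Hs2 : sin (s / 2) ^ 2 <= (s / 2) ^ 2).
  { destruct (Rle_dec (Rabs (s / 2)) 1) as [H1 | H1].
    - assert (Hs3 : forall x, 0 <= x <= 1 -> 0 <= sin x). { intros x Hx. apply sin_ge_0; generalize PI_4 PI2_1; lra. }
      destruct (Rle_dec 0 (s / 2)) as [H2 | H2].
      + rewrite Rabs_pos_eq in H1 by auto. generalize (Hs _ H2) (Hs3 _ (conj H2 H1)). nra.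
      + rewrite Rabs_left in H1 by lra. generalize (Hs (- (s / 2)) ltac:(lra)) (Hs3 (- (s / 2)) ltac:(lra)).
        rewrite sin_neg. nra.
    - generalize (SIN_bound (s / 2)). intros. rewrite <- (pow2_abs (s / 2)). nra. }
  assert (E : cos s = 1 - 2 * sin (s / 2) ^ 2).
  { replace s with (2 * (s / 2)) at 1 by field. rewrite cos_2a_sin. ring. }
  generalize (sin2_cos2 s). unfold Rsqr. intros E2.
  apply Rle_trans with (2 - 2 * cos s). right.
  transitivity (sin s * sin s + cos s * cos s - 2 * cos s + 1). ring. rewrite E2; ring.
  rewrite E. nra.
Qed.

(** A linear rate at the point 1 on the line Re z = 1; it feeds the limit kap -> 0 that evaluates
    the Gaussian constant. *)
Lemma CGamma_near_1 : exists K, 0 <= K /\ forall s : R, Cmod (CGamma (1 - Ci * s) - 1)%C <= K * Rabs s.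
Proof.
  destruct gamma_maj as (K & HK & HB). exists (2 * K); split; [lra|]. intros s.
  rewrite <- CGamma_1 at 2.
  assert (I : is_CInt (fun t => gamma_integrand (1 - Ci * s) t - gamma_integrand 1 t)%C (CGamma (1 - Ci * s) - CGamma 1)%C).
  { apply is_CInt_minus; apply is_CInt_Gamma; unfold Re; simpl; lra. }
  rewrite Rmult_assoc.
  apply (is_CInt_bound _ (K * Rabs s) 1 _) with (5 := I); try lra.
  - generalize (Rabs_pos s); nra.
  - intros; apply ccont_minus; now apply ccont_gamma_integrand.
  - intros t Ht.
    replace (_ - _)%C with (gamma_integrand 1 t * (Cexp (Ci * (- s * ln t)%R) - 1))%C.
    2:{ unfold gamma_integrand. replace ((1 - Ci * s - 1) * ln t)%C with ((1 - 1) * ln t + Ci * (- s * ln t)%R)%C.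
        rewrite Cexp_add. ring. rewrite RtoC_mult, RtoC_opp; ring. }
    rewrite Cmod_mult, Cmod_gamma_integrand, Rmult_1_l.
    eapply Rle_trans. { apply Rmult_le_compat_l; [apply Rmult_le_pos; left; apply exp_pos | apply Cmod_Cexp_Ci_sub_1]. }
    generalize (HB (Re 1 - 1) t ltac:(simpl; lra) Ht).
    assert (0 <= exp (- t) * Rpower t (Re 1 - 1)) by (apply Rmult_le_pos; left; apply exp_pos).
    set (P := exp (- t) * Rpower t (Re 1 - 1)) in *. intros B.
    rewrite Rabs_mult, Rabs_Ropp, Rmult_1_l.
    assert (Rabs (ln t) <= 1 + ln t ^ 2). { rewrite <- (pow2_abs (ln t)). generalize (Rabs_pos (ln t)); nra. }
    generalize (Rabs_pos s); intros Hs.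
    assert (P * Rabs (ln t) <= K * Wmaj t) by (apply Rle_trans with (2 := B); apply Rmult_le_compat_l; auto).
    replace (P * (Rabs s * Rabs (ln t))) with (Rabs s * (P * Rabs (ln t))) by ring.
    replace (K * Rabs s * Wmaj t) with (Rabs s * (K * Wmaj t)) by ring.
    apply Rmult_le_compat_l; auto.
Qed.

Lemma clim_conj (F : (R -> Prop) -> Prop) {FF : Filter F} f a :
  clim f F a -> clim (fun x => Cconj (f x)) F (Cconj a).
Proof.
  intros H eps He. apply filter_imp with (2 := H eps He). intros x Hx.
  now rewrite <- Cminus_conj, Cmod_conj.
Qed.

Lemma is_CInt_conj f a : is_CInt f a -> is_CInt (fun x => Cconj (f x)) (Cconj a).
Proof.
  intros (F & l & H1 & H2 & H3).
  exists (fun x => Cconj (F x)), (Cconj l); split; [|split].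
  - intros x Hx. apply cderiv_conj; auto.
  - apply clim_conj; auto; typeclasses eauto.
  - rewrite <- Cplus_conj. apply clim_conj; auto; typeclasses eauto.
Qed.

Lemma CGamma_conj z : 3 / 8 <= Re z <= 9 / 8 -> CGamma (Cconj z) = Cconj (CGamma z).
Proof.
  intros Hz. apply (is_CInt_unique (gamma_integrand (Cconj z))).
  - apply is_CInt_Gamma. exact Hz.
  - eapply is_CInt_ext; [|apply is_CInt_conj, is_CInt_Gamma, Hz].
    intros t _. unfold gamma_integrand. rewrite Cmult_conj, Cconj_Cexp, Cmult_conj, Cminus_conj, !Cconj_RtoC. reflexivity.
Qed.

Lemma RtoC_neq_0 (x : R) : x <> 0 -> RtoC x <> 0%C.
Proof. intros H E. apply RtoC_inj in E; auto. Qed.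

Lemma Ci2 : (Ci * Ci = - (1))%C.
Proof. apply C_ext; simpl; ring. Qed.

Lemma Cconj_Ci : Cconj Ci = (- Ci)%C.
Proof. apply C_ext; simpl; ring. Qed.

Lemma inner_le_Cmod (a b : C) : Rabs (Re a * Re b + Im a * Im b) <= Cmod a * Cmod b.
Proof.
  rewrite <- (Cmod_conj b), <- Cmod_mult.
  replace (Re a * Re b + Im a * Im b) with (Re (a * Cconj b)%C) by (unfold Re, Im; simpl; ring).
  apply Cmod_Re.
Qed.

Lemma is_derive_Cmod2 f x l : cderiv f x l ->
  is_derive (fun t => Cmod (f t) ^ 2) x (2 * (Re (f x) * Re l + Im (f x) * Im l)).
Proof.
  intros [H1 H2].
  assert (E : forall z : C, Re z * Re z + Im z * Im z = Cmod z ^ 2) by (intros; rewrite Cmod_sqr; ring).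
  apply is_derive_ext with (fun t => Re (f t) * Re (f t) + Im (f t) * Im (f t)).
  { intros t. apply E. }
  eapply is_derive_eq. exact (is_derive_plus _ _ _ _ _
    (is_derive_mult _ _ _ _ _ H1 H1 Rmult_comm) (is_derive_mult _ _ _ _ _ H2 H2 Rmult_comm)).
  unfold plus, mult; simpl. ring.
Qed.

Lemma ccont_bounded f X : 0 <= X -> (forall x, 0 <= x <= X -> ccont f x) ->
  exists M, forall x, 0 <= x <= X -> Cmod (f x) <= M.
Proof.
  intros HX Hc.
  assert (B : forall g : R -> R, (forall x, 0 <= x <= X -> continuous g x) -> exists M, forall x, 0 <= x <= X -> Rabs (g x) <= M).
  { intros g Hg. destruct (continuity_ab_maj (fun x => Rabs (g x)) 0 X HX) as (m & Hm & _).
    - intros x Hx. apply continuity_pt_filterlim. apply (continuous_comp g Rabs). apply Hg, Hx. apply continuous_Rabs.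
    - exists (Rabs (g m)). auto. }
  destruct (B (fun x => Re (f x))) as [M1 H1]. { intros x Hx; apply (Hc x Hx). }
  destruct (B (fun x => Im (f x))) as [M2 H2]. { intros x Hx; apply (Hc x Hx). }
  exists (M1 + M2). intros x Hx. eapply Rle_trans; [apply Cmod_le_abs|].
  specialize (H1 x Hx). specialize (H2 x Hx). lra.
Qed.

(** * The Landau-Zener system *)

Definition theta (kap x : R) : R := x ^ 2 / 4 + kap * ln (x ^ 2 / 2).
Definition phase (kap x : R) : C := Cexp (Ci * theta kap x).

Lemma is_derive_theta kap x : 0 < x -> is_derive (theta kap) x (x / 2 + 2 * kap / x).
Proof. intros Hx. unfold theta. auto_derive. nra. field. lra. Qed.

Lemma cderiv_phase kap x : 0 < x ->
  cderiv (phase kap) x (Ci * (x / 2 + 2 * kap / x)%R * phase kap x)%C.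
Proof. intros Hx. apply cderiv_Cexp, cderiv_scal, cderiv_RtoC, is_derive_theta, Hx. Qed.

Lemma Cmod_phase kap x : Cmod (phase kap x) = 1.
Proof. unfold phase. rewrite Cmod_Cexp. rewrite <- exp_0. f_equal. unfold Re; simpl; ring. Qed.

Lemma phase_conj kap x : (Cconj (phase kap x) * phase kap x = 1)%C.
Proof. rewrite Cmult_comm, <- Cmod2_conj, Cmod_phase. f_equal; ring. Qed.

Definition lz_sys (kap : R) (w1 w2 : R -> C) : Prop :=
  w1 0 = 1%C /\ w2 0 = 0%C /\
  forall x, cderiv w1 x (Ci * (x / 2)%R * w1 x - (2 * kap)%R * w2 x)%C /\
            cderiv w2 x (w1 x - Ci * (x / 2)%R * w2 x)%C.

Section LZ.
Variables (kap : R) (w1 w2 : R -> C).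
Hypothesis Hs : lz_sys kap w1 w2.

Lemma lz_d1 x : cderiv w1 x (Ci * (x / 2)%R * w1 x - (2 * kap)%R * w2 x)%C.
Proof. apply Hs. Qed.
Lemma lz_d2 x : cderiv w2 x (w1 x - Ci * (x / 2)%R * w2 x)%C.
Proof. apply Hs. Qed.

Lemma lz_conserved x : Cmod (w1 x) ^ 2 + 2 * kap * Cmod (w2 x) ^ 2 = 1.
Proof.
  set (E := fun x => Cmod (w1 x) ^ 2 + 2 * kap * Cmod (w2 x) ^ 2).
  assert (HE : forall x, is_derive E x 0).
  { intros t. eapply is_derive_eq.
    - apply @is_derive_plus; [apply is_derive_Cmod2, lz_d1 | apply is_derive_scal, is_derive_Cmod2, lz_d2].
    - unfold plus, Re, Im; simpl. field. }
  assert (E0 : E 0 = 1).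
  { unfold E. destruct Hs as (-> & -> & _). rewrite Cmod_1, Cmod_0. ring. }
  rewrite <- E0. change (E x = E 0).
  destruct (Rle_dec 0 x); [symmetry|]; apply (is_derive_zero_eq E (fun _ => 0)); auto; lra.
Qed.

(** Removing the phase from w1 leaves the bounded oscillating term -2 kap w2 in the derivative. The
    corrector i (2 kap / x) w2 integrates it by parts, and the 1/x term in w1 that this creates
    cancels against the derivative of the logarithm in [theta]; what is left is O(x^(-2)). The same
    holds for [lz_z2] with corrector i w1 / x. *)
Definition lz_z1 x := (Cconj (phase kap x) * (w1 x + (2 * kap / x)%R * Ci * w2 x))%C.
Definition lz_z2 x := (phase kap x * (w2 x + (/ x)%R * Ci * w1 x))%C.

Lemma lz_dz1 x : 0 < x ->
  cderiv lz_z1 x (Cconj (phase kap x) * w2 x * ((4 * kap ^ 2)%R - (2 * kap)%R * Ci) * (/ x ^ 2)%R)%C.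
Proof.
  intros Hx. unfold lz_z1. eapply cderiv_eq.
  - apply cderiv_mult. apply cderiv_conj, cderiv_phase, Hx.
    apply cderiv_plus. apply lz_d1. apply cderiv_mult; [|apply lz_d2].
    apply (cderiv_mult (fun x => RtoC (2 * kap / x)) (fun _ => Ci)); [|apply cderiv_const].
    apply cderiv_RtoC. auto_derive; [lra|reflexivity].
  - rewrite !Cmult_conj, Cconj_Ci, Cconj_RtoC.
    generalize (Cconj (phase kap x)) (w1 x) (w2 x); intros p a b.
    apply C_ext; unfold Re, Im; destruct p as [p1 p2], a as [a1 a2], b as [b1 b2]; simpl; field; lra.
Qed.

Lemma lz_dz2 x : 0 < x ->
  cderiv lz_z2 x (phase kap x * w1 x * ((- (2 * kap))%R - Ci) * (/ x ^ 2)%R)%C.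
Proof.
  intros Hx. unfold lz_z2. eapply cderiv_eq.
  - apply cderiv_mult. apply cderiv_phase, Hx.
    apply cderiv_plus. apply lz_d2. apply cderiv_mult; [|apply lz_d1].
    apply (cderiv_mult (fun x => RtoC (/ x)) (fun _ => Ci)); [|apply cderiv_const].
    apply cderiv_RtoC. auto_derive; [lra|reflexivity].
  - cbv beta. generalize (phase kap x) (w1 x) (w2 x); intros p a b.
    apply C_ext; unfold Re, Im; destruct p as [p1 p2], a as [a1 a2], b as [b1 b2]; simpl; field; lra.
Qed.

Let L := 4 * kap ^ 2 + 2 * Rabs kap + 1.

Lemma L_ge_1 : 1 <= L.
Proof. unfold L. generalize (Rabs_pos kap); nra. Qed.

Lemma lz_dz1_bound x : 0 < x ->
  Cmod (Cconj (phase kap x) * w2 x * ((4 * kap ^ 2)%R - (2 * kap)%R * Ci) * (/ x ^ 2)%R)%C <= L * Cmod (w2 x) / x ^ 2.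
Proof.
  intros Hx. rewrite !Cmod_mult, Cmod_conj, Cmod_phase, Cmod_RtoC by (left; apply Rinv_0_lt_compat; nra).
  rewrite Rmult_1_l. unfold Rdiv. apply Rmult_le_compat_r; [left; apply Rinv_0_lt_compat; nra|].
  rewrite Rmult_comm. apply Rmult_le_compat_r; [apply Cmod_ge_0|].
  eapply Rle_trans; [apply Cmod_minus|]. rewrite Cmod_mult, Cmod_Ci, !Cmod_R.
  rewrite (Rabs_mult 2 kap), (Rabs_pos_eq (4 * kap ^ 2)), (Rabs_pos_eq 2) by nra. unfold L; lra.
Qed.

Lemma lz_dz2_bound x : 0 < x ->
  Cmod (phase kap x * w1 x * ((- (2 * kap))%R - Ci) * (/ x ^ 2)%R)%C <= L * Cmod (w1 x) / x ^ 2.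
Proof.
  intros Hx. rewrite !Cmod_mult, Cmod_phase, Cmod_RtoC by (left; apply Rinv_0_lt_compat; nra).
  rewrite Rmult_1_l. unfold Rdiv. apply Rmult_le_compat_r; [left; apply Rinv_0_lt_compat; nra|].
  rewrite Rmult_comm. apply Rmult_le_compat_r; [apply Cmod_ge_0|].
  eapply Rle_trans; [apply Cmod_minus|]. rewrite Cmod_Ci, !Cmod_R.
  rewrite Rabs_Ropp, Rabs_mult, (Rabs_pos_eq 2) by nra. unfold L; nra.
Qed.

Lemma lz_w1_z1 x : 0 < x -> Cmod (w1 x - phase kap x * lz_z1 x)%C <= 2 * Rabs kap / x * Cmod (w2 x).
Proof.
  intros Hx. unfold lz_z1.
  replace (w1 x - _)%C with (w1 x - Cconj (phase kap x) * phase kap x * (w1 x + (2 * kap / x)%R * Ci * w2 x))%C by ring.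
  rewrite phase_conj.
  replace (w1 x - _)%C with (- ((2 * kap / x)%R * Ci * w2 x))%C by ring.
  rewrite Cmod_opp, !Cmod_mult, Cmod_Ci, Cmod_R, Rmult_1_r.
  apply Rmult_le_compat_r; [apply Cmod_ge_0|].
  unfold Rdiv. rewrite !Rabs_mult, (Rabs_pos_eq 2), (Rabs_pos_eq (/ x)); try lra. left; now apply Rinv_0_lt_compat.
Qed.

Lemma lz_w2_z2 x : 0 < x -> Cmod (w2 x - Cconj (phase kap x) * lz_z2 x)%C <= / x * Cmod (w1 x).
Proof.
  intros Hx. unfold lz_z2.
  replace (w2 x - _)%C with (w2 x - Cconj (phase kap x) * phase kap x * (w2 x + (/ x)%R * Ci * w1 x))%C by ring.
  rewrite phase_conj.
  replace (w2 x - _)%C with (- ((/ x)%R * Ci * w1 x))%C by ring.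
  rewrite Cmod_opp, !Cmod_mult, Cmod_Ci, Cmod_R, Rmult_1_r.
  apply Rmult_le_compat_r; [apply Cmod_ge_0|].
  rewrite (Rabs_pos_eq (/ x)); try lra. left; now apply Rinv_0_lt_compat.
Qed.

(* For kap < 0 the conserved form is indefinite, so boundedness comes from Gronwall on the z's. *)
Lemma lz_bounded : exists M, 0 <= M /\ forall x, 0 <= x -> Cmod (w1 x) <= M /\ Cmod (w2 x) <= M.
Proof.
  (* From here on 2 |kap| / x and 1/x are at most 1/2, so w is recovered from the rotated variables
     at the cost of a factor 2. *)
  set (X := 2 + 4 * Rabs kap). assert (HX : 2 <= X) by (unfold X; generalize (Rabs_pos kap); lra).
  generalize L_ge_1; intros HL.
  assert (Hwz : forall x, X <= x -> Cmod (w1 x) + Cmod (w2 x) <= 2 * (Cmod (lz_z1 x) + Cmod (lz_z2 x))).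
  { intros x Hx. generalize (lz_w1_z1 x ltac:(lra)) (lz_w2_z2 x ltac:(lra)); intros E1 E2.
    assert (E3 : Cmod (w1 x) <= Cmod (lz_z1 x) + 2 * Rabs kap / x * Cmod (w2 x)).
    { replace (w1 x) with ((w1 x - phase kap x * lz_z1 x) + phase kap x * lz_z1 x)%C at 1 by ring.
      eapply Rle_trans; [apply Cmod_triangle|]. rewrite Cmod_mult, Cmod_phase. lra. }
    assert (E4 : Cmod (w2 x) <= Cmod (lz_z2 x) + / x * Cmod (w1 x)).
    { replace (w2 x) with ((w2 x - Cconj (phase kap x) * lz_z2 x) + Cconj (phase kap x) * lz_z2 x)%C at 1 by ring.
      eapply Rle_trans; [apply Cmod_triangle|]. rewrite Cmod_mult, Cmod_conj, Cmod_phase. lra. }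
    assert (E5 : 2 * Rabs kap / x <= / 2).
    { apply Rmult_le_reg_r with x; [lra|]. unfold Rdiv. rewrite Rmult_assoc, Rinv_l by lra. unfold X in Hx; lra. }
    assert (E6 : / x <= / 2) by (apply Rinv_le_contravar; lra).
    generalize (Cmod_ge_0 (w1 x)) (Cmod_ge_0 (w2 x)); nra. }
  set (S := fun x => Cmod (lz_z1 x) ^ 2 + Cmod (lz_z2 x) ^ 2).
  assert (HSd : forall x, X <= x -> exists dS, is_derive S x dS /\ dS <= 8 * L / x ^ 2 * S x).
  { intros x Hx. eexists; split.
    - apply @is_derive_plus; apply is_derive_Cmod2; [apply lz_dz1 | apply lz_dz2]; lra.
    - generalize (lz_dz1_bound x ltac:(lra)) (lz_dz2_bound x ltac:(lra)).
      set (D1 := (Cconj _ * _ * _ * _)%C). set (D2 := (phase _ _ * _ * _ * _)%C). intros B1 B2.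
      generalize (inner_le_Cmod (lz_z1 x) D1) (inner_le_Cmod (lz_z2 x) D2) (Hwz x Hx); intros I1 I2 I3.
      apply Rabs_le_between in I1. apply Rabs_le_between in I2.
      change (2 * (Re (lz_z1 x) * Re D1 + Im (lz_z1 x) * Im D1) + 2 * (Re (lz_z2 x) * Re D2 + Im (lz_z2 x) * Im D2) <= 8 * L / x ^ 2 * S x). unfold S.
      assert (Hq : 0 < L / x ^ 2) by (apply Rdiv_lt_0_compat; nra).
      set (q := L / x ^ 2) in *. replace (8 * L / x ^ 2) with (8 * q) by (unfold q, Rdiv; ring).
      replace (L * Cmod (w2 x) / x ^ 2) with (q * Cmod (w2 x)) in B1 by (unfold q, Rdiv; ring).
      replace (L * Cmod (w1 x) / x ^ 2) with (q * Cmod (w1 x)) in B2 by (unfold q, Rdiv; ring).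
      generalize (Cmod_ge_0 (lz_z1 x)) (Cmod_ge_0 (lz_z2 x)) (Cmod_ge_0 (w1 x)) (Cmod_ge_0 (w2 x)).
      set (m1 := Cmod (lz_z1 x)) in *. set (m2 := Cmod (lz_z2 x)) in *.
      set (a1 := Cmod (w1 x)) in *. set (a2 := Cmod (w2 x)) in *. intros.
      assert (m1 * Cmod D1 <= m1 * (q * a2)) by (apply Rmult_le_compat_l; auto).
      assert (m2 * Cmod D2 <= m2 * (q * a1)) by (apply Rmult_le_compat_l; auto).
      assert (m1 * a2 + m2 * a1 <= 2 * (m1 + m2) * (m1 + m2)).
      { apply Rle_trans with ((m1 + m2) * (a1 + a2)); nra. }
      assert (q * (m1 * a2 + m2 * a1) <= q * (4 * (m1 ^ 2 + m2 ^ 2))).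
      { apply Rmult_le_compat_l; [lra|]. generalize (pow2_ge_0 (m1 - m2)); nra. }
      nra. }
  (* The integrating factor e^(8 L / x) makes S e^(8 L / x) decreasing. It is at least 1 and stays
     bounded, because 8 L / x^2 is integrable at infinity. *)
  assert (HSb : forall x, X <= x -> S x <= S X * exp (8 * L / X)).
  { intros x Hx.
    assert (Hm : - (S X * exp (8 * L / X)) <= - (S x * exp (8 * L / x))).
    { destruct (MVT_gen (fun t => S t * exp (8 * L / t)) X x (fun t => Derive (fun t => S t * exp (8 * L / t)) t)) as (c & Hc & E).
      - intros t Ht. rewrite Rmin_left, Rmax_right in Ht by lra. apply Derive_correct.
        destruct (HSd t ltac:(lra)) as (dS & D & _). apply (ex_derive_mult S (fun t => exp (8 * L / t)) t); [eexists; exact D|]. auto_derive; lra.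
      - intros t Ht. rewrite Rmin_left, Rmax_right in Ht by lra. apply continuity_pt_filterlim.
        apply (ex_derive_continuous (fun t => S t * exp (8 * L / t))). destruct (HSd t ltac:(lra)) as (dS & D & _).
        apply (ex_derive_mult S (fun t => exp (8 * L / t)) t); [eexists; exact D|]. auto_derive; lra.
      - rewrite Rmin_left, Rmax_right in Hc by lra.
        destruct (HSd c ltac:(lra)) as (dS & D & B).
        rewrite (is_derive_unique _ c (dS * exp (8 * L / c) + S c * (- (8 * L / c ^ 2) * exp (8 * L / c)))) in E.
        2:{ apply (is_derive_mult S (fun t => exp (8 * L / t))); [exact D | | apply Rmult_comm].
            auto_derive; [lra|]. unfold Rdiv. generalize (exp (8 * L * / c)). intros; field; lra. }
        assert (dS * exp (8 * L / c) + S c * (- (8 * L / c ^ 2) * exp (8 * L / c)) <= 0).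
        { replace (_ + _) with ((dS - 8 * L / c ^ 2 * S c) * exp (8 * L / c)) by ring.
          generalize (exp_pos (8 * L / c)); nra. }
        nra. }
    assert (0 <= S x) by (unfold S; nra).
    assert (1 <= exp (8 * L / x)).
    { rewrite <- exp_0. apply exp_le_compat. apply Rdiv_le_0_compat; lra. }
    nra. }
  set (T := S X * exp (8 * L / X)) in *.
  destruct (ccont_bounded w1 X) as [M1 H1]; [lra | intros; eapply cderiv_ccont, lz_d1 |].
  destruct (ccont_bounded w2 X) as [M2 H2]; [lra | intros; eapply cderiv_ccont, lz_d2 |].
  exists (Rabs M1 + Rabs M2 + 2 * (1 + T)).
  assert (HT : 0 <= T). { apply Rle_trans with (2 := HSb X ltac:(lra)). unfold S; nra. }
  split. { generalize (Rabs_pos M1) (Rabs_pos M2); lra. }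
  intros x Hx. generalize (Rabs_pos M1) (Rabs_pos M2) (Rle_abs M1) (Rle_abs M2); intros.
  destruct (Rle_dec x X) as [h | h].
  - specialize (H1 x (conj Hx h)). specialize (H2 x (conj Hx h)). lra.
  - specialize (HSb x ltac:(lra)). specialize (Hwz x ltac:(lra)). unfold S in HSb.
    generalize (Cmod_ge_0 (w1 x)) (Cmod_ge_0 (w2 x)) (Cmod_ge_0 (lz_z1 x)) (Cmod_ge_0 (lz_z2 x)); intros.
    assert (Cmod (lz_z1 x) + Cmod (lz_z2 x) <= 1 + T) by (generalize (pow2_ge_0 (Cmod (lz_z1 x) - 1)) (pow2_ge_0 (Cmod (lz_z2 x) - 1)); lra). lra.
Qed.

Lemma climit_of_derive_bound (f df : R -> C) (K : R) : 0 <= K ->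
  (forall x, 1 <= x -> cderiv f x (df x)) ->
  (forall x, 1 <= x -> Cmod (df x) <= K / x ^ 2) ->
  exists l, forall x, 1 <= x -> Cmod (f x - l)%C <= 2 * K / x.
Proof.
  intros HK Hd Hb.
  destruct (limit_of_derive_bound (fun t => Re (f t)) (fun t => Re (df t)) K 1 0) as [l1 H1]; auto; try lra.
  { intros; now apply Hd. } { intros. eapply Rle_trans; [apply Cmod_Re|]; auto. }
  destruct (limit_of_derive_bound (fun t => Im (f t)) (fun t => Im (df t)) K 1 0) as [l2 H2]; auto; try lra.
  { intros; now apply Hd. } { intros. eapply Rle_trans; [apply Cmod_Im|]; auto. }
  exists (l1, l2). intros x Hx. eapply Rle_trans; [apply Cmod_le_abs|].
  specialize (H1 x Hx). specialize (H2 x Hx). rewrite pow_1 in H1, H2.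
  unfold Re, Im in *; simpl. unfold Rminus in *. replace (2 * K / x) with (K / x + K / x) by (field; lra). lra.
Qed.

Lemma lz_asymptotics : exists (A B : C) (K : R), 0 <= K /\
  forall x, 1 <= x -> Cmod (w1 x - phase kap x * A)%C <= K / x /\ Cmod (w2 x - Cconj (phase kap x) * B)%C <= K / x.
Proof.
  destruct lz_bounded as (M & HM & Hb). generalize L_ge_1; intros HL.
  assert (Hq : forall x, 1 <= x -> 0 < / x ^ 2) by (intros; apply Rinv_0_lt_compat; nra).
  destruct (climit_of_derive_bound lz_z1 (fun x => Cconj (phase kap x) * w2 x * ((4 * kap ^ 2)%R - (2 * kap)%R * Ci) * (/ x ^ 2)%R)%C (L * M)) as [A HA].
  { nra. } { intros; apply lz_dz1; lra. }
  { intros x Hx. eapply Rle_trans; [apply lz_dz1_bound; lra|]. unfold Rdiv. apply Rmult_le_compat_r; [left; auto|].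
    apply Rmult_le_compat_l; [lra|]. apply Hb; lra. }
  destruct (climit_of_derive_bound lz_z2 (fun x => phase kap x * w1 x * ((- (2 * kap))%R - Ci) * (/ x ^ 2)%R)%C (L * M)) as [B HB].
  { nra. } { intros; apply lz_dz2; lra. }
  { intros x Hx. eapply Rle_trans; [apply lz_dz2_bound; lra|]. unfold Rdiv. apply Rmult_le_compat_r; [left; auto|].
    apply Rmult_le_compat_l; [lra|]. apply Hb; lra. }
  exists A, B, (2 * (L * M) + (2 * Rabs kap + 1) * M). split. { generalize (Rabs_pos kap); nra. }
  intros x Hx. destruct (Hb x ltac:(lra)) as [Hb1 Hb2]. assert (Hi : 0 < / x) by (apply Rinv_0_lt_compat; lra).
  generalize (Rabs_pos kap); intros Hk. split.
  - replace (w1 x - phase kap x * A)%C with ((w1 x - phase kap x * lz_z1 x) + phase kap x * (lz_z1 x - A))%C by ring.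
    eapply Rle_trans; [apply Cmod_triangle|]. rewrite Cmod_mult, Cmod_phase.
    specialize (HA x Hx). generalize (lz_w1_z1 x ltac:(lra)).
    assert (2 * Rabs kap / x * Cmod (w2 x) <= 2 * Rabs kap / x * M) by (apply Rmult_le_compat_l; auto; apply Rdiv_le_0_compat; lra).
    unfold Rdiv in *. nra.
  - replace (w2 x - Cconj (phase kap x) * B)%C with ((w2 x - Cconj (phase kap x) * lz_z2 x) + Cconj (phase kap x) * (lz_z2 x - B))%C by ring.
    eapply Rle_trans; [apply Cmod_triangle|]. rewrite Cmod_mult, Cmod_conj, Cmod_phase.
    specialize (HB x Hx). generalize (lz_w2_z2 x ltac:(lra)).
    assert (/ x * Cmod (w1 x) <= / x * M) by (apply Rmult_le_compat_l; auto; lra).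
    unfold Rdiv in *. assert (0 <= 2 * Rabs kap * M * / x). { apply Rmult_le_pos; [|lra]. nra. } nra.
Qed.

End LZ.

(** * Gaussian-Laplace transforms and their Abelian asymptotics *)

Definition gw (eps x : R) : R := exp (- (eps * (x ^ 2 / 2))).

Lemma gw_pos eps x : 0 < gw eps x.
Proof. apply exp_pos. Qed.

Lemma is_derive_gw eps x : is_derive (gw eps) x (- (eps * x) * gw eps x).
Proof. unfold gw. auto_derive; auto. change (exp (- (eps * (x * (x * 1) * / 2)))) with (exp (- (eps * (x ^ 2 / 2)))). generalize (exp (- (eps * (x ^ 2 / 2)))). intros; field. Qed.

Lemma cderiv_gw eps x : cderiv (fun x => RtoC (gw eps x)) x (- (eps * x) * gw eps x)%R.
Proof. apply cderiv_RtoC, is_derive_gw. Qed.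

Lemma ccont_gw eps x : ccont (fun x => RtoC (gw eps x)) x.
Proof. eapply cderiv_ccont, cderiv_gw. Qed.

Ltac ccont_tac := repeat lazymatch goal with
  | |- ccont (fun t => Cplus (@?f t) (@?g t)) _ => apply (ccont_plus f g)
  | |- ccont (fun t => Cminus (@?f t) (@?g t)) _ => apply (ccont_minus f g)
  | |- ccont (fun t => Copp (@?f t)) _ => apply (ccont_opp f)
  | |- ccont (fun t => Cmult (@?f t) (@?g t)) _ => apply (ccont_mult f g)
  | |- ccont (fun t => Cconj (@?f t)) _ => apply (ccont_conj f)
  | |- ccont (fun t => RtoC (gw ?e t)) _ => apply ccont_gw
  | |- ccont ?f _ => let c := eval cbv beta in (f 0) in constr_eq f (fun _ : R => c); apply (ccont_const c)
  end.

Lemma gauss_ex (f : R -> C) (eps M : R) (n : nat) : 0 < eps -> 0 <= M ->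
  (forall x, 0 < x -> ccont f x) -> (forall x, 0 < x -> Cmod (f x) <= M * (1 + x) ^ n) ->
  exists l, is_CInt (fun x => gw eps x * f x)%C l.
Proof.
  intros He HM Hc Hb. destruct (gauss_maj eps n He) as (K & HK & HB).
  destruct (is_CInt_dom (fun x => gw eps x * f x)%C (M * K) 1) as (l & Hl & _); [lra | nra | | | now exists l].
  - intros; apply ccont_mult; [apply ccont_gw | auto].
  - intros x Hx. rewrite Cmod_mult, Cmod_RtoC by (left; apply gw_pos). rewrite !Rmult_1_l.
    apply Rle_trans with (gw eps x * (M * (1 + x) ^ n)). apply Rmult_le_compat_l; [left; apply gw_pos | auto].
    specialize (HB x Hx). fold (gw eps x) in HB. rewrite Rmult_assoc.
    replace (gw eps x * (M * (1 + x) ^ n)) with (M * (gw eps x * (1 + x) ^ n)) by ring.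
    apply Rmult_le_compat_l; auto.
Qed.

Lemma cderiv_of_quadratic (f : R -> C) x l d K : 0 < d ->
  (forall h, Rabs h <= d -> Cmod (f (x + h)%R - f x - h * l)%C <= K * h ^ 2) -> cderiv f x l.
Proof.
  intros Hd H.
  assert (HR : forall (g : R -> R) l', (forall h, Rabs h <= d -> Rabs (g (x + h) - g x - h * l') <= K * h ^ 2) -> is_derive g x l').
  { intros g l' Hg. apply is_derive_Reals. intros eps He.
    assert (HK : 0 < 1 + Rabs K) by (generalize (Rabs_pos K); lra).
    assert (Hp : 0 < Rmin d (eps / (1 + Rabs K))) by (apply Rmin_glb_lt; auto; apply Rdiv_lt_0_compat; auto).
    exists (mkposreal _ Hp). intros h Hh Hlt. simpl in Hlt.
    generalize (Rmin_l d (eps / (1 + Rabs K))) (Rmin_r d (eps / (1 + Rabs K))); intros M1 M2.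
    replace ((g (x + h) - g x) / h - l') with ((g (x + h) - g x - h * l') / h) by (field; auto).
    assert (0 < Rabs h) by now apply Rabs_pos_lt.
    unfold Rdiv. rewrite Rabs_mult, Rabs_inv.
    apply Rle_lt_trans with ((1 + Rabs K) * Rabs h).
    - apply Rmult_le_reg_r with (Rabs h); auto. rewrite Rmult_assoc, Rinv_l, Rmult_1_r by lra.
      eapply Rle_trans; [apply Hg; lra|]. rewrite <- (pow2_abs h). generalize (Rle_abs K); nra.
    - replace eps with ((1 + Rabs K) * (eps / (1 + Rabs K))) by (field; lra). apply Rmult_lt_compat_l; lra. }
  split; apply HR; intros h Hh; (eapply Rle_trans; [|apply (H h Hh)]).
  - eapply Rle_trans; [|apply Cmod_Re]. right; f_equal. unfold Re; simpl; ring.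
  - eapply Rle_trans; [|apply Cmod_Im]. right; f_equal. unfold Im; simpl; ring.
Qed.

(** Each derivative in eps brings down - x^2/2. For |h| <= eps/2 the Taylor remainder costs at most
    a factor e^(eps x^2/4), leaving the weight with parameter eps/2 as majorant. *)
Lemma laplace_deriv (f m X : R -> C) (M : R) (n : nat) : 0 <= M ->
  (forall x, 0 < x -> ccont f x) -> (forall x, 0 < x -> Cmod (f x) <= M * (1 + x) ^ n) ->
  (forall eps, 0 < eps -> is_CInt (fun x => gw eps x * f x)%C (m eps)) ->
  (forall eps, 0 < eps -> is_CInt (fun x => gw eps x * ((x ^ 2)%R * f x))%C (X eps)) ->
  forall eps, 0 < eps -> cderiv m eps (- (/ 2)%R * X eps)%C.
Proof.
  intros HM Hc Hb Im IX eps He.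
  destruct (gauss_maj (eps / 2) (4 + n) ltac:(lra)) as (K & HK & HB).
  apply (cderiv_of_quadratic _ _ _ (eps / 2) (2 * (2 * M * K))); [lra|].
  intros h Hh. assert (Hh2 := Hh). apply Rabs_le_between in Hh2.
  assert (I : is_CInt (fun x => gw (eps + h) x * f x - gw eps x * f x - h * (- (/ 2)%R * (gw eps x * ((x ^ 2)%R * f x))))%C
            (m (eps + h)%R - m eps - h * (- (/ 2)%R * X eps))%C).
  { apply is_CInt_minus. apply is_CInt_minus; apply Im; lra. apply is_CInt_scal, is_CInt_scal, IX; lra. }
  assert (E2 : 2 * (2 * M * K) * h ^ 2 = 2 * (2 * M * K * h ^ 2)) by ring. rewrite E2. clear E2.
  refine (is_CInt_bound _ (2 * M * K * h ^ 2) 1 _ Rlt_0_1 _ _ _ I).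
  - apply Rmult_le_pos; [|nra]. apply Rmult_le_pos; lra.
  - intros x Hx. assert (P : ccont (fun x => RtoC (x ^ 2)) x).
    { eapply cderiv_ccont, cderiv_RtoC. auto_derive; auto. }
    ccont_tac; first [exact P | exact (Hc x Hx)].
  - intros x Hx. set (s := x ^ 2 / 2). assert (Hs : 0 <= s) by (unfold s; nra).
    replace (_ - _ - _)%C with ((gw eps x * (exp (- (h * s)) - 1 - - (h * s)))%R * f x)%C.
    2:{ replace (gw (eps + h) x) with (gw eps x * exp (- (h * s))).
        2:{ unfold gw. rewrite <- exp_plus. f_equal. unfold s. field. }
        unfold s. unfold Rdiv. rewrite ?RtoC_mult, ?RtoC_minus, ?RtoC_opp, ?RtoC_mult. ring. }
    rewrite Cmod_mult, Cmod_R, Rabs_mult, (Rabs_pos_eq (gw eps x)) by (left; apply gw_pos).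
    assert (E : Rabs (exp (- (h * s)) - 1 - - (h * s)) <= 2 * h ^ 2 * s ^ 2 * exp (eps / 2 * s)).
    { eapply Rle_trans; [apply exp_taylor2|].
      assert (exp (- (h * s)) <= exp (eps / 2 * s)) by (apply exp_le_compat; nra).
      assert (exp (- - (h * s)) <= exp (eps / 2 * s)) by (apply exp_le_compat; nra).
      replace ((- (h * s)) ^ 2) with (h ^ 2 * s ^ 2) by ring.
      apply Rle_trans with (h ^ 2 * s ^ 2 * (2 * exp (eps / 2 * s))); [|right; ring].
      apply Rmult_le_compat_l; [|lra]. apply Rmult_le_pos; apply pow2_ge_0. }
    assert (Eg : gw eps x * exp (eps / 2 * s) = gw (eps / 2) x).
    { unfold gw. rewrite <- exp_plus. f_equal. unfold s. field. }
    specialize (HB x Hx). fold (gw (eps / 2) x) in HB.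
    apply Rle_trans with (gw eps x * (2 * h ^ 2 * s ^ 2 * exp (eps / 2 * s)) * (M * (1 + x) ^ n)).
    + apply Rmult_le_compat; auto. apply Rmult_le_pos; [left; apply gw_pos | apply Rabs_pos]. apply Cmod_ge_0.
      apply Rmult_le_compat_l; auto. left; apply gw_pos.
    + replace (gw eps x * (2 * h ^ 2 * s ^ 2 * exp (eps / 2 * s)) * (M * (1 + x) ^ n))
        with (2 * M * h ^ 2 * (gw (eps / 2) x * (s ^ 2 * (1 + x) ^ n))) by (rewrite <- Eg; ring).
      rewrite !Rmult_1_l.
      replace (2 * M * K * h ^ 2 * Wmaj x) with (2 * M * h ^ 2 * (K * Wmaj x)) by ring.
      apply Rmult_le_compat_l. { apply Rmult_le_pos; [lra | apply pow2_ge_0]. }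
      apply Rle_trans with (2 := HB). apply Rmult_le_compat_l; [left; apply gw_pos|].
      rewrite pow_add. apply Rmult_le_compat_r; [apply pow_le; lra|].
      apply Rle_trans with (((1 + x) ^ 2) ^ 2); [|right; ring]. apply pow_incr. unfold s; nra.
Qed.

Lemma Rpower_scale (eps x a : R) : 0 < eps -> 0 < x ->
  Rpower x a = Rpower eps (- (a / 2)) * Rpower (sqrt eps * x) a.
Proof.
  intros He Hx. assert (Hq : 0 < sqrt eps) by now apply sqrt_lt_R0.
  rewrite <- Rpower_mult_distr by auto. rewrite <- Rpower_sqrt by auto. rewrite Rpower_mult, <- Rmult_assoc, <- Rpower_plus.
  replace (- (a / 2) + / 2 * a) with 0 by field. rewrite Rpower_O by auto. ring.
Qed.

Lemma gw_scale eps x : 0 <= eps -> gw eps x = exp (- ((sqrt eps * x) ^ 2 / 2)).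
Proof. intros He. unfold gw. rewrite Rpow_mult_distr, pow2_sqrt by auto. f_equal; field. Qed.

(** As eps -> oo the weight concentrates at 0 on the scale 1 / sqrt eps, so only the value of f at 0
    survives. A deviation of size x^(1/2) becomes eps^(-1/4) after rescaling. *)
Lemma abel_infty (f m : R -> C) (f0 g : C) (K : R) : 0 <= K ->
  (forall x, 0 < x -> ccont f x) -> (forall x, 0 < x -> Cmod (f x - f0)%C <= K * Rpower x (1 / 2)) ->
  (forall eps, 0 < eps -> is_CInt (fun x => gw eps x * f x)%C (m eps)) ->
  is_CInt (fun x => RtoC (gw 1 x)) g ->
  clim (fun eps => sqrt eps * m eps)%C (Rbar_locally p_infty) (f0 * g)%C.
Proof.
  intros HK Hc Hb Im Ig. destruct gauss_rpower as (K1 & HK1 & HB).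
  apply (clim_infty_rpower _ _ (2 * (K * K1)) (1 / 4)); [lra|]. intros eps He.
  assert (Hq : 0 < sqrt eps) by (apply sqrt_lt_R0; lra).
  assert (I : is_CInt (fun x => sqrt eps * (gw eps x * f x) - f0 * (sqrt eps * gw 1 (sqrt eps * x)%R))%C (sqrt eps * m eps - f0 * g)%C).
  { apply is_CInt_minus. apply is_CInt_scal, Im; lra. apply is_CInt_scal.
    apply (is_CInt_scale (fun x => RtoC (gw 1 x)) g (sqrt eps)); auto. }
  rewrite Rmult_assoc. apply (is_CInt_bound _ _ (sqrt eps)) with (5 := I); auto.
  - apply Rmult_le_pos; [nra | left; apply exp_pos].
  - intros x Hx. ccont_tac; [exact (Hc x Hx) |].
    eapply cderiv_ccont, (cderiv_comp (fun x => RtoC (gw 1 x))); [apply cderiv_gw|]. auto_derive; [auto | reflexivity].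
  - intros x Hx.
    assert (E : gw 1 (sqrt eps * x) = gw eps x).
    { rewrite (gw_scale eps x) by lra. unfold gw. f_equal. field. }
    replace (_ - _)%C with (sqrt eps * (gw eps x * (f x - f0)))%C by (rewrite E; ring).
    rewrite !Cmod_mult, !Cmod_RtoC by (left; first [exact Hq | apply gw_pos]).
    replace (K * K1 * Rpower eps (- (1 / 4)) * (sqrt eps * Wmaj (sqrt eps * x)))
      with (sqrt eps * (K * Rpower eps (- (1 / 4)) * (K1 * Wmaj (sqrt eps * x)))) by ring.
    apply Rmult_le_compat_l; [lra|].
    apply Rle_trans with (gw eps x * (K * Rpower x (1 / 2))).
    { apply Rmult_le_compat_l; [left; apply gw_pos | auto]. }
    rewrite (Rpower_scale eps x) by lra. rewrite gw_scale by lra.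
    replace (- (1 / 2 / 2)) with (- (1 / 4)) by field.
    set (e := exp _). set (r := Rpower eps _).
    replace (e * (K * (r * Rpower (sqrt eps * x) (1 / 2)))) with (K * r * (e * Rpower (sqrt eps * x) (1 / 2))) by ring.
    apply Rmult_le_compat_l. { apply Rmult_le_pos; [auto | left; apply exp_pos]. }
    apply HB; [lra | nra].
Qed.

Definition cpow (t : R) (z : C) : C := Cexp (z * ln t).

(** The Gamma integrand in the variable t = eps x^2/2, Jacobian eps x included; writing x as sqrt 2
    (x^2/2)^(1/2) shifts the exponent from z - 1 to z - 1/2. *)
Lemma cpow_change z eps x : 0 < eps -> 0 < x ->
  ((eps * x)%R * Cexp ((z - 1) * ln (eps * (x ^ 2 / 2))%R) = sqrt 2 * cpow eps z * cpow (x ^ 2 / 2) (z - (1 / 2)%R))%C.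
Proof.
  intros He Hx. unfold cpow. assert (Hy : 0 < x ^ 2 / 2) by nra.
  assert (E1 : x = sqrt 2 * exp (1 / 2 * ln (x ^ 2 / 2))).
  { change (exp (1 / 2 * ln (x ^ 2 / 2))) with (Rpower (x ^ 2 / 2) (1 / 2)).
    replace (1 / 2) with (/ 2) by field. rewrite Rpower_sqrt by auto. rewrite <- sqrt_mult by lra.
    replace (2 * (x ^ 2 / 2)) with (x ^ 2) by field. rewrite sqrt_pow2; lra. }
  rewrite ln_mult by auto. rewrite E1 at 1. rewrite <- (exp_ln eps He) at 1.
  rewrite !RtoC_mult, <- !Cexp_RtoC, RtoC_plus.
  transitivity (sqrt 2 * (Cexp (RtoC (ln eps)) * Cexp (1 / 2 * ln (x ^ 2 / 2))%R * Cexp ((z - 1) * (ln eps + ln (x ^ 2 / 2)))))%C; [ring|].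
  rewrite <- (Cmult_assoc (sqrt 2)). f_equal. rewrite <- !Cexp_add. f_equal. rewrite !RtoC_mult. 
  generalize (ln (x ^ 2 / 2)) (ln eps); intros; destruct z; apply C_ext; unfold Re, Im; simpl; field.
Qed.

Lemma ccont_ln_half x : 0 < x -> ccont (fun x => RtoC (ln (x ^ 2 / 2))) x.
Proof. intros Hx. eapply cderiv_ccont, cderiv_RtoC. auto_derive; [nra | reflexivity]. Qed.

Lemma ccont_cpow_half z x : 0 < x -> ccont (fun x => cpow (x ^ 2 / 2) z) x.
Proof.
  intros Hx. eapply cderiv_ccont, cderiv_Cexp, cderiv_scal, cderiv_RtoC.
  auto_derive; [nra | reflexivity].
Qed.

(** As eps -> 0 only large x counts. The model (x^2/2)^(z - 1/2) (D + D' ln (x^2/2)) has an exact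
    transform, where ln (x^2/2) = ln t - ln eps produces the derivative of Gamma and a divergent
    term; for this reason the statement is about a difference tending to 0. The error is smaller
    than the model by x^(-1/2), which turns into eps^(1/4). *)
Lemma abel_zero (z D D' : C) (f m : R -> C) (K : R) : 1 / 2 <= Re z <= 1 -> 0 <= K ->
  (forall x, 0 < x -> ccont f x) ->
  (forall x, 0 < x -> Cmod (f x - cpow (x ^ 2 / 2) (z - (1 / 2)%R) * (D + D' * ln (x ^ 2 / 2)%R))%C
      <= K * Rpower x (2 * Re z - 3 / 2)) ->
  (forall eps, 0 < eps -> is_CInt (fun x => gw eps x * f x)%C (m eps)) ->
  clim (fun eps => sqrt 2 * cpow eps z * m eps - (D * CGamma z + D' * (C_derive CGamma z - ln eps * CGamma z)))%C
    (at_right 0) 0.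
Proof.
  intros Hz HK Hc Hb Im. destruct gauss_rpower as (K1 & HK1 & HB).
  apply (clim_at_right_rpower _ _ (2 * (sqrt 2 * K * K1)) (1 / 4)); [lra|]. intros eps He.
  assert (Hq : 0 < sqrt eps) by (apply sqrt_lt_R0; lra).
  assert (H2 : 0 < sqrt 2) by (apply sqrt_lt_R0; lra).
  assert (I0 : is_CInt (fun t => gamma_integrand z t * (D + D' * (ln t - ln eps)))%C
     (D * CGamma z + D' * (C_derive CGamma z - ln eps * CGamma z))%C).
  { eapply is_CInt_ext; [|apply is_CInt_plus; [apply is_CInt_scal, is_CInt_Gamma; lra |
      apply is_CInt_scal, is_CInt_minus; [apply C_derive_Gamma; lra | apply is_CInt_scal, is_CInt_Gamma; lra]]].
    intros t Ht; simpl. ring. }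
  apply (is_CInt_sqr _ _ eps) in I0; [|lra].
  assert (I : is_CInt (fun x => sqrt 2 * cpow eps z * (gw eps x * (f x - cpow (x ^ 2 / 2) (z - (1 / 2)%R) * (D + D' * ln (x ^ 2 / 2)%R))))%C
    (sqrt 2 * cpow eps z * m eps - (D * CGamma z + D' * (C_derive CGamma z - ln eps * CGamma z)))%C).
  { eapply is_CInt_ext; [|apply is_CInt_minus; [apply is_CInt_scal, Im; lra | exact I0]].
    intros x Hx. cbv beta. unfold gamma_integrand.
    replace (ln (eps * (x ^ 2 / 2)) - ln eps)%C with (RtoC (ln (x ^ 2 / 2))).
    2:{ rewrite (ln_mult eps) by nra. rewrite RtoC_plus. ring. }
    change (exp (- (eps * (x ^ 2 / 2)))) with (gw eps x).
    transitivity (sqrt 2 * cpow eps z * (gw eps x * f x) - ((eps * x)%R * Cexp ((z - 1) * ln (eps * (x ^ 2 / 2))%R)) * gw eps x * (D + D' * ln (x ^ 2 / 2)%R))%C; [ring|].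
    rewrite cpow_change by lra. ring. }
  unfold Cminus at 1. rewrite Copp_0, Cplus_0_r.
  rewrite Rmult_assoc. apply (is_CInt_bound _ _ (sqrt eps)) with (5 := I); auto.
  - apply Rmult_le_pos; [|left; apply exp_pos]. apply Rmult_le_pos; [nra | auto].
  - intros x Hx. ccont_tac; [exact (Hc x Hx) | now apply ccont_cpow_half | now apply ccont_ln_half].
  - intros x Hx. rewrite !Cmod_mult, !Cmod_RtoC by (left; first [assumption | apply gw_pos]).
    unfold cpow at 1. rewrite Cmod_cpow.
    apply Rle_trans with (sqrt 2 * Rpower eps (Re z) * (gw eps x * (K * Rpower x (2 * Re z - 3 / 2)))).
    { apply Rmult_le_compat_l. apply Rmult_le_pos; [lra | left; apply exp_pos].
      apply Rmult_le_compat_l; [left; apply gw_pos | auto]. }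
    rewrite (Rpower_scale eps x) by lra. rewrite gw_scale by lra.
    set (a := 2 * Re z - 3 / 2). set (e := exp _).
    assert (E : Rpower eps (Re z) * Rpower eps (- (a / 2)) = Rpower eps (1 / 4) * sqrt eps).
    { rewrite <- (Rpower_sqrt eps) by lra. rewrite <- !Rpower_plus. f_equal. unfold a; field. }
    replace (sqrt 2 * Rpower eps (Re z) * (e * (K * (Rpower eps (- (a / 2)) * Rpower (sqrt eps * x) a))))
      with (sqrt 2 * K * (Rpower eps (Re z) * Rpower eps (- (a / 2))) * (e * Rpower (sqrt eps * x) a)) by ring.
    rewrite E.
    replace (sqrt 2 * K * K1 * Rpower eps (1 / 4) * (sqrt eps * Wmaj (sqrt eps * x)))
     with (sqrt 2 * K * (Rpower eps (1 / 4) * sqrt eps) * (K1 * Wmaj (sqrt eps * x))) by ring.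
    apply Rmult_le_compat_l.
    { apply Rmult_le_pos; [nra|]. apply Rmult_le_pos; [left; apply exp_pos | lra]. }
    apply HB; [unfold a; lra | nra].
Qed.

Lemma ccont_clim_0 f : ccont f 0 -> clim f (at_right 0) (f 0).
Proof.
  intros [H1 H2]. rewrite (surjective_pairing (f 0)). apply clim_pair; [typeclasses eauto | |].
  - eapply filterlim_filter_le_1; [|exact H1]. apply filter_le_within.
  - eapply filterlim_filter_le_1; [|exact H2]. apply filter_le_within.
Qed.

Lemma clim_gw_infty (f : R -> C) eps M n : 0 < eps ->
  (forall x, 0 < x -> Cmod (f x) <= M * (1 + x) ^ n) -> clim (fun x => gw eps x * f x)%C (Rbar_locally p_infty) 0.
Proof.
  intros He Hb. destruct (gauss_poly eps (S n) He) as (K & HK & HB).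
  apply (clim_infty_inv _ _ (Rabs M * K)). intros x Hx. unfold Cminus. rewrite Copp_0, Cplus_0_r.
  rewrite Cmod_mult, Cmod_RtoC by (left; apply gw_pos).
  apply Rle_trans with (gw eps x * (Rabs M * (1 + x) ^ n)).
  { apply Rmult_le_compat_l; [left; apply gw_pos|]. eapply Rle_trans; [apply Hb; lra|].
    apply Rmult_le_compat_r; [apply pow_le; lra | apply Rle_abs]. }
  specialize (HB x ltac:(lra)). fold (gw eps x) in HB.
  apply Rmult_le_reg_r with x; [lra|]. unfold Rdiv. rewrite (Rmult_assoc (Rabs M * K)), Rinv_l, Rmult_1_r by lra.
  replace (gw eps x * (Rabs M * (1 + x) ^ n) * x) with (Rabs M * (gw eps x * ((1 + x) ^ n * x))) by ring.
  apply Rmult_le_compat_l; [apply Rabs_pos|]. apply Rle_trans with (2 := HB).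
  apply Rmult_le_compat_l; [left; apply gw_pos|]. simpl. assert (0 <= (1 + x) ^ n) by (apply pow_le; lra). nra.
Qed.

(** An exact derivative integrates to its boundary terms: the weight kills the one at infinity, F(0)
    = 0 the one at 0. *)
Lemma is_CInt_gw_derive (F f : R -> C) eps M n l : 0 < eps ->
  (forall x, 0 < x -> Cmod (F x) <= M * (1 + x) ^ n) -> ccont F 0 -> F 0 = 0%C ->
  (forall x, 0 < x -> cderiv (fun x => gw eps x * F x)%C x (f x)) -> is_CInt f l -> l = 0%C.
Proof.
  intros He HM Hc H0 Hd I. apply (is_CInt_unique f); auto.
  replace (RtoC 0) with (0 - gw eps 0 * F 0)%C by (rewrite H0; ring).
  apply is_CInt_FTC with (fun x => gw eps x * F x)%C; auto.
  - apply (ccont_clim_0 (fun x => gw eps x * F x)%C). apply ccont_mult; auto. apply ccont_gw.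
  - eapply clim_gw_infty; eauto.
Qed.

(** * The first-order equation in eps and its homogeneous solution *)

Definition cp (tau eps : R) : C := (eps, tau).

Lemma cp_neq_0 tau eps : 0 < eps -> cp tau eps <> 0%C.
Proof. intros He E. apply (f_equal fst) in E. simpl in E. lra. Qed.

Section LaplaceODE.
Variables (kap tau M : R) (n : nat) (F1 F2 H NH : R -> C).
Hypothesis HM : 0 <= M.
Hypothesis HF1 : forall x, cderiv F1 x (Ci * ((1 - tau) * x)%R * F1 x - (2 * kap)%R * F2 x - 2 * H x)%C.
Hypothesis HF2 : forall x, cderiv F2 x (F1 x - Ci * (tau * x)%R * F2 x)%C.
Hypothesis HB1 : forall x, 0 < x -> Cmod (F1 x) <= M * (1 + x) ^ n.
Hypothesis HB2 : forall x, 0 < x -> Cmod (F2 x) <= M * (1 + x) ^ n.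
Hypothesis F20 : F2 0 = 0%C.
Hypothesis HNH : forall eps, 0 < eps -> is_CInt (fun x => gw eps x * (x * H x))%C (NH eps).

Lemma ccont_id_pow j x : ccont (fun x => RtoC (x ^ j)) x.
Proof. eapply cderiv_ccont, cderiv_RtoC. auto_derive; [auto | reflexivity]. Qed.

Lemma ccont_id x : ccont (fun x => RtoC x) x.
Proof. eapply cderiv_ccont, cderiv_RtoC. auto_derive; [auto | reflexivity]. Qed.

(** Let m, N, X be the transforms of F1, x F2 and x^2 F1. Integrating the derivatives of the
    weighted F2 and of the weighted x F1 gives m = (eps + i tau) N and m - 2 kap N - 2 NH = (eps + i
    (tau - 1)) X. With m' = - X/2 the system closes on m alone. *)
Lemma laplace_ode : exists m : R -> C,
  (forall eps, 0 < eps -> is_CInt (fun x => gw eps x * F1 x)%C (m eps)) /\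
  (forall eps, 0 < eps -> is_CInt (fun x => gw eps x * (x * F2 x))%C (m eps / cp tau eps)%C) /\
  (forall eps, 0 < eps -> cderiv m eps
     (- (/ 2)%R * ((m eps * (1 - (2 * kap)%R / cp tau eps) - 2 * NH eps) / cp (tau - 1) eps))%C).
Proof.
  assert (C1 : forall x, ccont F1 x) by (intros; eapply cderiv_ccont, HF1).
  assert (C2 : forall x, ccont F2 x) by (intros; eapply cderiv_ccont, HF2).
  assert (Ex : forall f : R -> C, (forall eps, 0 < eps -> exists l, is_CInt (fun x => gw eps x * f x)%C l) ->
     exists m : R -> C, forall eps, 0 < eps -> is_CInt (fun x => gw eps x * f x)%C (m eps)).
  (* Uniqueness of the integral lets [iota] turn existence for each eps into a function of eps. *)
  { intros f Hf. exists (fun eps => iota (T := C_R_CompleteNormedModule) (is_CInt (fun x => gw eps x * f x)%C)).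
    intros eps He. apply (iota_correct (V := C_R_CompleteNormedModule) (is_CInt (fun x => gw eps x * f x)%C)).
    destruct (Hf eps He) as [l Hl]. exists l. split; auto. intros l' Hl'. eapply is_CInt_unique; eauto. }
  destruct (Ex F1) as [m Hm]. { intros eps He. apply (gauss_ex _ _ M n); auto. }
  destruct (Ex (fun x => x * F2 x)%C) as [N HN].
  { intros eps He. apply (gauss_ex _ _ M (S n)); auto.
    - intros. apply ccont_mult; [apply ccont_id | auto].
    - intros x Hx. rewrite Cmod_mult, Cmod_RtoC by lra. simpl.
      specialize (HB2 x Hx). assert (0 <= M * (1 + x) ^ n) by (apply Rmult_le_pos; [auto | apply pow_le; lra]).
      generalize (Cmod_ge_0 (F2 x)); nra. }
  destruct (Ex (fun x => (x ^ 2)%R * F1 x)%C) as [X HX].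
  { intros eps He. apply (gauss_ex _ _ M (2 + n)); auto.
    - intros. apply ccont_mult; [apply ccont_id_pow | auto].
    - intros x Hx. rewrite Cmod_mult, Cmod_RtoC by nra. rewrite pow_add.
      specialize (HB1 x Hx). assert (0 <= M * (1 + x) ^ n) by (apply Rmult_le_pos; [auto | apply pow_le; lra]).
      generalize (Cmod_ge_0 (F1 x)). intros. apply Rle_trans with ((1 + x) ^ 2 * (M * (1 + x) ^ n)); [|right; ring].
      apply Rmult_le_compat; nra. }
  assert (E1 : forall eps, 0 < eps -> (m eps - cp tau eps * N eps)%C = 0%C).
  { intros eps He.
    apply (is_CInt_gw_derive F2 (fun x => gw eps x * F1 x - cp tau eps * (gw eps x * (x * F2 x)))%C eps M n); auto.
    - intros x Hx. eapply cderiv_eq. apply cderiv_mult; [apply cderiv_gw | apply HF2].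
      unfold cp. replace ((eps, tau) : C) with (eps + Ci * tau)%C by (apply C_ext; simpl; ring).
      rewrite !RtoC_mult, RtoC_opp, RtoC_mult. ring.
    - apply is_CInt_minus; [auto | apply is_CInt_scal; auto]. }
  assert (E2 : forall eps, 0 < eps -> (m eps - (2 * kap)%R * N eps - 2 * NH eps - cp (tau - 1) eps * X eps)%C = 0%C).
  { intros eps He.
    apply (is_CInt_gw_derive (fun x => x * F1 x)%C (fun x => gw eps x * F1 x - (2 * kap)%R * (gw eps x * (x * F2 x))
       - 2 * (gw eps x * (x * H x)) - cp (tau - 1) eps * (gw eps x * ((x ^ 2)%R * F1 x)))%C eps M (S n)); auto.
    - intros x Hx. rewrite Cmod_mult, Cmod_RtoC by lra. simpl.
      specialize (HB1 x Hx). assert (0 <= M * (1 + x) ^ n) by (apply Rmult_le_pos; [auto | apply pow_le; lra]).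
      generalize (Cmod_ge_0 (F1 x)); nra.
    - apply ccont_mult; [apply ccont_id | auto].
    - ring.
    - intros x Hx. eapply cderiv_eq.
      + apply cderiv_mult; [apply cderiv_gw |]. apply (cderiv_mult (fun x => RtoC x)); [|apply HF1].
        apply cderiv_RtoC. apply @is_derive_id.
      + unfold cp. replace ((eps, (tau - 1)%R) : C) with (eps + Ci * tau - Ci)%C by (apply C_ext; simpl; ring).
        unfold one; simpl. rewrite !RtoC_mult, RtoC_opp, RtoC_mult, RtoC_minus. ring.
    - repeat apply is_CInt_minus; try apply is_CInt_scal; auto. }
  assert (EN : forall eps, 0 < eps -> (m eps / cp tau eps)%C = N eps).
  { intros eps He. replace (m eps) with (m eps - cp tau eps * N eps + cp tau eps * N eps)%C by ring.
    rewrite E1 by auto. field. now apply cp_neq_0. }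
  exists m. split; [auto | split].
  - intros eps He. rewrite EN; auto.
  - intros eps He.
    replace ((m eps * (1 - (2 * kap)%R / cp tau eps) - 2 * NH eps) / cp (tau - 1) eps)%C with (X eps).
    { apply (laplace_deriv F1 m X M n); auto. }
    replace (m eps * (1 - (2 * kap)%R / cp tau eps) - 2 * NH eps)%C
      with (m eps - (2 * kap)%R * N eps - 2 * NH eps - cp (tau - 1) eps * X eps + cp (tau - 1) eps * X eps)%C.
    + rewrite E2 by auto. field. now apply cp_neq_0.
    + rewrite <- EN by auto. field. now apply cp_neq_0.
Qed.

End LaplaceODE.

(* The logarithm of eps + i tau, for tau in {-1, 0, 1} and eps > 0. *)
Definition Lg (tau eps : R) : C := (ln (eps ^ 2 + tau ^ 2) / 2, tau * (PI / 2 - atan eps)).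

Lemma cderiv_Lg tau eps : tau ^ 2 = 0 \/ tau ^ 2 = 1 -> 0 < eps -> cderiv (Lg tau) eps (/ cp tau eps)%C.
Proof.
  intros Ht He.
  assert (D : is_derive atan eps (/ (1 + eps ^ 2))).
  { apply is_derive_Reals.
    apply derivable_pt_lim_atan. }
  assert (tau = 0 \/ tau ^ 2 = 1) by (destruct Ht; [left; nra | now right]).
  split; unfold Lg, Re, Im, cp; simpl.
  - auto_derive; [nra|]. field. nra.
  - eapply is_derive_eq.
    + apply is_derive_scal. apply @is_derive_minus; [apply @is_derive_const | exact D].
    + unfold minus, plus, opp, zero; simpl. destruct H as [-> | H]; [field; nra|].
      replace (eps * (eps * 1) + tau * (tau * 1)) with (1 + eps * (eps * 1)) by nra. field; nra.
Qed.

Lemma atan_le x : 0 <= x -> atan x <= x.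
Proof.
  intros Hx. apply Ropp_le_cancel.
  enough (0 - atan 0 <= x - atan x) by (rewrite atan_0 in H; lra).
  apply (is_derive_nonneg_le (fun t => t - atan t) (fun t => 1 - / (1 + t ^ 2))); auto.
  - intros t _. apply @is_derive_minus; [apply @is_derive_id|].
    apply is_derive_Reals.
    apply derivable_pt_lim_atan.
  - intros t _. assert (/ (1 + t ^ 2) <= / 1) by (apply Rinv_le_contravar; nra). lra.
Qed.

Lemma atan_nonneg x : 0 <= x -> 0 <= atan x.
Proof. intros [H | <-]; [left; rewrite <- atan_0; now apply atan_increasing | rewrite atan_0; lra]. Qed.

Lemma ln_1p_le x : 0 <= x -> 0 <= ln (1 + x) <= x.
Proof.
  intros Hx. split. { rewrite <- ln_1. apply ln_le; lra. }
  rewrite <- (ln_exp x) at 2. apply ln_le; [lra|]. generalize (exp_ineq1_le x); lra.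
Qed.

Lemma Lg_infty tau eps : tau ^ 2 <= 1 -> 1 <= eps -> Cmod (Lg tau eps - ln eps)%C <= 2 / eps.
Proof.
  intros Ht He. eapply Rle_trans; [apply Cmod_le_abs|]. unfold Lg, Re, Im; simpl.
  assert (E : ln (eps * (eps * 1) + tau * (tau * 1)) / 2 + - ln eps = ln (1 + tau ^ 2 / eps ^ 2) / 2).
  { replace (eps * (eps * 1) + tau * (tau * 1)) with (eps * eps * (1 + tau ^ 2 / eps ^ 2)) by (field; lra).
    assert (0 <= tau ^ 2 / eps ^ 2) by (apply Rdiv_le_0_compat; nra).
    rewrite !ln_mult; nra. }
  rewrite E.
  assert (Hq : 0 <= tau ^ 2 / eps ^ 2 <= / eps).
  { split. apply Rdiv_le_0_compat; nra.
    apply Rmult_le_reg_r with (eps ^ 2); [nra|].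
    unfold Rdiv; rewrite Rmult_assoc, Rinv_l, Rmult_1_r by nra. replace (/ eps * eps ^ 2) with eps by (field; lra). lra. }
  generalize (ln_1p_le _ (proj1 Hq)); intros L.
  rewrite Rabs_pos_eq by lra.
  assert (0 < / eps) by (apply Rinv_0_lt_compat; lra).
  assert (Ea : atan eps = PI / 2 - atan (/ eps)). { rewrite atan_inv by lra. ring. }
  rewrite Ea. replace (tau * (PI / 2 - (PI / 2 - atan (/ eps))) + - 0) with (tau * atan (/ eps)) by ring.
  rewrite Rabs_mult, (Rabs_pos_eq (atan _)) by (apply atan_nonneg; lra).
  assert (Rabs tau <= 1). { apply Rabs_le. nra. }
  generalize (atan_le (/ eps) ltac:(lra)) (atan_nonneg (/ eps) ltac:(lra)) (Rabs_pos tau); intros.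
  unfold Rdiv. nra.
Qed.

(** The boundary value i tau pi/2 of the logarithm is the origin of every factor e^(- pi kap / 2)
    and e^(i pi / 4) in the amplitudes. *)
Lemma Lg_zero tau eps : tau ^ 2 = 1 -> 0 < eps <= 1 -> Cmod (Lg tau eps - Ci * (tau * (PI / 2))%R)%C <= 2 * eps.
Proof.
  intros Ht He. eapply Rle_trans; [apply Cmod_le_abs|]. unfold Lg, Re, Im; simpl.
  replace (eps * (eps * 1) + tau * (tau * 1)) with (1 + eps ^ 2) by nra.
  generalize (ln_1p_le (eps ^ 2) ltac:(nra)); intros L.
  replace (ln (1 + eps ^ 2) / 2 + - (0 * (tau * (PI / 2)) - 1 * 0)) with (ln (1 + eps ^ 2) / 2) by ring.
  rewrite Rabs_pos_eq by lra.
  replace (tau * (PI / 2 - atan eps) + - (0 * 0 + 1 * (tau * (PI / 2)))) with (- (tau * atan eps)) by ring.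
  rewrite Rabs_Ropp, Rabs_mult, (Rabs_pos_eq (atan _)) by (apply atan_nonneg; lra).
  assert (Rabs tau <= 1). { apply Rabs_le. nra. }
  generalize (atan_le eps ltac:(lra)) (atan_nonneg eps ltac:(lra)) (Rabs_pos tau); intros. nra.
Qed.

Lemma Lg_0 eps : 0 < eps -> Lg 0 eps = ln eps.
Proof.
  intros He. apply C_ext; unfold Lg; simpl; [|ring].
  replace (eps * (eps * 1) + 0 * (0 * 1)) with (eps * eps) by ring. rewrite ln_mult by auto. field.
Qed.

Lemma Cexp_sub_1_le u : Cmod (Cexp u - 1)%C <= 2 * Cmod u * exp (Cmod u).
Proof.
  replace u with (RtoC (Re u) + Ci * Im u)%C at 1 by (apply C_ext; unfold Re, Im; simpl; ring).
  rewrite Cexp_add, Cexp_RtoC.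
  replace (exp (Re u) * Cexp (Ci * Im u) - 1)%C with (exp (Re u) * (Cexp (Ci * Im u) - 1) + (exp (Re u) - 1)%R)%C
    by (rewrite RtoC_minus; ring).
  eapply Rle_trans; [apply Cmod_triangle|]. rewrite Cmod_mult, Cmod_RtoC, Cmod_R by (left; apply exp_pos).
  generalize (Cmod_Cexp_Ci_sub_1 (Im u)) (Cmod_Im u) (Cmod_Re u) (Cmod_ge_0 u) (exp_pos (Re u)); intros.
  assert (Hab := H1). apply Rabs_le_between in Hab.
  assert (exp (Re u) <= exp (Cmod u)) by (apply exp_le_compat; lra).
  assert (1 <= exp (Cmod u)) by (generalize (exp_ineq1_le (Cmod u)); lra).
  assert (Rabs (exp (Re u) - 1) <= Cmod u * exp (Cmod u)).
  { generalize (exp_ineq1_le (Re u)) (exp_ineq1_le (- Re u)) ; intros G1 G2.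
    assert (E : exp (Re u) * exp (- Re u) = 1) by (rewrite <- exp_plus, Rplus_opp_r; apply exp_0).
    apply Rabs_le. split; nra. }
  assert (exp (Re u) * Cmod (Cexp (Ci * Im u) - 1)%C <= exp (Cmod u) * Cmod u).
  { apply Rmult_le_compat; try lra. apply Cmod_ge_0. }
  lra.
Qed.

(** The function (eps + i tau)^(i kap) (eps + i (tau - 1))^(- 1/2 - i kap). The exponents are the
    residues of the partial fractions of - (1 - 2 kap / (eps + i tau)) / (2 (eps + i (tau - 1))),
    the coefficient in the equation for m. *)
Definition M0 (kap tau eps : R) : C :=
  Cexp (Ci * kap * Lg tau eps - ((1 / 2)%R + Ci * kap) * Lg (tau - 1) eps).

Lemma cderiv_M0 kap tau eps : tau = 0 \/ tau = 1 -> 0 < eps ->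
  cderiv (M0 kap tau) eps (M0 kap tau eps * (- (/ 2)%R * ((1 - (2 * kap)%R / cp tau eps) / cp (tau - 1) eps)))%C.
Proof.
  intros Ht He. eapply cderiv_eq.
  - apply cderiv_Cexp. apply cderiv_minus; apply cderiv_scal; apply cderiv_Lg; auto;
      destruct Ht as [-> | ->]; [left | right | right | left]; ring.
  - fold (M0 kap tau eps). rewrite Cmult_comm. f_equal.
    assert (E : cp tau eps = (cp (tau - 1) eps + Ci)%C) by (apply C_ext; simpl; ring).
    assert (N1 := cp_neq_0 tau eps He). assert (N2 := cp_neq_0 (tau - 1) eps He).
    replace (RtoC (/ 2)) with (/ 2)%C by (apply C_ext; simpl; field).
    replace (RtoC (1 / 2)) with (/ 2)%C by (apply C_ext; simpl; field).
    rewrite RtoC_mult.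
    apply (Cmult_cancel_r (cp tau eps * cp (tau - 1) eps * 2)); [repeat apply Cmult_neq_0; auto; apply RtoC_neq_0; lra|].
    transitivity ((2 * (Ci * kap) * (cp (tau - 1) eps) - (1 + 2 * (Ci * kap)) * cp tau eps))%C. { field. auto. }
    transitivity (- (cp tau eps - 2 * kap))%C. 2:{ field; auto. }
    rewrite E.
    transitivity (- (cp (tau - 1) eps + Ci) - 2 * kap * (Ci * Ci))%C. ring. rewrite Ci2. ring.

Qed.

Lemma M0_neq_0 kap tau eps : M0 kap tau eps <> 0%C.
Proof. apply Cexp_neq_0. Qed.

(** The two exponents add up to -1/2, and each logarithm differs from ln eps by O(1/eps). *)
Lemma M0_infty kap tau : tau = 0 \/ tau = 1 ->
  clim (fun eps => sqrt eps * M0 kap tau eps)%C (Rbar_locally p_infty) 1.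
Proof.
  intros Ht. set (c := 2 * Rabs kap + 1).
  assert (Hc : 1 <= c) by (unfold c; generalize (Rabs_pos kap); lra).
  apply (clim_infty_inv _ _ (2 * (4 * c) * exp (4 * c))). intros eps He.
  set (u := (Ci * kap * (Lg tau eps - ln eps) - ((1 / 2)%R + Ci * kap) * (Lg (tau - 1) eps - ln eps))%C).
  assert (E : (sqrt eps * M0 kap tau eps)%C = Cexp u).
  { rewrite <- Rpower_sqrt by lra. unfold Rpower, M0. rewrite <- Cexp_RtoC, <- Cexp_add. f_equal.
    unfold u. rewrite RtoC_mult. replace (RtoC (/ 2)) with (RtoC (1 / 2)) by (f_equal; field). ring. }
  rewrite E.
  assert (Hi : 0 < / eps <= 1). { split. apply Rinv_0_lt_compat; lra. rewrite <- Rinv_1. apply Rinv_le_contravar; lra. }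
  assert (Hu : Cmod u <= 4 * c / eps).
  { unfold u. eapply Rle_trans; [apply Cmod_minus|]. rewrite !Cmod_mult, Cmod_Ci, Cmod_R, Rmult_1_l.
    assert (T1 : tau ^ 2 <= 1) by (destruct Ht as [-> | ->]; lra).
    assert (T2 : (tau - 1) ^ 2 <= 1) by (destruct Ht as [-> | ->]; lra).
    generalize (Lg_infty tau eps T1 He) (Lg_infty (tau - 1) eps T2 He); intros L1 L2.
    assert (Cmod ((1 / 2)%R + Ci * kap)%C <= 1 + Rabs kap).
    { eapply Rle_trans; [apply Cmod_triangle|]. rewrite Cmod_mult, Cmod_Ci, !Cmod_R, (Rabs_pos_eq (1 / 2)); lra. }
    generalize (Rabs_pos kap) (Cmod_ge_0 ((1 / 2)%R + Ci * kap)%C) (Cmod_ge_0 (Lg (tau - 1) eps - ln eps)%C); intros.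
    apply Rle_trans with (Rabs kap * (2 / eps) + (1 + Rabs kap) * (2 / eps)).
    - apply Rplus_le_compat; [apply Rmult_le_compat_l; auto | apply Rmult_le_compat; auto].
    - unfold c, Rdiv. nra. }
  eapply Rle_trans; [apply Cexp_sub_1_le|].
  assert (exp (Cmod u) <= exp (4 * c)). { apply exp_le_compat. unfold Rdiv in Hu. nra. }
  replace (2 * (4 * c) * exp (4 * c) / eps) with (2 * (4 * c / eps) * exp (4 * c)) by (field; lra).
  apply Rmult_le_compat; try lra. generalize (Cmod_ge_0 u); lra. left; apply exp_pos.
Qed.

Lemma ln_le_sqrt x : 1 <= x -> 0 <= ln x <= 2 * Rpower x (1 / 2).
Proof.
  intros Hx. split. { rewrite <- ln_1. apply ln_le; lra. }
  replace (ln x) with (2 * (1 / 2 * ln x)) by field. apply Rmult_le_compat_l; [lra|].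
  unfold Rpower. generalize (exp_ineq1_le (1 / 2 * ln x)); lra.
Qed.

Lemma ln2_bounds : 0 <= ln 2 <= 1.
Proof.
  split. { rewrite <- ln_1. apply ln_le; lra. }
  rewrite <- (ln_exp 1). apply ln_le; [lra|]. generalize (exp_ineq1_le 1); lra.
Qed.

Lemma ln_half_sqr x : 0 < x -> ln (x ^ 2 / 2) = 2 * ln x - ln 2.
Proof.
  intros Hx. unfold Rdiv. rewrite ln_mult by nra. rewrite ln_Rinv by lra.
  simpl. rewrite Rmult_1_r, ln_mult by auto. ring.
Qed.

Lemma Rpower_ge_1 x a : 1 <= x -> 0 <= a -> 1 <= Rpower x a.
Proof. intros. apply Rle_trans with (Rpower x 0); [rewrite Rpower_O; lra|]. apply Rle_Rpower; lra. Qed.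

Lemma ln_half_large x : 1 <= x -> Rabs (ln (x ^ 2 / 2)) <= 5 * Rpower x (1 / 2).
Proof.
  intros Hx. rewrite ln_half_sqr by lra. generalize (ln_le_sqrt x Hx) ln2_bounds (Rpower_ge_1 x (1 / 2) Hx); intros.
  apply Rabs_le. lra.
Qed.

Lemma ln_half_small x : 0 < x <= 1 -> Rabs (ln (x ^ 2 / 2)) <= 5 * Rpower x (- (1 / 2)).
Proof.
  intros Hx. rewrite ln_half_sqr by lra.
  assert (Hi : 1 <= / x). { rewrite <- Rinv_1. apply Rinv_le_contravar; lra. }
  generalize (ln_le_sqrt (/ x) Hi) ln2_bounds (Rpower_ge_1 (/ x) (1 / 2) Hi). rewrite ln_Rinv by lra.
  replace (Rpower (/ x) (1 / 2)) with (Rpower x (- (1 / 2))).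
  2:{ unfold Rpower. rewrite ln_Rinv by lra. f_equal; ring. }
  intros. apply Rabs_le. lra.
Qed.

Lemma Rabs_ln_small x : 0 < x <= 1 -> Rabs (ln x) <= 2 * Rpower x (- (1 / 2)).
Proof.
  intros Hx.
  assert (Hi : 1 <= / x). { rewrite <- Rinv_1. apply Rinv_le_contravar; lra. }
  generalize (ln_le_sqrt (/ x) Hi). rewrite ln_Rinv by lra.
  replace (Rpower (/ x) (1 / 2)) with (Rpower x (- (1 / 2))).
  2:{ unfold Rpower. rewrite ln_Rinv by lra. f_equal; ring. }
  intros. apply Rabs_le. lra.
Qed.

Lemma Cmod_cpow_Ci (t k : R) : Cmod (cpow t (Ci * k)) = 1.
Proof.
  unfold cpow. rewrite Cmod_cpow. unfold Rpower.
  assert (E : Re (Ci * k)%C = 0) by (unfold Re; simpl; ring). rewrite E, Rmult_0_l. apply exp_0.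
Qed.

Lemma cpow_add t z w : cpow t (z + w) = (cpow t z * cpow t w)%C.
Proof. unfold cpow. rewrite <- Cexp_add. f_equal. ring. Qed.

Lemma cpow_half x : 0 < x -> RtoC x = (sqrt 2 * cpow (x ^ 2 / 2) (1 / 2)%R)%C.
Proof.
  intros Hx. unfold cpow. rewrite <- RtoC_mult, Cexp_RtoC, <- RtoC_mult. f_equal.
  change (exp (1 / 2 * ln (x ^ 2 / 2))) with (Rpower (x ^ 2 / 2) (1 / 2)).
  replace (1 / 2) with (/ 2) by field. rewrite Rpower_sqrt by nra. rewrite <- sqrt_mult by nra.
  replace (2 * (x ^ 2 / 2)) with (x ^ 2) by field. rewrite sqrt_pow2; lra.
Qed.

(** The weight x^j treats both components at once: j = 0 serves the first one, with z = 1/2 + i kap,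
    and j = 1 the second, whose transform comes with a factor x, with k = - kap and z = 1 - i kap.
    The power sqrt 2^j arises from x = sqrt 2 (x^2/2)^(1/2). On (0, 1] the asymptotic form says
    nothing, but function and model are both O(x^(-1/2)) there. *)
Lemma abel_weighted (j : nat) (k C K : R) (D D' : Complex.C) (F m : R -> Complex.C) : (j <= 1)%nat -> 0 <= C -> 0 <= K ->
  (forall x, 0 < x -> ccont F x) ->
  (forall x, 0 < x <= 1 -> Cmod (F x) <= C) ->
  (forall x, 1 <= x -> Cmod (F x - cpow (x ^ 2 / 2) (Ci * k) * (D + D' * ln (x ^ 2 / 2)%R))%C <= K * Rpower x (- (1 / 2))) ->
  (forall eps, 0 < eps -> is_CInt (fun x => gw eps x * ((x ^ j)%R * F x))%C (m eps)) ->
  let z := (((1 + INR j) / 2)%R + Ci * k)%C in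
  clim (fun eps => sqrt 2 * cpow eps z * m eps
         - (sqrt 2 ^ j)%R * (D * CGamma z + D' * (C_derive CGamma z - ln eps * CGamma z)))%C (at_right 0) 0.
Proof.
  intros Hj HC HK Hc Hb Ha Im z.
  assert (Hq : INR j = 0 \/ INR j = 1). { destruct j as [|[|j]]; [left | right | lia]; reflexivity. }
  assert (Rz : Re z = (1 + INR j) / 2) by (unfold z, Re; simpl; field).
  apply clim_ext_loc with (fun eps => sqrt 2 * cpow eps z * m eps
    - ((sqrt 2 ^ j)%R * D * CGamma z + (sqrt 2 ^ j)%R * D' * (C_derive CGamma z - ln eps * CGamma z)))%C.
  { typeclasses eauto. } { apply at_right_0_iff. exists 1; split; [lra|]. intros; ring. }
  set (K' := C + Cmod D + 5 * Cmod D' + K).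
  assert (HK' : 0 <= K') by (unfold K'; generalize (Cmod_ge_0 D) (Cmod_ge_0 D'); lra).
  apply (abel_zero z _ _ (fun x => (x ^ j)%R * F x)%C m K'); auto.
  - rewrite Rz. lra.
  - intros x Hx. apply ccont_mult; auto. apply ccont_id_pow.
  - intros x Hx.
    assert (Ej : cpow (x ^ 2 / 2) (z - (1 / 2)%R) = ((x ^ j)%R * / (sqrt 2 ^ j)%R * cpow (x ^ 2 / 2) (Ci * k))%C).
    { assert (HS : RtoC (sqrt 2) <> 0%C) by (apply RtoC_neq_0; generalize (sqrt_lt_R0 2); lra).
      destruct j as [|[|j]]; [| |lia]; unfold z.
      - replace (_ - _)%C with (Ci * k)%C by (apply C_ext; simpl; field). simpl pow. field.
      - replace (_ - _)%C with ((1 / 2)%R + Ci * k)%C by (apply C_ext; simpl; field).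
        rewrite cpow_add. rewrite !pow_1. rewrite (cpow_half x) by auto. field; auto. }
    assert (Hne : RtoC (sqrt 2 ^ j) <> 0%C). { apply RtoC_neq_0, pow_nonzero. generalize (sqrt_lt_R0 2); lra. }
    replace ((x ^ j)%R * F x - cpow (x ^ 2 / 2) (z - (1 / 2)%R) * ((sqrt 2 ^ j)%R * D + (sqrt 2 ^ j)%R * D' * ln (x ^ 2 / 2)%R))%C
      with ((x ^ j)%R * (F x - cpow (x ^ 2 / 2) (Ci * k) * (D + D' * ln (x ^ 2 / 2)%R)))%C.
    2:{ rewrite Ej. field. auto. }
    rewrite Cmod_mult, Cmod_RtoC by (apply pow_le; lra).
    replace (K' * Rpower x (2 * Re z - 3 / 2)) with (x ^ j * (K' * Rpower x (- (1 / 2)))).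
    2:{ rewrite Rz. replace (2 * ((1 + INR j) / 2) - 3 / 2) with (INR j + - (1 / 2)) by field.
        rewrite Rpower_plus, Rpower_pow by auto. ring. }
    apply Rmult_le_compat_l; [apply pow_le; lra|].
    assert (Hp : 0 < Rpower x (- (1 / 2))) by apply exp_pos.
    generalize (Cmod_ge_0 D) (Cmod_ge_0 D'); intros HD HD'.
    destruct (Rle_dec x 1) as [H1 | H1].
    + generalize (ln_half_small x (conj Hx H1)); intros L.
      assert (P1 : 1 <= Rpower x (- (1 / 2))) by (apply Rpower_ge_1_neg; lra).
      eapply Rle_trans; [apply Cmod_minus|]. rewrite Cmod_mult, Cmod_cpow_Ci, Rmult_1_l.
      specialize (Hb x (conj Hx H1)).
      assert (Cmod (D + D' * ln (x ^ 2 / 2)%R)%C <= Cmod D + Cmod D' * (5 * Rpower x (- (1 / 2)))).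
      { eapply Rle_trans; [apply Cmod_triangle|]. rewrite Cmod_mult, Cmod_R. apply Rplus_le_compat_l, Rmult_le_compat_l; auto. }
      unfold K'. nra.
    + eapply Rle_trans; [apply Ha; lra|]. apply Rmult_le_compat_r; [lra|]. unfold K'; lra.
Qed.

Lemma cderiv_lipschitz (F f : R -> C) (C a b : R) : a <= b ->
  (forall x, a <= x <= b -> cderiv F x (f x)) -> (forall x, a <= x <= b -> Cmod (f x) <= C) ->
  Cmod (F b - F a)%C <= 2 * C * (b - a).
Proof.
  intros Hab Hd Hb.
  assert (L : forall (G g : R -> R), (forall x, a <= x <= b -> is_derive G x (g x)) ->
    (forall x, a <= x <= b -> Rabs (g x) <= C) -> Rabs (G b - G a) <= C * (b - a)).
  { intros G g HG Hg. apply Rabs_le. split.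
    - enough (G a + C * a <= G b + C * b) by lra.
      apply (is_derive_nonneg_le (fun x => G x + C * x) (fun x => g x + C)); auto.
      + intros x Hx. apply @is_derive_plus; auto. auto_derive; auto; ring.
      + intros x Hx. specialize (Hg x Hx). apply Rabs_le_between in Hg. lra.
    - enough (C * a - G a <= C * b - G b) by lra.
      apply (is_derive_nonneg_le (fun x => C * x - G x) (fun x => C - g x)); auto.
      + intros x Hx. apply @is_derive_minus; auto. auto_derive; auto; ring.
      + intros x Hx. specialize (Hg x Hx). apply Rabs_le_between in Hg. lra. }
  eapply Rle_trans; [apply Cmod_le_abs|].
  assert (L1 := L (fun x => Re (F x)) (fun x => Re (f x))). assert (L2 := L (fun x => Im (F x)) (fun x => Im (f x))).
  unfold Re, Im in *; simpl in *. unfold Rminus in *.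
  replace (2 * C * (b + - a)) with (C * (b + - a) + C * (b + - a)) by ring.
  apply Rplus_le_compat; [apply L1 | apply L2]; intros x Hx.
  - apply (Hd x Hx). - eapply Rle_trans; [apply (Cmod_Re (f x)) | auto].
  - apply (Hd x Hx). - eapply Rle_trans; [apply (Cmod_Im (f x)) | auto].
Qed.

(** Joins a derivative bound on [0, 1] with a growth bound beyond 1 into the single estimate that
    [abel_infty] asks for. *)
Lemma sqrt_growth (F f : R -> C) (C M : R) : 0 <= C -> 0 <= M ->
  (forall x, 0 <= x <= 1 -> cderiv F x (f x)) -> (forall x, 0 <= x <= 1 -> Cmod (f x) <= C) ->
  (forall x, 1 <= x -> Cmod (F x - F 0)%C <= M * Rpower x (1 / 2)) ->
  forall x, 0 < x -> Cmod (F x - F 0)%C <= (2 * C + M) * Rpower x (1 / 2).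
Proof.
  intros HC HM Hd Hb Hl x Hx. assert (Hp : 0 < Rpower x (1 / 2)) by apply exp_pos.
  destruct (Rle_dec x 1) as [H1 | H1].
  - assert (x <= Rpower x (1 / 2)). { rewrite <- (Rpower_1 x) at 1 by auto. apply Rpower_le_neg; lra. }
    eapply Rle_trans. apply (cderiv_lipschitz F f C 0 x); try lra; intros; [apply Hd | apply Hb]; lra.
    nra.
  - eapply Rle_trans; [apply Hl; lra|]. nra.
Qed.

Lemma cderiv_inv (f : R -> C) x l : f x <> 0%C -> cderiv f x l -> cderiv (fun t => / f t)%C x (- l / (f x * f x))%C.
Proof.
  intros Hn [H1 H2].
  assert (HN : Re (f x) ^ 2 + Im (f x) ^ 2 <> 0).
  { rewrite <- Cmod_sqr. apply pow_nonzero. intros E. apply Cmod_eq_0 in E; auto. }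
  assert (DN : is_derive (fun t => Re (f t) ^ 2 + Im (f t) ^ 2) x (2 * Re (f x) * Re l + 2 * Im (f x) * Im l)).
  { eapply is_derive_eq. apply @is_derive_plus; apply is_derive_pow; [exact H1 | exact H2].
    unfold plus; simpl. ring. }
  split.
  - eapply is_derive_eq. exact (is_derive_div _ _ _ _ _ H1 DN HN).
    cbv beta. destruct (f x) as [a b] eqn:E. rewrite ?E. destruct l as [c d]. unfold Re, Im in HN; simpl in HN.
    unfold Re, Im; simpl. assert (HN2 : a * a + b * b <> 0) by (intros G; apply HN; rewrite <- G; ring). field. split; [|exact HN2].
    replace (_ + _) with ((a * (a * 1) + b * (b * 1)) ^ 2) by ring. now apply pow_nonzero.
  - eapply is_derive_eq. exact (is_derive_div _ _ _ _ _ (is_derive_opp _ _ _ H2) DN HN).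
    cbv beta. destruct (f x) as [a b] eqn:E. rewrite ?E. destruct l as [c d]. unfold Re, Im in HN; simpl in HN.
    unfold Re, Im, opp; simpl. assert (HN2 : a * a + b * b <> 0) by (intros G; apply HN; rewrite <- G; ring). field. split; [|exact HN2].
    replace (_ + _) with ((a * (a * 1) + b * (b * 1)) ^ 2) by ring. now apply pow_nonzero.
Qed.

(* Variation of constants in eps: [M0] solves the homogeneous equation and is ~ eps^(-1/2) at infinity, which fixes the
   constant. *)
Lemma laplace_solve (kap tau : R) (m S s : R -> C) (c S1 : C) : tau = 0 \/ tau = 1 ->
  (forall eps, 0 < eps -> cderiv m eps
     (m eps * (- (/ 2)%R * ((1 - (2 * kap)%R / cp tau eps) / cp (tau - 1) eps)) + M0 kap tau eps * s eps)%C) ->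
  (forall eps, 0 < eps -> cderiv S eps (s eps)) ->
  clim S (Rbar_locally p_infty) S1 ->
  clim (fun eps => sqrt eps * m eps)%C (Rbar_locally p_infty) c ->
  forall eps, 0 < eps -> m eps = ((c - S1 + S eps) * M0 kap tau eps)%C.
Proof.
  intros Ht Hm HS LS Lm.
  assert (Hq : forall eps, 0 < eps -> cderiv (fun e => m e * / M0 kap tau e - S e)%C eps 0).
  { intros eps He. eapply cderiv_eq.
    - apply cderiv_minus; [|apply HS, He]. apply cderiv_mult; [apply Hm, He|].
      apply cderiv_inv; [apply M0_neq_0 | apply cderiv_M0; auto].
    - cbv beta. generalize (M0_neq_0 kap tau eps) (cp_neq_0 tau eps He) (cp_neq_0 (tau - 1) eps He); intros.
      field. auto. }
  set (q := (m 1 * / M0 kap tau 1 - S 1)%C).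
  assert (Hc : forall eps, 0 < eps -> (m eps * / M0 kap tau eps - S eps)%C = q).
  { intros eps He. unfold q. destruct (Rle_dec eps 1).
    - apply (cderiv_zero_eq (fun e => m e * / M0 kap tau e - S e)%C (fun _ => 0%C)); auto. intros; apply Hq; lra.
    - symmetry. apply (cderiv_zero_eq (fun e => m e * / M0 kap tau e - S e)%C (fun _ => 0%C)); auto; try lra. intros; apply Hq; lra. }
  assert (Em : forall eps, 0 < eps -> m eps = ((q + S eps) * M0 kap tau eps)%C).
  { intros eps He. rewrite <- (Hc eps He). field. apply M0_neq_0. }
  (* The free constant is read off at infinity, where sqrt eps m tends to c and sqrt eps [M0] to
     1. *)
  assert (Eq : c = (q + S1)%C).
  { apply (clim_unique (Rbar_locally p_infty) (fun eps => sqrt eps * m eps)%C); auto.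
    apply clim_ext_loc with (fun eps => (q + S eps) * (sqrt eps * M0 kap tau eps))%C.
    - typeclasses eauto.
    - exists 0. intros x Hx. rewrite (Em x Hx). ring.
    - replace (q + S1)%C with ((q + S1) * 1)%C by ring. apply clim_mult; [typeclasses eauto | | now apply M0_infty].
      apply clim_plus; [typeclasses eauto | apply clim_const; typeclasses eauto | auto]. }
  intros eps He. rewrite (Em eps He), Eq. ring.
Qed.

(** This is e^(- i x^2/4) for tau = 1 and e^(i x^2/4) for tau = 0. Multiplied by the phase of the
    matching component it leaves only the logarithmic part, that is, an imaginary power of x^2/2. *)
Definition et (tau x : R) : C := Cexp (Ci * ((1 / 4 - tau / 2) * x ^ 2)%R).

Lemma Cmod_et tau x : Cmod (et tau x) = 1.
Proof. unfold et. rewrite Cmod_Cexp, <- exp_0. f_equal. unfold Re; simpl; ring. Qed.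

Lemma cderiv_et tau x : cderiv (et tau) x (Ci * ((1 / 2 - tau) * x)%R * et tau x)%C.
Proof.
  apply cderiv_Cexp, cderiv_scal, cderiv_RtoC. auto_derive; auto. field.
Qed.

Lemma et_phase_1 kap x : (et 1 x * phase kap x = cpow (x ^ 2 / 2) (Ci * kap))%C.
Proof.
  unfold et, phase, cpow, theta. rewrite <- Cexp_add. f_equal.
  generalize (ln (x ^ 2 / 2)); intros. apply C_ext; simpl; field.
Qed.

Lemma et_phase_0 kap x : (et 0 x * Cconj (phase kap x) = cpow (x ^ 2 / 2) (Ci * (- kap)%R))%C.
Proof.
  unfold et, phase, cpow, theta. rewrite Cconj_Cexp, <- Cexp_add. f_equal.
  generalize (ln (x ^ 2 / 2)); intros. apply C_ext; simpl; field.
Qed.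

Section Pair.
Variables (kap : R) (y1 y2 h : R -> C) (D1 E1 D2 E2 g : C) (K : R).
Hypothesis HK : 0 <= K.
Hypothesis Hy1 : forall x, cderiv y1 x (Ci * (x / 2)%R * y1 x - (2 * kap)%R * y2 x - 2 * h x)%C.
Hypothesis Hy2 : forall x, cderiv y2 x (y1 x - Ci * (x / 2)%R * y2 x)%C.
Hypothesis Hh : forall x, ccont h x.
Hypothesis y20 : y2 0 = 0%C.
Hypothesis HA1 : forall x, 1 <= x -> Cmod (y1 x - phase kap x * (D1 + E1 * ln (x ^ 2 / 2)%R))%C <= K * Rpower x (- (1 / 2)).
Hypothesis HA2 : forall x, 1 <= x -> Cmod (y2 x - Cconj (phase kap x) * (D2 + E2 * ln (x ^ 2 / 2)%R))%C <= K * Rpower x (- (1 / 2)).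
Hypothesis Ig : is_CInt (fun x => RtoC (gw 1 x)) g.

(** The logarithm in the asymptotic form is paid for by the growth x^(1/2). *)
Lemma pair_growth (y p : R -> C) (d e : C) : (forall x, ccont y x) -> (forall x, Cmod (p x) = 1) ->
  (forall x, 1 <= x -> Cmod (y x - p x * (d + e * ln (x ^ 2 / 2)%R))%C <= K * Rpower x (- (1 / 2))) ->
  exists M, 0 <= M /\ (forall x, 0 <= x <= 1 -> Cmod (y x) <= M) /\ (forall x, 1 <= x -> Cmod (y x) <= M * Rpower x (1 / 2)).
Proof.
  intros Hc Hp Ha. destruct (ccont_bounded y 1) as [M1 H1]; [lra | intros; apply Hc |].
  generalize (Cmod_ge_0 d) (Cmod_ge_0 e) (Rabs_pos M1) (Rle_abs M1); intros.
  exists (Rabs M1 + K + Cmod d + 5 * Cmod e). split; [lra | split].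
  - intros x Hx. specialize (H1 x Hx). lra.
  - intros x Hx. specialize (Ha x Hx).
    generalize (Rpower_ge_1 x (1 / 2) Hx ltac:(lra)) (ln_half_large x Hx); intros P L.
    assert (Rpower x (- (1 / 2)) <= 1).
    { rewrite Rpower_Ropp. apply Rle_trans with (/ 1); [apply Rinv_le_contravar; lra | lra]. }
    replace (y x) with ((y x - p x * (d + e * ln (x ^ 2 / 2)%R)) + p x * (d + e * ln (x ^ 2 / 2)%R))%C by ring.
    eapply Rle_trans; [apply Cmod_triangle|]. rewrite Cmod_mult, Hp, Rmult_1_l.
    assert (Cmod (d + e * ln (x ^ 2 / 2)%R)%C <= Cmod d + Cmod e * (5 * Rpower x (1 / 2))).
    { eapply Rle_trans; [apply Cmod_triangle|]. rewrite Cmod_mult, Cmod_R. apply Rplus_le_compat_l, Rmult_le_compat_l; auto. }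
    nra.
Qed.

(** The source h lets one statement serve twice: h = 0 for the Landau-Zener solution, h = w2 for its
    derivative in kap. The last three clauses are the data at the two ends in eps: the initial value
    y1(0) at infinity, and at 0 the amplitude of whichever component [et] has freed from its
    oscillation. *)
Lemma pair_laplace (tau : R) (NH : R -> C) : tau = 0 \/ tau = 1 ->
  (forall eps, 0 < eps -> is_CInt (fun x => gw eps x * (x * (et tau x * h x)))%C (NH eps)) ->
  exists m : R -> C,
  (forall eps, 0 < eps -> is_CInt (fun x => gw eps x * (x * (et tau x * y2 x)))%C (m eps / cp tau eps)%C) /\
  (forall eps, 0 < eps -> cderiv m eps
     (- (/ 2)%R * ((m eps * (1 - (2 * kap)%R / cp tau eps) - 2 * NH eps) / cp (tau - 1) eps))%C) /\
  clim (fun eps => sqrt eps * m eps)%C (Rbar_locally p_infty) (y1 0 * g)%C /\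
  (tau = 1 -> let z := ((1 / 2)%R + Ci * kap)%C in
     clim (fun eps => sqrt 2 * cpow eps z * m eps
        - (D1 * CGamma z + E1 * (C_derive CGamma z - ln eps * CGamma z)))%C (at_right 0) 0) /\
  (tau = 0 -> let z := (1 - Ci * kap)%C in
     clim (fun eps => sqrt 2 * cpow eps z * (m eps / eps)
        - sqrt 2 * (D2 * CGamma z + E2 * (C_derive CGamma z - ln eps * CGamma z)))%C (at_right 0) 0).
Proof.
  intros Ht HNH.
  assert (C1 : forall x, ccont y1 x) by (intros; eapply cderiv_ccont, Hy1).
  assert (C2 : forall x, ccont y2 x) by (intros; eapply cderiv_ccont, Hy2).
  assert (Ce : forall x, ccont (et tau) x) by (intros; eapply cderiv_ccont, cderiv_et).
  destruct (pair_growth y1 (phase kap) D1 E1 C1 (Cmod_phase kap) HA1) as (M1 & P1 & B1 & G1).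
  destruct (pair_growth y2 (fun x => Cconj (phase kap x)) D2 E2 C2) as (M2 & P2 & B2 & G2).
  { intros; rewrite Cmod_conj; apply Cmod_phase. } { exact HA2. }
  destruct (ccont_bounded h 1) as [M3 B3]; [lra | intros; apply Hh |].
  set (M := M1 + M2).
  assert (HB : forall y Mj, 0 <= Mj <= M -> (forall x, 0 <= x <= 1 -> Cmod (y x) <= Mj) ->
     (forall x, 1 <= x -> Cmod (y x) <= Mj * Rpower x (1 / 2)) ->
     forall x, 0 < x -> Cmod (et tau x * y x)%C <= M * (1 + x) ^ 1).
  { intros y Mj HMj Hb Hg x Hx. rewrite Cmod_mult, Cmod_et, Rmult_1_l, pow_1. destruct (Rle_dec x 1).
    - specialize (Hb x ltac:(lra)). nra.
    - specialize (Hg x ltac:(lra)).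
      assert (Rpower x (1 / 2) <= x). { rewrite <- (Rpower_1 x) at 2 by lra. apply Rle_Rpower; lra. }
      assert (0 < Rpower x (1 / 2)) by apply exp_pos. nra. }
  assert (Hd1 : forall x, cderiv (fun x => et tau x * y1 x)%C x (Ci * ((1 - tau) * x)%R * (et tau x * y1 x)
      - (2 * kap)%R * (et tau x * y2 x) - 2 * (et tau x * h x))%C).
  { intros x. eapply cderiv_eq. apply cderiv_mult; [apply cderiv_et | apply Hy1].
    replace ((1 - tau) * x) with ((1 / 2 - tau) * x + x / 2) by field. rewrite RtoC_plus. ring. }
  assert (Hd2 : forall x, cderiv (fun x => et tau x * y2 x)%C x (et tau x * y1 x - Ci * (tau * x)%R * (et tau x * y2 x))%C).
  { intros x. eapply cderiv_eq. apply cderiv_mult; [apply cderiv_et | apply Hy2].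
    replace (tau * x) with (x / 2 - (1 / 2 - tau) * x) by field. rewrite RtoC_minus. ring. }
  destruct (laplace_ode kap tau M 1 (fun x => et tau x * y1 x)%C (fun x => et tau x * y2 x)%C (fun x => et tau x * h x)%C NH)
    as (m & I1 & I2 & Dm); auto.
  { unfold M; lra. }
  { apply (HB y1 M1); auto. unfold M; lra. } { apply (HB y2 M2); auto. unfold M; lra. }
  { rewrite y20; ring. }
  exists m. split; [exact I2 | split; [exact Dm | split; [| split]]].
  (* A bound on [0, 1] for the derivative of the twisted first component; it gives the estimate near
     0 required by [abel_infty]. *)
  - set (C3 := 2 * M1 + 2 * Rabs kap * M2 + 2 * Rabs M3).
    assert (HC3 : 0 <= C3). { unfold C3. generalize (Rabs_pos kap) (Rabs_pos M3); nra. }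
    assert (Hy0 : (et tau 0 * y1 0)%C = y1 0).
    { unfold et. replace (Ci * ((1 / 4 - tau / 2) * 0 ^ 2)%R)%C with (RtoC 0) by (apply C_ext; simpl; ring). rewrite Cexp_0; ring. }
    rewrite <- Hy0.
    apply (abel_infty (fun x => et tau x * y1 x)%C m _ g (2 * C3 + 2 * M1)); auto.
    { lra. } { intros; apply ccont_mult; auto. }
    apply (sqrt_growth (fun x => et tau x * y1 x)%C (fun x => Ci * ((1 - tau) * x)%R * (et tau x * y1 x)
      - (2 * kap)%R * (et tau x * y2 x) - 2 * (et tau x * h x))%C C3 (2 * M1)); try lra.
    + intros x _. apply Hd1.
    + intros x Hx. assert (HM3 := B3 x Hx). generalize (Rle_abs M3); intros.
      eapply Rle_trans; [apply Cmod_minus|]. eapply Rle_trans; [apply Rplus_le_compat_r, Cmod_minus|].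
      rewrite !Cmod_mult, Cmod_et, Cmod_Ci, !Cmod_R, !Rmult_1_l.
      specialize (B1 x Hx). specialize (B2 x Hx).
      rewrite !Rabs_mult, (Rabs_pos_eq 2) by lra.
      assert (Rabs (1 - tau) * Rabs x <= 1).
      { rewrite (Rabs_pos_eq x) by lra. destruct Ht as [-> | ->].
        rewrite Rminus_0_r, Rabs_R1; lra. rewrite Rminus_diag, Rabs_R0; lra. }
      generalize (Rabs_pos kap) (Rabs_pos (1 - tau)) (Rabs_pos x) (Cmod_ge_0 (y1 x)) (Cmod_ge_0 (y2 x)); intros.
      assert (0 <= Rabs (1 - tau) * Rabs x) by (apply Rmult_le_pos; auto).
      assert (Rabs (1 - tau) * Rabs x * Cmod (y1 x) <= M1) by nra.
      assert (2 * Rabs kap * Cmod (y2 x) <= 2 * Rabs kap * M2) by nra.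
      unfold C3. lra.
    + intros x Hx. eapply Rle_trans; [apply Cmod_minus|]. rewrite !Cmod_mult, !Cmod_et, !Rmult_1_l.
      specialize (G1 x Hx). specialize (B1 0 ltac:(lra)). generalize (Rpower_ge_1 x (1 / 2) Hx ltac:(lra)). nra.
  - intros E z. subst tau.
    assert (AW := abel_weighted 0 kap M1 K D1 E1 (fun x => et 1 x * y1 x)%C m ltac:(lia) P1 HK).
    replace ((1 + INR 0) / 2) with (1 / 2) in AW by (simpl; field). fold z in AW.
    eapply clim_ext_loc; [typeclasses eauto | | apply AW].
    + apply at_right_0_iff. exists 1; split; [lra|]. intros. simpl pow. ring.
    + intros; apply ccont_mult; auto.
    + intros x Hx. rewrite Cmod_mult, Cmod_et, Rmult_1_l. apply B1; lra.
    + intros x Hx. rewrite <- et_phase_1.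
      replace (et 1 x * y1 x - et 1 x * phase kap x * (D1 + E1 * ln (x ^ 2 / 2)%R))%C
        with (et 1 x * (y1 x - phase kap x * (D1 + E1 * ln (x ^ 2 / 2)%R)))%C by ring.
      rewrite Cmod_mult, Cmod_et, Rmult_1_l. auto.
    + intros eps He. eapply is_CInt_ext; [|apply I1, He]. intros x Hx; simpl pow. cbv beta. ring.
  - intros E z. subst tau.
    assert (AW := abel_weighted 1 (- kap) M2 K D2 E2 (fun x => et 0 x * y2 x)%C (fun eps => m eps / cp 0 eps)%C ltac:(lia) P2 HK).
    replace (((1 + INR 1) / 2)%R + Ci * (- kap)%R)%C with z in AW.
    2:{ unfold z. apply C_ext; simpl; field. }
    eapply clim_ext_loc; [typeclasses eauto | | apply AW].
    + apply at_right_0_iff. exists 1; split; [lra|]. intros x Hx. rewrite pow_1. reflexivity.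
    + intros; apply ccont_mult; auto.
    + intros x Hx. rewrite Cmod_mult, Cmod_et, Rmult_1_l. apply B2; lra.
    + intros x Hx. rewrite <- et_phase_0.
      replace (et 0 x * y2 x - et 0 x * Cconj (phase kap x) * (D2 + E2 * ln (x ^ 2 / 2)%R))%C
        with (et 0 x * (y2 x - Cconj (phase kap x) * (D2 + E2 * ln (x ^ 2 / 2)%R)))%C by ring.
      rewrite Cmod_mult, Cmod_et, Rmult_1_l. auto.
    + intros eps He. eapply is_CInt_ext; [|apply I2, He]. intros x Hx; cbv beta. rewrite pow_1. ring.
Qed.

End Pair.

Definition expLg (c : C) (tau eps : R) : C := Cexp (c * Lg tau eps).

Lemma expLg_zero c tau : tau ^ 2 = 1 -> exists K, 0 <= K /\ forall eps, 0 < eps <= 1 ->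
  Cmod (expLg c tau eps - Cexp (c * (Ci * (tau * (PI / 2))%R)))%C <= K * eps.
Proof.
  intros Ht. set (E0 := Cexp (c * (Ci * (tau * (PI / 2))%R))).
  exists (Cmod E0 * (2 * (Cmod c * 2) * exp (Cmod c * 2))).
  generalize (Cmod_ge_0 E0) (Cmod_ge_0 c) (exp_pos (Cmod c * 2)); intros.
  split. { apply Rmult_le_pos; [lra|]. apply Rmult_le_pos; lra. }
  intros eps He. set (u := (c * (Lg tau eps - Ci * (tau * (PI / 2))%R))%C).
  assert (E : expLg c tau eps = (E0 * Cexp u)%C). { unfold expLg, E0, u. rewrite <- Cexp_add. f_equal. ring. }
  rewrite E. replace (E0 * Cexp u - E0)%C with (E0 * (Cexp u - 1))%C by ring. rewrite Cmod_mult, Rmult_assoc.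
  apply Rmult_le_compat_l; auto. eapply Rle_trans; [apply Cexp_sub_1_le|].
  assert (Hu : Cmod u <= Cmod c * 2 * eps).
  { unfold u. rewrite Cmod_mult, Rmult_assoc. apply Rmult_le_compat_l; auto. apply Lg_zero; auto. }
  assert (exp (Cmod u) <= exp (Cmod c * 2)) by (apply exp_le_compat; nra).
  apply Rle_trans with (2 * (Cmod c * 2 * eps) * exp (Cmod c * 2)); [|right; ring].
  apply Rmult_le_compat; auto. generalize (Cmod_ge_0 u); lra. left; apply exp_pos. lra.
Qed.

Lemma expLg_clim c tau : tau ^ 2 = 1 ->
  clim (expLg c tau) (at_right 0) (Cexp (c * (Ci * (tau * (PI / 2))%R))).
Proof. intros Ht. destruct (expLg_zero c tau Ht) as (K & _ & HK). eapply clim_at_right_lin, HK. Qed.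

(** Convergence at the rate eps beats ln eps; this disposes of the divergent logarithms in the
    second transform. *)
Lemma expLg_ln_clim c tau : tau ^ 2 = 1 ->
  clim (fun eps => (expLg c tau eps - Cexp (c * (Ci * (tau * (PI / 2))%R))) * ln eps)%C (at_right 0) 0.
Proof.
  intros Ht. destruct (expLg_zero c tau Ht) as (K & K0 & HK).
  apply (clim_at_right_rpower _ _ (K * 2) (1 / 2)); [lra|]. intros x Hx.
  unfold Cminus at 1. rewrite Copp_0, Cplus_0_r, Cmod_mult, Cmod_R.
  specialize (HK x Hx). generalize (Rabs_ln_small x Hx); intros L.
  apply Rle_trans with (K * x * (2 * Rpower x (- (1 / 2)))).
  - apply Rmult_le_compat; auto. apply Cmod_ge_0. apply Rabs_pos.
  - right. rewrite <- (Rpower_1 x) at 1 by lra.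
    transitivity (K * 2 * (Rpower x 1 * Rpower x (- (1 / 2)))). ring. rewrite <- Rpower_plus. do 2 f_equal. field.
Qed.

Lemma Lg_clim tau : tau ^ 2 = 1 -> clim (Lg tau) (at_right 0) (Ci * (tau * (PI / 2))%R)%C.
Proof. intros Ht. apply (clim_at_right_lin _ _ 2). intros; now apply Lg_zero. Qed.

(** For tau = 1 the singular factor of [M0] is eps^(- 1/2 - i kap), exactly the inverse of the
    normalising power; the other factor has a limit as eps -> 0. *)
Lemma M0_tau1 (kap eps : R) : 0 < eps ->
  (cpow eps ((1 / 2)%R + Ci * kap) * M0 kap 1 eps = expLg (Ci * kap) 1 eps)%C.
Proof.
  intros He. unfold cpow, M0, expLg. rewrite Rminus_diag, Lg_0 by auto. rewrite <- Cexp_add. f_equal. ring.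
Qed.

(** For tau = 0 the singular factor of [M0] is eps^(i kap), and the division by eps comes from the
    second component's transform m / (eps + i tau). *)
Lemma M0_tau0 (kap eps : R) : 0 < eps ->
  (cpow eps (1 - Ci * kap) * (M0 kap 0 eps / eps) = expLg (- ((1 / 2)%R + Ci * kap)) (-1) eps)%C.
Proof.
  intros He. unfold cpow, M0, expLg. rewrite Lg_0 by auto. replace (0 - 1) with (-1) by ring.
  assert (E : (/ eps = Cexp (- ln eps))%C).
  { rewrite <- RtoC_opp, Cexp_RtoC, exp_Ropp, exp_ln, RtoC_inv; auto; lra. }
  unfold Cdiv. rewrite E, <- !Cexp_add. f_equal. ring.
Qed.

Ltac solve_filter := typeclasses eauto.

(** * Amplitudes and their parameter derivatives in terms of Gamma *)

Section Identities.
Variables (kap : R) (w1 w2 : R -> C) (A B g : C) (K : R).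
Hypothesis Hs : lz_sys kap w1 w2.
Hypothesis HK : 0 <= K.
Hypothesis HA : forall x, 1 <= x -> Cmod (w1 x - phase kap x * A)%C <= K / x.
Hypothesis HB : forall x, 1 <= x -> Cmod (w2 x - Cconj (phase kap x) * B)%C <= K / x.
Hypothesis Ig : is_CInt (fun x => RtoC (gw 1 x)) g.

Lemma inv_le_rpower x : 1 <= x -> / x <= Rpower x (- (1 / 2)).
Proof.
  intros Hx. replace (/ x) with (Rpower x (- (1))) by (rewrite Rpower_Ropp, Rpower_1; lra). apply Rle_Rpower; lra.
Qed.

Lemma lz_asym_weak (y : R -> C) (p : R -> C) (D : C) : (forall x, 1 <= x -> Cmod (y x - p x * D)%C <= K / x) ->
  forall x, 1 <= x -> Cmod (y x - p x * (D + 0 * ln (x ^ 2 / 2)%R))%C <= K * Rpower x (- (1 / 2)).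
Proof.
  intros H x Hx. replace (D + 0 * ln (x ^ 2 / 2)%R)%C with D by ring.
  eapply Rle_trans; [now apply H|]. apply Rmult_le_compat_l; auto. now apply inv_le_rpower.
Qed.

Lemma is_CInt_zero : is_CInt (fun _ => 0%C) 0.
Proof.
  assert (H := is_CInt_scal 0 _ _ (is_CInt_Gamma 1 ltac:(simpl; lra))). rewrite Cmult_0_l in H.
  apply is_CInt_ext with (2 := H). intros; ring.
Qed.

(** Without source the transform is a multiple of [M0], and w1(0) = 1 makes the multiple equal to g.
    The first clause is kept because it becomes the source term of the second transform. *)
Lemma lz_first_laplace tau : tau = 0 \/ tau = 1 ->
  (forall eps, 0 < eps -> is_CInt (fun x => gw eps x * (x * (et tau x * w2 x)))%C (g * M0 kap tau eps / cp tau eps)%C) /\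
  (tau = 1 -> let z := ((1 / 2)%R + Ci * kap)%C in
     clim (fun eps => sqrt 2 * cpow eps z * (g * M0 kap tau eps) - A * CGamma z)%C (at_right 0) 0) /\
  (tau = 0 -> let z := (1 - Ci * kap)%C in
     clim (fun eps => sqrt 2 * cpow eps z * (g * M0 kap tau eps / eps) - sqrt 2 * (B * CGamma z))%C (at_right 0) 0).
Proof.
  intros Ht. assert (Hs' := Hs). destruct Hs' as (W1 & W2 & Hd).
  destruct (pair_laplace kap w1 w2 (fun _ => 0%C) A 0 B 0 g K HK) with (tau := tau) (NH := fun _ : R => RtoC 0)
    as (m & I2 & Dm & Li & L1 & L0); auto.
  { intros x. eapply cderiv_eq; [exact (lz_d1 kap w1 w2 Hs x)|]. ring. }
  { exact (lz_d2 kap w1 w2 Hs). }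
  { intros x. apply ccont_const. }
  { apply lz_asym_weak, HA. }
  { apply (lz_asym_weak w2 (fun x => Cconj (phase kap x))), HB. }
  { intros eps He. eapply is_CInt_ext; [|apply is_CInt_zero]. intros; simpl; ring. }
  rewrite W1, Cmult_1_l in Li.
  assert (Em : forall eps, 0 < eps -> m eps = (g * M0 kap tau eps)%C).
  { intros eps He.
    rewrite (laplace_solve kap tau m (fun _ => 0%C) (fun _ => 0%C) g 0 Ht) with (5 := He); auto.
    - ring.
    - intros e He'. eapply cderiv_eq; [apply Dm, He'|]. field. split; apply cp_neq_0; auto.
    - intros; apply cderiv_const.
    - apply clim_const; solve_filter. }
  split; [|split].
  - intros eps He. rewrite <- Em by auto. auto.
  - intros E z. eapply clim_ext_loc; [solve_filter | | apply (L1 E)].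
    apply at_right_0_iff. exists 1; split; [lra|]. intros x Hx. cbv beta. rewrite Em by lra. fold z. ring.
  - intros E z. eapply clim_ext_loc; [solve_filter | | apply (L0 E)].
    apply at_right_0_iff. exists 1; split; [lra|]. intros x Hx. cbv beta. rewrite Em by lra. fold z. ring.
Qed.

Lemma Cexp_tau1 : Cexp (Ci * kap * (Ci * (1 * (PI / 2))%R)) = RtoC (exp (- (PI * kap / 2))).
Proof.
  rewrite <- Cexp_RtoC. f_equal. apply C_ext; simpl; field.
Qed.

(** Two evaluations of one limit as eps -> 0 for tau = 1: from the amplitude of w1, and from the
    closed form g [M0]. *)
Lemma lz_A_Gamma : (A * CGamma ((1 / 2)%R + Ci * kap) = sqrt 2 * g * exp (- (PI * kap / 2))%R)%C.
Proof.
  destruct (lz_first_laplace 1) as (_ & L & _); auto. specialize (L eq_refl). cbv zeta in L.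
  set (z := ((1 / 2)%R + Ci * kap)%C) in *.
  assert (E : clim (fun eps => sqrt 2 * cpow eps z * (g * M0 kap 1 eps) - A * CGamma z)%C (at_right 0)
     (sqrt 2 * g * Cexp (Ci * kap * (Ci * (1 * (PI / 2))%R)) - A * CGamma z)%C).
  { eapply clim_ext_loc; [solve_filter | | apply clim_minus; [solve_filter | apply clim_scal; [solve_filter | apply (expLg_clim (Ci * kap)%C 1); ring] | apply clim_const; solve_filter]].
    apply at_right_0_iff. exists 1; split; [lra|]. intros x Hx. cbv beta.
    rewrite <- M0_tau1 by lra. fold z. ring. }
  assert (E' := clim_unique (at_right 0) _ _ _ L E). rewrite Cexp_tau1 in E'.
  replace (A * CGamma z)%C with (sqrt 2 * g * exp (- (PI * kap / 2))%R - (sqrt 2 * g * exp (- (PI * kap / 2))%R - A * CGamma z))%C by ring.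
  rewrite <- E'. ring.
Qed.

(** The same comparison for tau = 0. The exponential is e^(i pi/4 - pi kap/2). *)
Lemma lz_B_Gamma : (B * CGamma (1 - Ci * kap) = g * Cexp (- ((1 / 2)%R + Ci * kap) * (Ci * (-1 * (PI / 2))%R)))%C.
Proof.
  destruct (lz_first_laplace 0) as (_ & _ & L); auto. specialize (L eq_refl). cbv zeta in L.
  set (z := (1 - Ci * kap)%C) in *. set (E0 := Cexp _).
  assert (E : clim (fun eps => sqrt 2 * cpow eps z * (g * M0 kap 0 eps / eps) - sqrt 2 * (B * CGamma z))%C (at_right 0)
     (sqrt 2 * g * E0 - sqrt 2 * (B * CGamma z))%C).
  { eapply clim_ext_loc; [solve_filter | | apply clim_minus; [solve_filter | apply clim_scal; [solve_filter | apply (expLg_clim (- ((1 / 2)%R + Ci * kap))%C (-1)); ring] | apply clim_const; solve_filter]].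
    apply at_right_0_iff. exists 1; split; [lra|]. intros x Hx. cbv beta.
    rewrite <- M0_tau0 by lra. fold z. field. apply RtoC_neq_0; lra. }
  assert (E' := clim_unique (at_right 0) _ _ _ L E).
  assert (H2 : RtoC (sqrt 2) <> 0%C) by (apply RtoC_neq_0; generalize (sqrt_lt_R0 2); lra).
  apply (Cmult_cancel_r (sqrt 2)); auto.
  replace (B * CGamma z * sqrt 2)%C with (sqrt 2 * g * E0 - (sqrt 2 * g * E0 - sqrt 2 * (B * CGamma z)))%C by ring.
  rewrite <- E'. ring.
Qed.

Variables (v1 v2 : R -> C) (D1 D2 : C) (K' : R).
Hypothesis HK' : 0 <= K'.
Hypothesis Hv1 : forall x, cderiv v1 x (Ci * (x / 2)%R * v1 x - (2 * kap)%R * v2 x - 2 * w2 x)%C.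
Hypothesis Hv2 : forall x, cderiv v2 x (v1 x - Ci * (x / 2)%R * v2 x)%C.
Hypothesis v10 : v1 0 = 0%C.
Hypothesis v20 : v2 0 = 0%C.
Hypothesis HD1 : forall x, 1 <= x -> Cmod (v1 x - phase kap x * (D1 + Ci * A * ln (x ^ 2 / 2)%R))%C <= K' * Rpower x (- (1 / 2)).
Hypothesis HD2 : forall x, 1 <= x -> Cmod (v2 x - Cconj (phase kap x) * (D2 + - (Ci * B) * ln (x ^ 2 / 2)%R))%C <= K' * Rpower x (- (1 / 2)).

Lemma Lg_diff_infty tau : tau = 0 \/ tau = 1 ->
  clim (fun eps => Lg tau eps - Lg (tau - 1) eps)%C (Rbar_locally p_infty) 0.
Proof.
  intros Ht. assert (T1 : tau ^ 2 <= 1) by (destruct Ht as [-> | ->]; lra).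
  assert (T2 : (tau - 1) ^ 2 <= 1) by (destruct Ht as [-> | ->]; lra).
  apply (clim_infty_inv _ _ 4). intros x Hx.
  replace (Lg tau x - Lg (tau - 1) x - 0)%C with ((Lg tau x - ln x) - (Lg (tau - 1) x - ln x))%C by ring.
  eapply Rle_trans; [apply Cmod_minus|]. generalize (Lg_infty tau x T1 Hx) (Lg_infty (tau - 1) x T2 Hx).
  unfold Rdiv; intros; lra.
Qed.

(** The pair (v1, v2) solves the system differentiated in kap with zero initial data, and its
    logarithmic coefficients i A and - i B are those that differentiating the phases in kap
    produces. Accordingly its transform is g times the kap-derivative of [M0], namely g i ([Lg] tau
    - [Lg] (tau - 1)) [M0]. *)
Lemma lz_second_laplace tau : tau = 0 \/ tau = 1 ->
  (tau = 1 -> let z := ((1 / 2)%R + Ci * kap)%C in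
     clim (fun eps => sqrt 2 * cpow eps z * (g * Ci * (Lg tau eps - Lg (tau - 1) eps) * M0 kap tau eps)
         - (D1 * CGamma z + Ci * A * (C_derive CGamma z - ln eps * CGamma z)))%C (at_right 0) 0) /\
  (tau = 0 -> let z := (1 - Ci * kap)%C in
     clim (fun eps => sqrt 2 * cpow eps z * (g * Ci * (Lg tau eps - Lg (tau - 1) eps) * M0 kap tau eps / eps)
        - sqrt 2 * (D2 * CGamma z + - (Ci * B) * (C_derive CGamma z - ln eps * CGamma z)))%C (at_right 0) 0).
Proof.
  intros Ht. destruct (lz_first_laplace tau Ht) as (IN & _ & _).
  destruct (pair_laplace kap v1 v2 w2 D1 (Ci * A)%C D2 (- (Ci * B))%C g K' HK') with (tau := tau) (NH := fun eps => (g * M0 kap tau eps / cp tau eps)%C)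
    as (m & I2 & Dm & Li & L1 & L0); auto.
  { intros x. eapply cderiv_ccont, Hs. }
  rewrite v10, Cmult_0_l in Li.
  assert (Em : forall eps, 0 < eps -> m eps = (g * Ci * (Lg tau eps - Lg (tau - 1) eps) * M0 kap tau eps)%C).
  { intros eps He.
    rewrite (laplace_solve kap tau m (fun eps => g * Ci * (Lg tau eps - Lg (tau - 1) eps))%C
      (fun eps => g * Ci * (/ cp tau eps - / cp (tau - 1) eps))%C 0 0 Ht) with (5 := He); auto.
    - ring.
    - intros e He'. eapply cderiv_eq; [apply Dm, He'|].
      assert (E : cp tau e = (cp (tau - 1) e + Ci)%C) by (apply C_ext; simpl; ring).
      assert (N1 := cp_neq_0 tau e He'). assert (N2 := cp_neq_0 (tau - 1) e He').
      apply (Cmult_cancel_r (2 * cp tau e * cp (tau - 1) e)); [repeat apply Cmult_neq_0; auto; apply RtoC_neq_0; lra|].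
      replace (RtoC (/ 2)) with (/ 2)%C by (apply C_ext; simpl; field).
      transitivity (- (m e * (cp tau e - (2 * kap)%R) - 2 * (g * M0 kap tau e)))%C. { field. auto. }
      transitivity (- (m e * (cp tau e - (2 * kap)%R)) + 2 * (M0 kap tau e * (g * Ci * (cp (tau - 1) e - cp tau e))))%C. 2:{ field; auto. }
      rewrite E. transitivity (- (m e * (cp (tau - 1) e + Ci - (2 * kap)%R)) - 2 * (M0 kap tau e * (g * (Ci * Ci))))%C; [rewrite Ci2; ring | ring].
    - intros e He'. apply cderiv_scal. apply cderiv_minus; apply cderiv_Lg; auto; destruct Ht as [-> | ->]; [left | right | right | left]; ring.
    - replace (RtoC 0) with (g * Ci * 0)%C by ring. apply clim_scal; [solve_filter|]. now apply Lg_diff_infty. }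
  split.
  - intros E z. eapply clim_ext_loc; [solve_filter | | apply (L1 E)].
    apply at_right_0_iff. exists 1; split; [lra|]. intros x Hx. cbv beta. rewrite Em by lra. reflexivity.
  - intros E z. eapply clim_ext_loc; [solve_filter | | apply (L0 E)].
    apply at_right_0_iff. exists 1; split; [lra|]. intros x Hx. cbv beta. rewrite Em by lra. reflexivity.
Qed.

(** Formally this is [lz_A_Gamma] differentiated in kap, with D1 in the role of dA/dkap. The ln eps
    terms of the two sides carry the same coefficient by [lz_A_Gamma] itself, so they cancel and a
    finite limit remains. *)
Lemma lz_D1_Gamma : let z := ((1 / 2)%R + Ci * kap)%C in
  (D1 * CGamma z = - (Ci * A * C_derive CGamma z) - (PI / 2)%R * (A * CGamma z))%C.
Proof.
  intros z. destruct (lz_second_laplace 1) as (L & _); auto. specialize (L eq_refl). cbv zeta in L. fold z in L.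
  assert (EA := lz_A_Gamma). rewrite <- Cexp_tau1 in EA. fold z in EA.
  set (E0 := Cexp (Ci * kap * (Ci * (1 * (PI / 2))%R))) in *.
  assert (E : clim (fun eps => sqrt 2 * g * Ci * (expLg (Ci * kap) 1 eps * Lg 1 eps)
      - sqrt 2 * g * Ci * ((expLg (Ci * kap) 1 eps - E0) * ln eps)
      - (D1 * CGamma z + Ci * A * C_derive CGamma z))%C (at_right 0)
     (sqrt 2 * g * Ci * (E0 * (Ci * (1 * (PI / 2))%R)) - sqrt 2 * g * Ci * 0 - (D1 * CGamma z + Ci * A * C_derive CGamma z))%C).
  { apply clim_minus; [solve_filter | | apply clim_const; solve_filter]. apply clim_minus; [solve_filter | |]; apply clim_scal; try solve_filter.
    - apply clim_mult; [solve_filter | apply expLg_clim; ring | apply Lg_clim; ring].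
    - apply expLg_ln_clim; ring. }
  assert (E2 : clim (fun eps => sqrt 2 * cpow eps z * (g * Ci * (Lg 1 eps - Lg (1 - 1) eps) * M0 kap 1 eps)
         - (D1 * CGamma z + Ci * A * (C_derive CGamma z - ln eps * CGamma z)))%C (at_right 0)
     (sqrt 2 * g * Ci * (E0 * (Ci * (1 * (PI / 2))%R)) - sqrt 2 * g * Ci * 0 - (D1 * CGamma z + Ci * A * C_derive CGamma z))%C).
  { eapply clim_ext_loc; [solve_filter | | exact E]. apply at_right_0_iff. exists 1; split; [lra|]. intros x Hx. cbv beta.
    transitivity (sqrt 2 * (cpow x z * M0 kap 1 x) * (g * Ci * (Lg 1 x - Lg (1 - 1) x))
         - D1 * CGamma z - Ci * A * C_derive CGamma z + Ci * (A * CGamma z) * ln x)%C; [|ring].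
    rewrite (M0_tau1 kap x (proj1 Hx) : (cpow x z * M0 kap 1 x = _)%C). rewrite EA, Rminus_diag, Lg_0 by lra. ring. }
  assert (E3 := clim_unique (at_right 0) _ _ _ L E2).
  rewrite EA.
  replace (D1 * CGamma z)%C with (sqrt 2 * g * Ci * (E0 * (Ci * (1 * (PI / 2))%R)) - Ci * A * C_derive CGamma z -
    (sqrt 2 * g * Ci * (E0 * (Ci * (1 * (PI / 2))%R)) - sqrt 2 * g * Ci * 0 - (D1 * CGamma z + Ci * A * C_derive CGamma z)))%C by ring.
  rewrite <- E3. rewrite Rmult_1_l.
  transitivity (Ci * Ci * (sqrt 2 * g * E0 * (PI / 2)%R) - Ci * A * C_derive CGamma z)%C; [ring | rewrite Ci2; ring].
Qed.

(** Formally [lz_B_Gamma] differentiated in kap; the sign of the Gamma term flips because z = 1 - i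
    kap. *)
Lemma lz_D2_Gamma : let z := (1 - Ci * kap)%C in
  (D2 * CGamma z = Ci * B * C_derive CGamma z - (PI / 2)%R * (B * CGamma z))%C.
Proof.
  intros z. destruct (lz_second_laplace 0) as (_ & L); auto. specialize (L eq_refl). cbv zeta in L. fold z in L.
  assert (EB := lz_B_Gamma). fold z in EB.
  set (c := (- ((1 / 2)%R + Ci * kap))%C) in *.
  set (E0 := Cexp (c * (Ci * (-1 * (PI / 2))%R))) in *.
  set (s := RtoC (sqrt 2)) in *.
  assert (E : clim (fun eps => - s * g * Ci * (expLg c (-1) eps * Lg (-1) eps)
      + s * g * Ci * ((expLg c (-1) eps - E0) * ln eps)
      - s * (D2 * CGamma z - Ci * B * C_derive CGamma z))%C (at_right 0)
     (- s * g * Ci * (E0 * (Ci * (-1 * (PI / 2))%R)) + s * g * Ci * 0 - s * (D2 * CGamma z - Ci * B * C_derive CGamma z))%C).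
  { apply clim_minus; [solve_filter | | apply clim_const; solve_filter]. apply clim_plus; [solve_filter | |]; apply clim_scal; try solve_filter.
    - apply clim_mult; [solve_filter | apply expLg_clim; ring | apply Lg_clim; ring].
    - apply expLg_ln_clim; ring. }
  assert (E2 : clim (fun eps => s * cpow eps z * (g * Ci * (Lg 0 eps - Lg (0 - 1) eps) * M0 kap 0 eps / eps)
         - s * (D2 * CGamma z + - (Ci * B) * (C_derive CGamma z - ln eps * CGamma z)))%C (at_right 0)
      (- s * g * Ci * (E0 * (Ci * (-1 * (PI / 2))%R)) + s * g * Ci * 0 - s * (D2 * CGamma z - Ci * B * C_derive CGamma z))%C).
  { eapply clim_ext_loc; [solve_filter | | exact E]. apply at_right_0_iff. exists 1; split; [lra|]. intros x Hx. cbv beta.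
    transitivity (s * (cpow x z * (M0 kap 0 x / x)) * (g * Ci * (Lg 0 x - Lg (0 - 1) x))
         - s * D2 * CGamma z + s * Ci * B * C_derive CGamma z - s * Ci * (B * CGamma z) * ln x)%C; [|unfold Cdiv; ring].
    rewrite (M0_tau0 kap x (proj1 Hx) : (cpow x z * (M0 kap 0 x / x) = _)%C). fold c.
    rewrite EB, Lg_0 by lra. replace (0 - 1) with (-1) by ring. ring. }
  assert (E3 := clim_unique (at_right 0) _ _ _ L E2).
  assert (H2 : s <> 0%C) by (apply RtoC_neq_0; generalize (sqrt_lt_R0 2); lra).
  apply (Cmult_cancel_r s); auto.
  rewrite EB.
  replace (D2 * CGamma z * s)%C with (- s * g * Ci * (E0 * (Ci * (-1 * (PI / 2))%R)) + s * Ci * B * C_derive CGamma z -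
    (- s * g * Ci * (E0 * (Ci * (-1 * (PI / 2))%R)) + s * g * Ci * 0 - s * (D2 * CGamma z - Ci * B * C_derive CGamma z)))%C by ring.
  rewrite <- E3. replace (-1 * (PI / 2)) with (- (PI / 2)) by ring. rewrite RtoC_opp.
  transitivity (Ci * Ci * (s * g * E0 * (PI / 2)%R) + s * Ci * B * C_derive CGamma z)%C; [ring | rewrite Ci2; ring].
Qed.

End Identities.

(** * Kummer functions as solutions of the system *)

Lemma pow_div_fact_le_exp (u : R) (n : nat) : 0 <= u -> u ^ n / INR (fact n) <= exp u.
Proof.
  intros Hu. eapply Rle_trans; [|apply (exp_ge_taylor u n Hu)].
  destruct n as [|n]; [simpl; lra|]. rewrite tech5.
  assert (0 <= sum_f_R0 (fun k => u ^ k / INR (fact k)) n).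
  { apply cond_pos_sum. intros k. apply Rdiv_le_0_compat; [now apply pow_le | apply INR_fact_lt_0]. }
  lra.
Qed.

(** A coefficient bound of exponential type: it forces an infinite radius of convergence, so the
    series can be added and differentiated at every real point. *)
Definition entire (c : nat -> C) : Prop :=
  exists M q : R, 0 <= q /\ forall n, Cmod (c n) <= M * (q ^ n / INR (fact n)).

Lemma entire_radius (a : nat -> R) (M q : R) : 0 <= q -> (forall n, Rabs (a n) <= M * (q ^ n / INR (fact n))) ->
  forall x : R, Rbar_lt (Rabs x) (CV_radius a).
Proof.
  intros Hq Ha x. destruct (CV_radius_bounded a) as [H _].
  apply Rbar_lt_le_trans with (Finite (Rabs x + 1)); [simpl; lra|].
  apply H. exists (Rabs M * exp (q * (Rabs x + 1))). intros n.
  assert (Hx : 0 <= Rabs x + 1) by (generalize (Rabs_pos x); lra).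
  rewrite Rabs_mult, (Rabs_pos_eq (_ ^ _)) by now apply pow_le.
  assert (H0 : 0 <= q ^ n / INR (fact n)) by (apply Rdiv_le_0_compat; [now apply pow_le | apply INR_fact_lt_0]).
  apply Rle_trans with (Rabs M * (q ^ n / INR (fact n)) * (Rabs x + 1) ^ n).
  - apply Rmult_le_compat_r; [now apply pow_le|]. eapply Rle_trans; [apply Ha|].
    apply Rmult_le_compat_r; [auto | apply Rle_abs].
  - rewrite Rmult_assoc. apply Rmult_le_compat_l; [apply Rabs_pos|].
    eapply Rle_trans; [|apply (pow_div_fact_le_exp _ n); now apply Rmult_le_pos].
    rewrite Rpow_mult_distr. right. field. apply INR_fact_neq_0.
Qed.

Lemma entire_scal (z : C) c : entire c -> entire (fun n => z * c n)%C.
Proof.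
  intros (M & q & Hq & H). exists (Cmod z * M), q. split; auto. intros n.
  rewrite Cmod_mult, Rmult_assoc. apply Rmult_le_compat_l; [apply Cmod_ge_0 | auto].
Qed.

(** A complex series in a real variable is enough: the argument of the Kummer functions is i t with
    t = x^2/2, and the powers of i are moved into the coefficients by [kcoef]. *)
Definition CPS (c : nat -> C) (t : R) : C := (PSeries (fun n => Re (c n)) t, PSeries (fun n => Im (c n)) t).

Lemma entire_re c : entire c -> forall x : R, Rbar_lt (Rabs x) (CV_radius (fun n => Re (c n))).
Proof.
  intros (M & q & Hq & H). apply (entire_radius _ M q Hq). intros n. eapply Rle_trans; [apply Cmod_Re | apply H].
Qed.

Lemma entire_im c : entire c -> forall x : R, Rbar_lt (Rabs x) (CV_radius (fun n => Im (c n))).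
Proof.
  intros (M & q & Hq & H). apply (entire_radius _ M q Hq). intros n. eapply Rle_trans; [apply Cmod_Im | apply H].
Qed.

Lemma cderiv_CPS c t : entire c -> cderiv (CPS c) t (CPS (fun n => INR (S n) * c (S n))%C t).
Proof.
  intros H. split.
  - eapply is_derive_eq; [apply is_derive_PSeries, (entire_re c H)|].
    unfold CPS, Re at 2; cbv beta iota delta [fst]. apply PSeries_ext. intros n. unfold PS_derive, Re, Cmult, RtoC. cbn [fst snd]. ring.
  - eapply is_derive_eq; [apply is_derive_PSeries, (entire_im c H)|].
    unfold CPS, Im at 2; cbv beta iota delta [snd]. apply PSeries_ext. intros n. unfold PS_derive, Im, Cmult, RtoC. cbn [fst snd]. ring.
Qed.

Lemma CPS_ext c d t : (forall n, c n = d n) -> CPS c t = CPS d t.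
Proof. intros E. apply C_ext; apply PSeries_ext; intros n; now rewrite E. Qed.

Lemma CPS_plus c d t : entire c -> entire d -> CPS (fun n => c n + d n)%C t = (CPS c t + CPS d t)%C.
Proof.
  intros Hc Hd. apply C_ext.
  - transitivity (PSeries (PS_plus (fun n => Re (c n)) (fun n => Re (d n))) t).
    + apply PSeries_ext; intros n; reflexivity.
    + apply PSeries_plus; apply CV_radius_inside; now apply entire_re.
  - transitivity (PSeries (PS_plus (fun n => Im (c n)) (fun n => Im (d n))) t).
    + apply PSeries_ext; intros n; reflexivity.
    + apply PSeries_plus; apply CV_radius_inside; now apply entire_im.
Qed.

Lemma CPS_Rscal (r : R) c t : CPS (fun n => r * c n)%C t = (r * CPS c t)%C.
Proof.
  apply C_ext.
  - transitivity (PSeries (PS_scal r (fun n => Re (c n))) t).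
    + apply PSeries_ext; intros n. unfold PS_scal, scal, Re; simpl; unfold mult; simpl; ring.
    + rewrite PSeries_scal. unfold CPS, Re; simpl; ring.
  - transitivity (PSeries (PS_scal r (fun n => Im (c n))) t).
    + apply PSeries_ext; intros n. unfold PS_scal, scal, Im; simpl; unfold mult; simpl; ring.
    + rewrite PSeries_scal. unfold CPS, Im; simpl; ring.
Qed.

Lemma CPS_Ci c t : CPS (fun n => Ci * c n)%C t = (Ci * CPS c t)%C.
Proof.
  apply C_ext.
  - transitivity (PSeries (PS_scal (-1) (fun n => Im (c n))) t).
    + apply PSeries_ext; intros n. unfold PS_scal, scal, Re, Im; simpl; unfold mult; simpl; ring.
    + rewrite PSeries_scal. unfold CPS, Re; simpl; ring.
  - transitivity (PSeries (fun n => Re (c n)) t).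
    + apply PSeries_ext; intros n. unfold Re, Im; simpl; ring.
    + unfold CPS, Im; simpl; ring.
Qed.

Lemma CPS_shift c (t : R) : (t * CPS (fun n => INR (S n) * c (S n)) t = CPS (fun n => INR n * c n) t)%C.
Proof.
  apply C_ext.
  - transitivity (t * PSeries (PS_derive (fun n => Re (c n))) t).
    + unfold Re at 1, CPS at 1, Cmult at 1, RtoC at 1. cbn [fst snd]. rewrite Rmult_0_l, Rminus_0_r. f_equal. apply PSeries_ext. intros n.
      unfold PS_derive, Re, Cmult, RtoC. cbn [fst snd]. ring.
    + rewrite <- PSeries_incr_1. apply PSeries_ext. intros [|n]; unfold PS_incr_1, PS_derive, zero, Re, Cmult, RtoC; cbn [fst snd AbelianMonoid.zero]; [simpl; ring | ring].
  - transitivity (t * PSeries (PS_derive (fun n => Im (c n))) t).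
    + unfold Im at 1, CPS at 1, Cmult at 1, RtoC at 1. cbn [fst snd]. rewrite Rmult_0_l, Rplus_0_r. f_equal. apply PSeries_ext. intros n.
      unfold PS_derive, Im, Cmult, RtoC. cbn [fst snd]. ring.
    + rewrite <- PSeries_incr_1. apply PSeries_ext. intros [|n]; unfold PS_incr_1, PS_derive, zero, Im, Cmult, RtoC; cbn [fst snd AbelianMonoid.zero]; [simpl; ring | ring].
Qed.

Lemma CPS_0 c : CPS c 0 = c 0%nat.
Proof. apply C_ext; unfold CPS; simpl; rewrite PSeries_0; reflexivity. Qed.

Definition kcoef (alpha beta : C) (n : nat) : C :=
  (pochhammer alpha n / pochhammer beta n * (Ci ^ n / INR (fact n)))%C.

Lemma kummer_CPS alpha beta (t : R) : kummer alpha beta (Ci * t)%C = CPS (kcoef alpha beta) t.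
Proof.
  unfold kummer, CSeries, CPS, PSeries.
  assert (E : forall n, (pochhammer alpha n / pochhammer beta n * ((Ci * t) ^ n / INR (fact n)) = kcoef alpha beta n * (t ^ n)%R)%C).
  { intros n. unfold kcoef. rewrite Cpow_mult_l, RtoC_pow. unfold Cdiv. ring. }
  f_equal; apply Series_ext; intros n; rewrite E; unfold Re, Im; simpl; ring.
Qed.

Lemma half_plus_neq (s : R) (n : nat) : 0 < s -> (RtoC s + INR n)%C <> 0%C.
Proof.
  intros Hs. rewrite <- RtoC_plus. apply RtoC_neq_0. generalize (pos_INR n); lra.
Qed.

Lemma pochhammer_neq_0 (s : R) n : 0 < s -> pochhammer s n <> 0%C.
Proof.
  intros Hs. induction n as [|n IH]; simpl.
  - apply RtoC_neq_0; lra.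
  - apply Cmult_neq_0; auto. now apply half_plus_neq.
Qed.

Lemma kcoef_succ alpha (s : R) n : 0 < s ->
  (INR (S n) * kcoef alpha s (S n) = Ci * ((alpha + INR n) / (s + INR n)) * kcoef alpha s n)%C.
Proof.
  intros Hs. unfold kcoef. rewrite fact_simpl, mult_INR, RtoC_mult. simpl pochhammer. simpl Cpow.
  assert (N1 := pochhammer_neq_0 s n Hs). assert (N2 := half_plus_neq s n Hs).
  assert (N3 : RtoC (INR (S n)) <> 0%C) by (apply RtoC_neq_0, not_0_INR; lia).
  assert (N4 : RtoC (INR (fact n)) <> 0%C) by (apply RtoC_neq_0, INR_fact_neq_0).
  field. auto.
Qed.

Lemma kcoef_entire alpha (s : R) : / 2 <= s -> entire (kcoef alpha s).
Proof.
  (* Bounds the coefficient ratio: |alpha + n| / (s + n) <= q because s >= 1/2. *)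
  intros Hs. set (q := 1 + 2 * Cmod alpha). assert (Hq : 1 <= q) by (unfold q; generalize (Cmod_ge_0 alpha); lra).
  exists 1, q. split; [lra|]. intros n. rewrite Rmult_1_l. induction n as [|n IH].
  - unfold kcoef. simpl. replace (1 / 1 * (1 / 1))%C with (RtoC 1) by (field; apply RtoC_neq_0; lra). rewrite Cmod_1. lra.
  - assert (Hn : 0 < INR (S n)) by (apply lt_0_INR; lia).
    apply Rmult_le_reg_l with (INR (S n)); auto.
    rewrite <- (Cmod_RtoC (INR (S n))) at 1 by lra. rewrite <- Cmod_mult, kcoef_succ by lra.
    rewrite !Cmod_mult, Cmod_Ci, Rmult_1_l, Cmod_div by (apply half_plus_neq; lra).
    rewrite <- RtoC_plus, (Cmod_RtoC (s + INR n)) by (generalize (pos_INR n); lra).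
    replace (INR (S n) * (q ^ S n / INR (fact (S n)))) with (q * (q ^ n / INR (fact n))).
    2:{ rewrite fact_simpl, mult_INR. simpl pow. field. split; [apply INR_fact_neq_0 | lra]. }
    apply Rmult_le_compat; auto; try apply Cmod_ge_0.
    + apply Rdiv_le_0_compat; [apply Cmod_ge_0 | generalize (pos_INR n); lra].
    + apply Rmult_le_reg_r with (s + INR n); [generalize (pos_INR n); lra|].
      unfold Rdiv. rewrite Rmult_assoc, Rinv_l, Rmult_1_r by (generalize (pos_INR n); lra).
      eapply Rle_trans; [apply Cmod_triangle|]. rewrite Cmod_RtoC by apply pos_INR.
      unfold q. generalize (pos_INR n) (Cmod_ge_0 alpha); nra.
Qed.

(** With kap = chi^2/8, [kw1] is psi1 and [kw2] is psi2 / (i chi / 2). Expressed in kap the pair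
    makes sense for kap < 0 too, where chi would not be real. *)
Definition kw1 (kap x : R) : C := (Cexp (- zeta x / 2) * kummer (1 / 2 + Ci * kap) (1 / 2) (zeta x))%C.
Definition kw2 (kap x : R) : C := (x * Cexp (- zeta x / 2) * kummer (1 / 2 + Ci * kap) (3 / 2) (zeta x))%C.

Lemma zeta_eq x : zeta x = (Ci * (x ^ 2 / 2)%R)%C.
Proof. unfold zeta. apply C_ext; simpl; field. Qed.

Lemma C_half : (1 / 2)%C = RtoC (/ 2).
Proof. apply C_ext; simpl; field. Qed.

Lemma C_three_half : (3 / 2)%C = RtoC (3 / 2).
Proof. apply C_ext; simpl; field. Qed.

Section Kummer.
Variable kap : R.
Let al : C := (1 / 2 + Ci * kap)%C.
Let c1 := kcoef al (/ 2)%R.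
Let c2 := kcoef al (3 / 2)%R.

Lemma poch_ratio n : (pochhammer (3 / 2)%R n = pochhammer (/ 2)%R n * (2 * INR n + 1))%C.
Proof.
  induction n as [|n IH]; [simpl; ring|].
  simpl pochhammer. rewrite IH, S_INR, RtoC_plus.
  replace (RtoC (3 / 2)) with ((2 * 1 + 1) / 2)%C by (apply C_ext; simpl; field).
  replace (RtoC (/ 2)) with (1 / 2)%C by (apply C_ext; simpl; field).
  field.
Qed.

(** Coefficient form of the contiguous relation U = V + 2 t V' for the series U, V in t. *)
Lemma kcoef_half_three_half n : c1 n = ((2 * INR n + 1) * c2 n)%C.
Proof.
  unfold c1, c2, kcoef. rewrite poch_ratio.
  assert (N1 := pochhammer_neq_0 (/ 2) n ltac:(lra)).
  assert (N2 : (2 * INR n + 1)%C <> 0%C).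
  { rewrite <- RtoC_mult, <- RtoC_plus. apply RtoC_neq_0. generalize (pos_INR n); lra. }
  assert (N4 : RtoC (INR (fact n)) <> 0%C) by (apply RtoC_neq_0, INR_fact_neq_0).
  field. auto.
Qed.

(** Coefficient form of U' = i U - 2 kap V. *)
Lemma kcoef_half_succ n : (INR (S n) * c1 (S n) = Ci * c1 n + (- (2 * kap))%R * c2 n)%C.
Proof.
  unfold c1 at 1. rewrite kcoef_succ by lra. fold c1. rewrite kcoef_half_three_half.
  assert (N2 : (2 * INR n + 1)%C <> 0%C).
  { rewrite <- RtoC_mult, <- RtoC_plus. apply RtoC_neq_0. generalize (pos_INR n); lra. }
  unfold al. replace (RtoC (/ 2)) with (1 / 2)%C by (apply C_ext; simpl; field).
  rewrite RtoC_opp, RtoC_mult.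
  transitivity ((Ci * (2 * INR n + 1) + 2 * kap * (Ci * Ci)) * c2 n)%C.
  - field; repeat split; (let G := fresh in intros G; apply N2; rewrite <- G; ring).
  - rewrite Ci2. ring.
Qed.

Lemma cderiv_sqr_half f x l : cderiv f (x ^ 2 / 2) l -> cderiv (fun x => f (x ^ 2 / 2)) x (x * l)%C.
Proof. intros H. apply cderiv_comp; auto. auto_derive; auto; field. Qed.

(** The two contiguous relations are already a first-order system in t = x^2/2. The chain rule and
    the factor e^(- i x^2/4) turn it into the Landau-Zener system. *)
Lemma lz_sys_kummer : lz_sys kap (kw1 kap) (kw2 kap).
Proof.
  assert (H1 : entire c1) by (apply kcoef_entire; lra). assert (H2 : entire c2) by (apply kcoef_entire; lra).
  assert (E1 : forall x, kw1 kap x = (Cexp (- Ci * (x ^ 2 / 4)%R) * CPS c1 (x ^ 2 / 2))%C).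
  { intros x. unfold kw1. rewrite zeta_eq. fold al. rewrite C_half, kummer_CPS.
    replace (- (Ci * (x ^ 2 / 2)%R) / 2)%C with (- Ci * (x ^ 2 / 4)%R)%C by (apply C_ext; simpl; field). reflexivity. }
  assert (E2 : forall x, kw2 kap x = (x * Cexp (- Ci * (x ^ 2 / 4)%R) * CPS c2 (x ^ 2 / 2))%C).
  { intros x. unfold kw2. rewrite zeta_eq. fold al. rewrite C_three_half, kummer_CPS.
    replace (- (Ci * (x ^ 2 / 2)%R) / 2)%C with (- Ci * (x ^ 2 / 4)%R)%C by (apply C_ext; simpl; field). reflexivity. }
  assert (DF1 : forall t, cderiv (CPS c1) t (Ci * CPS c1 t - (2 * kap)%R * CPS c2 t)%C).
  { intros t. eapply cderiv_eq; [apply cderiv_CPS, H1|].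
    rewrite (CPS_ext _ _ t kcoef_half_succ).
    rewrite (CPS_plus _ _ t (entire_scal Ci _ H1) (entire_scal _ _ H2)), CPS_Ci, CPS_Rscal. rewrite RtoC_opp. ring. }
  set (F2' := fun t => CPS (fun n => INR (S n) * c2 (S n))%C t).
  assert (DF2 : forall t, cderiv (CPS c2) t (F2' t)) by (intros; apply cderiv_CPS, H2).
  assert (E3 : forall t, (CPS c1 t = 2 * (t * F2' t) + CPS c2 t)%C).
  { intros t. unfold F2'. rewrite CPS_shift, <- CPS_Rscal.
    rewrite (CPS_ext (fun n => 2 * (INR n * c2 n))%C (fun n => c1 n + (- (1))%R * c2 n)%C); [|intros n; rewrite kcoef_half_three_half; rewrite RtoC_opp; ring].
    rewrite CPS_plus, CPS_Rscal; auto. rewrite RtoC_opp; ring. apply entire_scal, H2. }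
  split; [|split].
  - rewrite E1. replace (0 ^ 2 / 4) with 0 by field. replace (0 ^ 2 / 2) with 0 by field. rewrite CPS_0.
    replace (- Ci * 0)%C with (RtoC 0) by ring. rewrite Cexp_0. unfold c1, kcoef. simpl. field.
  - rewrite E2. ring.
  - intros x.
    assert (De : cderiv (fun x => Cexp (- Ci * (x ^ 2 / 4)%R)) x (- Ci * (x / 2)%R * Cexp (- Ci * (x ^ 2 / 4)%R))%C).
    { apply cderiv_Cexp, cderiv_scal, cderiv_RtoC. auto_derive; auto; field. }
    split.
    + eapply cderiv_ext; [intros t; symmetry; apply E1|]. rewrite E1, E2.
      eapply cderiv_eq; [apply cderiv_mult; [exact De | apply cderiv_sqr_half, DF1]|].
      cbv beta. replace (RtoC x) with (RtoC (x / 2) + RtoC (x / 2))%C by (rewrite <- RtoC_plus; f_equal; field). ring.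
    + eapply cderiv_ext; [intros t; symmetry; apply E2|]. rewrite E1, E2, E3.
      eapply cderiv_eq; [apply cderiv_mult; [apply cderiv_mult; [apply (cderiv_RtoC (fun x => x)), @is_derive_id | exact De] | apply cderiv_sqr_half, DF2]|].
      cbv beta. change (RtoC one) with (RtoC 1).
      replace (RtoC (x ^ 2 / 2)) with (x * x / 2)%C by (apply C_ext; simpl; field). field.
Qed.
End Kummer.

(** * Moduli of the amplitudes *)

(** Only existence, reality and positivity are settled here; the value of g is found later from
    Gamma. Reality comes from invariance under conjugation. *)
Lemma gauss_const_exists : exists g : R, 0 < g /\ is_CInt (fun x => RtoC (gw 1 x)) (RtoC g).
Proof.
  destruct (gauss_ex (fun _ => 1%C) 1 1 0) as [l Hl]; try lra.
  { intros; apply ccont_const. } { intros; rewrite Cmod_1; simpl; lra. }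
  assert (H : is_CInt (fun x => RtoC (gw 1 x)) l). { eapply is_CInt_ext; [|exact Hl]. intros; simpl; ring. }
  assert (Hr : l = RtoC (Re l)).
  { apply C_ext; simpl; auto.
    assert (E : Cconj l = l).
    { apply (is_CInt_unique (fun x => RtoC (gw 1 x))); auto.
      eapply is_CInt_ext; [|apply is_CInt_conj, H]. intros; apply Cconj_RtoC. }
    apply (f_equal snd) in E. simpl in E. unfold Im. lra. }
  exists (Re l). split; [|now rewrite <- Hr].
  destruct H as (F & l0 & D & L0 & L1).
  assert (Dr : forall x, 0 < x -> is_derive (fun t => Re (F t)) x (gw 1 x)) by (intros x Hx; apply (D x Hx)).
  assert (Hm : forall x y, 0 < x -> x <= y -> Re (F x) <= Re (F y)).
  { intros x y Hx Hy. apply (is_derive_nonneg_le (fun t => Re (F t)) (gw 1)); auto.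
    intros; apply Dr; lra. intros; left; apply gw_pos. }
  assert (Hlt : Re (F 1) < Re (F 2)).
  (* On [1, 2] the integrand is at least e^(-2), so the monotone primitive gains a definite amount
     there. *)
  { assert (Re (F 1) + exp (- 2) * 1 <= Re (F 2)).
    { enough (Re (F 1) - exp (- 2) * 1 <= Re (F 2) - exp (- 2) * 2) by lra.
      apply (is_derive_nonneg_le (fun t => Re (F t) - exp (- 2) * t) (fun t => gw 1 t - exp (- 2))); try lra.
      - intros x Hx. apply @is_derive_minus; [apply Dr; lra|]. auto_derive; auto; ring.
      - intros x Hx. unfold gw. enough (exp (- 2) <= exp (- (1 * (x ^ 2 / 2)))) by lra. apply exp_le_compat. nra. }
    generalize (exp_pos (- 2)); lra. }
  assert (B0 : Re l0 <= Re (F 1)).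
  { apply le_epsilon. intros e He. specialize (L0 e He). apply at_right_0_iff in L0. destruct L0 as (d & Hd & L0).
    assert (Hx : 0 < Rmin (d / 2) 1) by (apply Rmin_glb_lt; lra).
    specialize (L0 (Rmin (d / 2) 1)). generalize (Rmin_l (d / 2) 1) (Rmin_r (d / 2) 1); intros.
    specialize (L0 ltac:(lra)). generalize (Cmod_Re (F (Rmin (d / 2) 1) - l0)%C) (Hm _ 1 Hx ltac:(lra)); intros G1 G2.
    unfold Re in *; simpl in G1. apply Rabs_le_between in G1. lra. }
  assert (B1 : Re (F 2) <= Re (l0 + l)%C).
  { apply le_epsilon. intros e He. destruct (L1 e He) as [M L1'].
    specialize (L1' (Rmax 2 (M + 1))). generalize (Rmax_l 2 (M + 1)) (Rmax_r 2 (M + 1)); intros.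
    specialize (L1' ltac:(lra)). generalize (Cmod_Re (F (Rmax 2 (M + 1)) - (l0 + l))%C) (Hm 2 _ ltac:(lra) H); intros G1 G2.
    unfold Re in *; simpl in *. apply Rabs_le_between in G1. lra. }
  unfold Re in *; simpl in *. lra.
Qed.

Definition gamma_half (kap : R) : C := CGamma ((1 / 2)%R + Ci * kap).
Definition gamma_one (kap : R) : C := CGamma (1 - Ci * kap).

Lemma gamma_half_even kap : Cmod (gamma_half (- kap)) = Cmod (gamma_half kap).
Proof.
  unfold gamma_half. rewrite <- (Cmod_conj (CGamma ((1 / 2)%R + Ci * kap))), <- CGamma_conj by (simpl; lra).
  do 2 f_equal. apply C_ext; simpl; ring.
Qed.

Lemma gamma_one_even kap : Cmod (gamma_one (- kap)) = Cmod (gamma_one kap).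
Proof.
  unfold gamma_one. rewrite <- (Cmod_conj (CGamma (1 - Ci * kap))), <- CGamma_conj by (simpl; lra).
  do 2 f_equal. apply C_ext; simpl; ring.
Qed.

Lemma Cmod_diff_le (a b : C) : Rabs (Cmod a - Cmod b) <= Cmod (a - b)%C.
Proof.
  apply Rabs_le. split.
  - enough (Cmod b <= Cmod a + Cmod (a - b)%C) by lra. replace b with (a - (a - b))%C at 1 by ring. apply Cmod_minus.
  - enough (Cmod a <= Cmod (a - b)%C + Cmod b) by lra. replace a with ((a - b) + b)%C at 1 by ring. apply Cmod_triangle.
Qed.

Lemma zero_of_inv_bound (c K : R) : (forall x, 1 <= x -> Rabs c <= K / x) -> c = 0.
Proof.
  intros H. destruct (Req_dec c 0) as [|Hc]; auto. exfalso.
  assert (Hp : 0 < Rabs c) by now apply Rabs_pos_lt.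
  assert (Hk := H 1 ltac:(lra)). unfold Rdiv in Hk; rewrite Rinv_1 in Hk.
  (* At this point the bound reads |c| <= |c| / 2. *)
  specialize (H (2 * K / Rabs c)).
  assert (1 <= 2 * K / Rabs c). { apply Rmult_le_reg_r with (Rabs c); auto. unfold Rdiv; rewrite Rmult_assoc, Rinv_l; lra. }
  specialize (H H0). replace (K / (2 * K / Rabs c)) with (Rabs c / 2) in H by (field; lra). lra.
Qed.

Section Moduli.
Variable g : R.
Hypothesis g_pos : 0 < g.
Hypothesis Ig : is_CInt (fun x => RtoC (gw 1 x)) (RtoC g).

Lemma amplitude_sum kap w1 w2 (A B : C) K : lz_sys kap w1 w2 -> 0 <= K ->
  (forall x, 1 <= x -> Cmod (w1 x - phase kap x * A)%C <= K / x /\ Cmod (w2 x - Cconj (phase kap x) * B)%C <= K / x) ->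
  Cmod A ^ 2 + 2 * kap * Cmod B ^ 2 = 1.
Proof.
  intros Hs HK H.
  assert (HA := Cmod_ge_0 A). assert (HB := Cmod_ge_0 B).
  enough (Cmod A ^ 2 + 2 * kap * Cmod B ^ 2 - 1 = 0) by lra.
  apply (zero_of_inv_bound _ (K * (2 * Cmod A + K) + 2 * Rabs kap * (K * (2 * Cmod B + K)))).
  intros x Hx. destruct (H x Hx) as [H1 H2].
  rewrite <- (lz_conserved kap w1 w2 Hs x).
  assert (S : forall (m a : R), 0 <= m -> 0 <= a -> Rabs (m - a) <= K / x -> Rabs (a ^ 2 - m ^ 2) <= K * (2 * a + K) / x).
  { intros m a Hm Ha Hd. replace (a ^ 2 - m ^ 2) with ((a - m) * (a + m)) by ring.
    rewrite Rabs_mult, (Rabs_pos_eq (a + m)), Rabs_minus_sym by lra.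
    assert (K / x <= K). { unfold Rdiv. rewrite <- (Rmult_1_r K) at 2. apply Rmult_le_compat_l; auto.
      rewrite <- Rinv_1. apply Rinv_le_contravar; lra. }
    apply Rle_trans with (K / x * (2 * a + K)); [|right; field; lra].
    apply Rmult_le_compat; auto. apply Rabs_pos. lra. apply Rabs_le_between in Hd. lra. }
  assert (D1 : Rabs (Cmod (w1 x) - Cmod A) <= K / x).
  { rewrite <- (Rmult_1_l (Cmod A)), <- (Cmod_phase kap x), <- Cmod_mult. eapply Rle_trans; [apply Cmod_diff_le | auto]. }
  assert (D2 : Rabs (Cmod (w2 x) - Cmod B) <= K / x).
  { rewrite <- (Rmult_1_l (Cmod B)), <- (Cmod_phase kap x), <- (Cmod_conj (phase kap x)), <- Cmod_mult. eapply Rle_trans; [apply Cmod_diff_le | auto]. }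
  assert (S1 := S _ _ (Cmod_ge_0 (w1 x)) HA D1). assert (S2 := S _ _ (Cmod_ge_0 (w2 x)) HB D2).
  replace (_ - _) with ((Cmod A ^ 2 - Cmod (w1 x) ^ 2) + 2 * kap * (Cmod B ^ 2 - Cmod (w2 x) ^ 2)) by ring.
  eapply Rle_trans; [apply Rabs_triang|]. rewrite !Rabs_mult, (Rabs_pos_eq 2) by lra.
  replace ((K * (2 * Cmod A + K) + 2 * Rabs kap * (K * (2 * Cmod B + K))) / x)
    with (K * (2 * Cmod A + K) / x + 2 * Rabs kap * (K * (2 * Cmod B + K) / x)) by (field; lra).
  apply Rplus_le_compat; auto. apply Rmult_le_compat_l; auto. generalize (Rabs_pos kap); lra.
Qed.

(** The squared moduli are packaged as numbers a, b fixed by their products with Gamma moduli, for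
    either sign of kap; the Kummer pair guarantees that amplitudes exist. The last clause ties a and
    b to the amplitudes of any solution given later. *)
Lemma gamma_sum kap : exists a b : R,
  0 <= a /\ 0 <= b /\ a * Cmod (gamma_half kap) ^ 2 = 2 * g ^ 2 * exp (- (PI * kap)) /\
  b * Cmod (gamma_one kap) ^ 2 = g ^ 2 * exp (- (PI * kap)) /\ a + 2 * kap * b = 1 /\
  forall w1 w2 A B K, lz_sys kap w1 w2 -> 0 <= K ->
   (forall x, 1 <= x -> Cmod (w1 x - phase kap x * A)%C <= K / x /\ Cmod (w2 x - Cconj (phase kap x) * B)%C <= K / x) ->
   a = Cmod A ^ 2 /\ b = Cmod B ^ 2.
Proof.
  assert (HG : forall w1 w2 A B K, lz_sys kap w1 w2 -> 0 <= K ->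
   (forall x, 1 <= x -> Cmod (w1 x - phase kap x * A)%C <= K / x /\ Cmod (w2 x - Cconj (phase kap x) * B)%C <= K / x) ->
     Cmod A ^ 2 * Cmod (gamma_half kap) ^ 2 = 2 * g ^ 2 * exp (- (PI * kap)) /\
     Cmod B ^ 2 * Cmod (gamma_one kap) ^ 2 = g ^ 2 * exp (- (PI * kap))).
  { intros w1 w2 A B K Hs HK H.
    assert (E2 : exp (- (PI * kap / 2)) ^ 2 = exp (- (PI * kap))).
    { simpl. rewrite Rmult_1_r, <- exp_plus. f_equal. field. }
    assert (EA := lz_A_Gamma kap w1 w2 A B g K Hs HK (fun x Hx => proj1 (H x Hx)) (fun x Hx => proj2 (H x Hx)) Ig).
    assert (EB := lz_B_Gamma kap w1 w2 A B g K Hs HK (fun x Hx => proj1 (H x Hx)) (fun x Hx => proj2 (H x Hx)) Ig).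
    apply (f_equal Cmod) in EA. apply (f_equal Cmod) in EB. fold (gamma_half kap) in EA. fold (gamma_one kap) in EB.
    rewrite !Cmod_mult in EA. rewrite !Cmod_mult, Cmod_Cexp in EB.
    rewrite !Cmod_RtoC in EA by (first [apply sqrt_pos | left; apply exp_pos | lra]).
    rewrite Cmod_RtoC in EB by lra.
    replace (Re _) with (- (PI * kap / 2)) in EB by (unfold Re; simpl; field).
    rewrite <- !Rpow_mult_distr, EA, EB, !Rpow_mult_distr, E2, pow2_sqrt by lra. auto. }
  destruct (lz_asymptotics kap _ _ (lz_sys_kummer kap)) as (A & B & K & HK & H).
  assert (Hs := lz_sys_kummer kap).
  destruct (HG _ _ A B K Hs HK H) as [G1 G2].
  assert (S := amplitude_sum kap _ _ A B K Hs HK H).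
  assert (Ex : 0 < exp (- (PI * kap))) by apply exp_pos.
  assert (N1 : 0 < Cmod (gamma_half kap) ^ 2).
  { destruct (Req_dec (Cmod (gamma_half kap)) 0) as [Z|Z]. rewrite Z in G1. assert (0 < 2 * g ^ 2 * exp (- (PI * kap))) by (apply Rmult_lt_0_compat; nra). nra.
    generalize (Cmod_ge_0 (gamma_half kap)); intros. apply pow_lt. lra. }
  assert (N2 : 0 < Cmod (gamma_one kap) ^ 2).
  { destruct (Req_dec (Cmod (gamma_one kap)) 0) as [Z|Z]. rewrite Z in G2. assert (0 < g ^ 2 * exp (- (PI * kap))) by (apply Rmult_lt_0_compat; nra). nra.
    generalize (Cmod_ge_0 (gamma_one kap)); intros. apply pow_lt. lra. }
  exists (Cmod A ^ 2), (Cmod B ^ 2).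
  split; [apply pow2_ge_0 | split; [apply pow2_ge_0 | split; [exact G1 | split; [exact G2 | split; [exact S|]]]]].
  intros w1 w2 A' B' K' Hs' HK' H'. destruct (HG _ _ A' B' K' Hs' HK' H') as [G1' G2'].
  split; [apply Rmult_eq_reg_r with (Cmod (gamma_half kap) ^ 2) | apply Rmult_eq_reg_r with (Cmod (gamma_one kap) ^ 2)]; lra.
Qed.

(* Even and odd parts in kap of [gamma_sum]. *)
Lemma gamma_parity kap :
  4 * g ^ 2 = (exp (PI * kap) + exp (- (PI * kap))) * Cmod (gamma_half kap) ^ 2 /\
  4 * kap * g ^ 2 = (exp (PI * kap) - exp (- (PI * kap))) * Cmod (gamma_one kap) ^ 2.
Proof.
  destruct (gamma_sum kap) as (a & b & _ & _ & Ha & Hb & S & _).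
  destruct (gamma_sum (- kap)) as (a' & b' & _ & _ & Ha' & Hb' & S' & _).
  rewrite gamma_half_even in Ha'. rewrite gamma_one_even in Hb'.
  replace (- (PI * - kap)) with (PI * kap) in Ha', Hb' by ring.
  set (p := exp (PI * kap)) in *. set (m := exp (- (PI * kap))) in *.
  assert (pm : p * m = 1). { unfold p, m. rewrite <- exp_plus, Rplus_opp_r. apply exp_0. }
  assert (0 < p) by apply exp_pos. assert (0 < m) by apply exp_pos.
  set (G := Cmod (gamma_half kap) ^ 2) in *. set (H2 := Cmod (gamma_one kap) ^ 2) in *.
  assert (HG : 0 < G). { assert (0 <= G) by apply pow2_ge_0. assert (0 < 2 * g ^ 2 * m) by (apply Rmult_lt_0_compat; nra). destruct (Req_dec G 0) as [Z|]; [rewrite Z in Ha; lra | lra]. }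
  assert (HH : 0 < H2). { assert (0 <= H2) by apply pow2_ge_0. assert (0 < g ^ 2 * m) by (apply Rmult_lt_0_compat; nra). destruct (Req_dec H2 0) as [Z|]; [rewrite Z in Hb; lra | lra]. }
  assert (Ea : a = 2 * g ^ 2 * m / G) by (rewrite <- Ha; field; lra).
  assert (Eb : b = g ^ 2 * m / H2) by (rewrite <- Hb; field; lra).
  assert (Ea' : a' = 2 * g ^ 2 * p / G) by (rewrite <- Ha'; field; lra).
  assert (Eb' : b' = g ^ 2 * p / H2) by (rewrite <- Hb'; field; lra).
  set (u := 2 * g ^ 2 / G). set (v := 2 * kap * g ^ 2 / H2).
  assert (F1 : m * (u + v) = 1). { rewrite <- S, Ea, Eb. unfold u, v. field. lra. }
  assert (F2 : p * (u - v) = 1). { rewrite <- S', Ea', Eb'. unfold u, v. field. lra. }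
  assert (u + v = p). { transitivity (p * (m * (u + v))); [rewrite <- Rmult_assoc, pm; ring | rewrite F1; ring]. }
  assert (u - v = m). { transitivity (m * (p * (u - v))); [rewrite <- Rmult_assoc, (Rmult_comm m p), pm; ring | rewrite F2; ring]. }
  split.
  - replace (4 * g ^ 2) with (2 * u * G) by (unfold u; field; lra). f_equal. lra.
  - replace (4 * kap * g ^ 2) with (2 * v * H2) by (unfold v; field; lra). f_equal. lra.
Qed.

(** The odd relation 4 kap g^2 = 2 sinh (pi kap) |Gamma(1 - i kap)|^2, divided by kap, tends to 4
    g^2 = 2 pi as kap -> 0. *)
Lemma gauss_sqr : g ^ 2 = PI / 2.
Proof.
  destruct CGamma_near_1 as (K & HK & H).
  assert (PP := PI_RGT_0).
  (* With [exp_taylor2], M k^2 bounds the remainder of exp at pi k and at - pi k for 0 < k <= 1. *)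
  set (M := PI ^ 2 * (2 * exp PI)). assert (HM : 0 < M) by (unfold M; apply Rmult_lt_0_compat; [nra | generalize (exp_pos PI); lra]).
  assert (B : forall k, 0 < k <= 1 -> Rabs (4 * g ^ 2 - 2 * PI) <= (2 * M * (1 + K) ^ 2 + 2 * PI * (K * (2 + K))) * k).
  { intros k Hk. destruct (gamma_parity k) as [_ E].
    assert (T : forall x, Rabs x <= PI * k -> Rabs (exp x - 1 - x) <= M * k ^ 2).
    { intros x Hx. eapply Rle_trans; [apply exp_taylor2|].
      assert (Hx' := Hx). apply Rabs_le_between in Hx'.
      assert (x ^ 2 <= PI ^ 2 * k ^ 2). { rewrite <- (pow2_abs x), <- Rpow_mult_distr. apply pow_incr. split; [apply Rabs_pos | auto]. }
      assert (exp x <= exp PI) by (apply exp_le_compat; nra). assert (exp (- x) <= exp PI) by (apply exp_le_compat; nra).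
      apply Rle_trans with (PI ^ 2 * k ^ 2 * (2 * exp PI)); [|unfold M; right; ring].
      apply Rmult_le_compat; try lra. nra. generalize (exp_pos x) (exp_pos (- x)); lra. }
    assert (T1 := T (PI * k) ltac:(rewrite Rabs_pos_eq; nra)).
    assert (T2 := T (- (PI * k)) ltac:(rewrite Rabs_Ropp, Rabs_pos_eq; nra)).
    set (q := Cmod (gamma_one k)) in *. set (s := exp (PI * k) - exp (- (PI * k))) in *.
    assert (Hs : Rabs (s - 2 * PI * k) <= 2 * M * k ^ 2).
    { unfold s. apply Rabs_le_between in T1. apply Rabs_le_between in T2. apply Rabs_le. lra. }
    assert (Hq : Rabs (q - 1) <= K * k).
    { unfold q. rewrite <- Cmod_1. eapply Rle_trans; [apply Cmod_diff_le|]. eapply Rle_trans; [apply H|]. rewrite Rabs_pos_eq; lra. }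
    assert (q0 : 0 <= q) by apply Cmod_ge_0.
    assert (Hq2 : Rabs (q ^ 2 - 1) <= K * (2 + K) * k).
    { replace (q ^ 2 - 1) with ((q - 1) * (q + 1)) by ring. rewrite Rabs_mult, (Rabs_pos_eq (q + 1)) by lra.
      apply Rabs_le_between in Hq as Hq'. apply Rle_trans with (K * k * (2 + K)); [|right; ring].
      apply Rmult_le_compat; auto. apply Rabs_pos. lra. nra. }
    assert (q ^ 2 <= (1 + K) ^ 2). { apply pow_incr. split; auto. apply Rabs_le_between in Hq. nra. }
    apply Rmult_le_reg_r with k; [lra|]. rewrite <- (Rabs_pos_eq k) at 1 by lra. rewrite <- Rabs_mult.
    replace ((4 * g ^ 2 - 2 * PI) * k) with ((s - 2 * PI * k) * q ^ 2 + 2 * PI * k * (q ^ 2 - 1)).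
    2:{ transitivity (4 * k * g ^ 2 - 2 * PI * k); [rewrite E; ring | ring]. }
    eapply Rle_trans; [apply Rabs_triang|]. rewrite !Rabs_mult, (Rabs_pos_eq (q ^ 2)), (Rabs_pos_eq 2), (Rabs_pos_eq PI), (Rabs_pos_eq k) by nra.
    assert (Rabs (s - 2 * PI * k) * q ^ 2 <= 2 * M * k ^ 2 * (1 + K) ^ 2).
    { apply Rmult_le_compat; auto. apply Rabs_pos. apply pow2_ge_0. }
    assert (2 * PI * k * Rabs (q ^ 2 - 1) <= 2 * PI * k * (K * (2 + K) * k)) by (apply Rmult_le_compat_l; nra).
    lra. }
  enough (4 * g ^ 2 - 2 * PI = 0) by lra.
  apply (zero_of_inv_bound _ (2 * M * (1 + K) ^ 2 + 2 * PI * (K * (2 + K)))).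
  intros x Hx. apply B. split. apply Rinv_0_lt_compat; lra. rewrite <- Rinv_1. apply Rinv_le_contravar; lra.
Qed.

Lemma amplitude_A kap w1 w2 (A B : C) K : lz_sys kap w1 w2 -> 0 <= K ->
  (forall x, 1 <= x -> Cmod (w1 x - phase kap x * A)%C <= K / x /\ Cmod (w2 x - Cconj (phase kap x) * B)%C <= K / x) ->
  Cmod A ^ 2 = (1 + exp (- (2 * PI * kap))) / 2.
Proof.
  intros Hs HK H. destruct (gamma_sum kap) as (a & b & _ & _ & Ha & _ & _ & U).
  destruct (U _ _ _ _ _ Hs HK H) as [<- _]. destruct (gamma_parity kap) as [E _].
  assert (PG : 0 < g ^ 2) by nra.
  apply Rmult_eq_reg_r with (4 * g ^ 2); [|lra].
  rewrite E at 1.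
  transitivity (2 * g ^ 2 * exp (- (PI * kap)) * (exp (PI * kap) + exp (- (PI * kap)))); [rewrite <- Ha; ring|].
  assert (E1 : exp (- (PI * kap)) * exp (PI * kap) = 1) by (rewrite <- exp_plus, Rplus_opp_l; apply exp_0).
  assert (E2 : exp (- (PI * kap)) * exp (- (PI * kap)) = exp (- (2 * PI * kap))) by (rewrite <- exp_plus; f_equal; ring).
  rewrite <- E2. transitivity (2 * g ^ 2 * (exp (- (PI * kap)) * exp (PI * kap) + exp (- (PI * kap)) * exp (- (PI * kap)))); [ring|].
  rewrite E1. field.
Qed.

End Moduli.

(** * The moving frame *)

Lemma Rinv_unit (x : R) : 1 <= x -> 0 < / x <= 1.
Proof. intros Hx. split. apply Rinv_0_lt_compat; lra. rewrite <- Rinv_1. apply Rinv_le_contravar; lra. Qed.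

(** Since k n = (k/x) d', one integration by parts replaces g by g - k d/x; a second one, through d
    = - (n' + k g)/x, adds k n/x^3. The derivative of [e] is then O(x^(-3)), so [e] is within
    O(x^(-2)) of its limit, which survives the multiplication by x. *)
Lemma frame_limit (k M : R) (g n d : R -> R) : 0 <= M ->
  (forall x, is_derive g x (k * n x)) -> (forall x, is_derive d x (x * n x)) ->
  (forall x, is_derive n x (- k * g x - x * d x)) ->
  (forall x, Rabs (g x) <= M) -> (forall x, Rabs (n x) <= M) ->
  exists u K, 0 <= K /\ forall x, 1 <= x -> Rabs (x * g x - k * d x - x * u) <= K / x.
Proof.
  intros HM Hg Hd Hn Bg Bn.
  assert (Hk := Rabs_pos k).
  set (e := fun x => g x - k * d x * / x + k * n x * (/ x) ^ 3).
  set (C := k ^ 2 * M + 3 * Rabs k * M).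
  assert (HC : 0 <= C) by (unfold C; nra).
  destruct (limit_of_derive_bound e (fun x => - (k ^ 2) * g x * (/ x) ^ 3 - 3 * k * n x * (/ x) ^ 4) C 1 1) as [u Hu]; try lra.
  - intros x Hx. unfold e.
    assert (Hi : is_derive Rinv x (- / x ^ 2)). { auto_derive; [lra|]. field; lra. }
    assert (Hi3 : is_derive (fun x => (/ x) ^ 3) x (- 3 * (/ x) ^ 4)). { auto_derive; [lra|]. field; lra. }
    eapply is_derive_eq.
    + apply @is_derive_plus; [apply @is_derive_minus; [apply Hg|]|].
      * apply (is_derive_mult (fun x => k * d x) Rinv); [apply is_derive_scal, Hd | exact Hi | apply Rmult_comm].
      * apply (is_derive_mult (fun x => k * n x) (fun x => (/ x) ^ 3)); [apply is_derive_scal, Hn | exact Hi3 | apply Rmult_comm].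
    + unfold minus; unfold plus, mult, opp; simpl. field. lra.
  - intros x Hx. assert (Hi := Rinv_unit x Hx).
    eapply Rle_trans; [apply Rabs_triang|]. rewrite Rabs_Ropp, !Rabs_mult, !(Rabs_pos_eq (_ ^ _)) by (apply pow_le; lra).
    rewrite Rabs_Ropp, (Rabs_pos_eq (k ^ 2)), (Rabs_pos_eq 3) by nra.
    replace (C / x ^ 3) with (C * (/ x) ^ 3) by (field; lra).
    specialize (Bg x). specialize (Bn x).
    assert (H4 : (/ x) ^ 4 <= (/ x) ^ 3). { replace ((/ x) ^ 4) with ((/ x) ^ 3 * / x) by ring. assert (0 < (/ x) ^ 3) by (apply pow_lt; lra). nra. }
    assert (0 < (/ x) ^ 3) by (apply pow_lt; lra). assert (0 < (/ x) ^ 4) by (apply pow_lt; lra).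
    generalize (Rabs_pos (g x)) (Rabs_pos (n x)); intros.
    assert (k ^ 2 * Rabs (g x) * (/ x) ^ 3 <= k ^ 2 * M * (/ x) ^ 3).
    { apply Rmult_le_compat_r; [lra|]. apply Rmult_le_compat_l; nra. }
    assert (3 * Rabs k * Rabs (n x) * (/ x) ^ 4 <= 3 * Rabs k * M * (/ x) ^ 3).
    { apply Rmult_le_compat; try lra. apply Rmult_le_pos; lra. apply Rmult_le_compat_l; lra. }
    unfold C. lra.
  - exists u, (C + Rabs k * M). split; [nra|]. intros x Hx. specialize (Hu x Hx).
    replace (x * g x - k * d x - x * u) with (x * (e x - u) - k * n x * / x ^ 2) by (unfold e; field; lra).
    assert (Hi := Rinv_unit x Hx).
    assert (Hi2 : / x ^ 2 <= / x). { replace (/ x ^ 2) with (/ x * / x) by (field; lra). nra. }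
    assert (0 < / x ^ 2) by (apply Rinv_0_lt_compat; nra).
    eapply Rle_trans; [apply Rabs_triang|]. rewrite Rabs_Ropp, !Rabs_mult, (Rabs_pos_eq x), (Rabs_pos_eq (/ x ^ 2)) by lra.
    assert (x * Rabs (e x - u) <= C / x).
    { apply Rle_trans with (x * (C / x ^ 2)); [apply Rmult_le_compat_l; [lra | exact Hu] | right; field; lra]. }
    assert (Rabs k * Rabs (n x) * / x ^ 2 <= Rabs k * M * / x).
    { apply Rmult_le_compat; try lra. apply Rmult_le_pos; [lra | apply Rabs_pos]. apply Rmult_le_compat_l; auto. }
    unfold Rdiv in *. lra.
Qed.

(** Here - d = n'/x + k g/x. The first term integrates to n/x + O(1/x), and g = u + O(1/x) turns the
    second into k u ln x plus a convergent integral. *)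
Lemma frame_primitive (k M u K : R) (g n d j : R -> R) : 0 <= M -> 0 <= K ->
  (forall x, is_derive n x (- k * g x - x * d x)) -> (forall x, is_derive j x (- d x)) ->
  (forall x, Rabs (n x) <= M) -> (forall x, Rabs (d x) <= M) ->
  (forall x, 1 <= x -> Rabs (x * g x - k * d x - x * u) <= K / x) ->
  exists c K', 0 <= K' /\ forall x, 1 <= x -> Rabs (j x - (c + k * u * ln x)) <= K' / x.
Proof.
  intros HM HK Hn Hj Bn Bd Hu. assert (Hk := Rabs_pos k).
  set (p := fun x => j x - n x * / x - k * u * ln x).
  set (C := Rabs k * (K + Rabs k * M) + M). assert (HC : 0 <= C) by (unfold C; nra).
  destruct (limit_of_derive_bound p (fun x => k * (g x - u) * / x + n x * / x ^ 2) C 1 0) as [c Hc]; try lra.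
  - intros x Hx. unfold p.
    assert (Hi : is_derive Rinv x (- / x ^ 2)). { auto_derive; [lra|]. field; lra. }
    eapply is_derive_eq.
    + apply @is_derive_minus; [apply @is_derive_minus; [apply Hj|]|].
      * apply (is_derive_mult n Rinv); [apply Hn | exact Hi | apply Rmult_comm].
      * apply is_derive_scal. apply is_derive_ln. lra.
    + unfold minus; unfold plus, mult, opp; simpl. field. lra.
  - intros x Hx. assert (Hi := Rinv_unit x Hx).
    assert (0 < / x ^ 2) by (apply Rinv_0_lt_compat; nra).
    eapply Rle_trans; [apply Rabs_triang|]. rewrite !Rabs_mult, (Rabs_pos_eq (/ x)), (Rabs_pos_eq (/ x ^ 2)) by lra.
    assert (G : Rabs (g x - u) <= (K + Rabs k * M) * / x).
    { replace (g x - u) with ((x * g x - k * d x - x * u) * / x + k * d x * / x) by (field; lra).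
      eapply Rle_trans; [apply Rabs_triang|]. rewrite !Rabs_mult, (Rabs_pos_eq (/ x)) by lra.
      specialize (Hu x Hx). specialize (Bd x).
      assert (K / x <= K). { unfold Rdiv. nra. }
      rewrite Rmult_plus_distr_r. apply Rplus_le_compat.
      - apply Rmult_le_compat_r; lra.
      - apply Rmult_le_compat_r; [lra|]. apply Rmult_le_compat_l; auto. }
    specialize (Bn x).
    assert (Rabs k * Rabs (g x - u) * / x <= Rabs k * (K + Rabs k * M) * / x ^ 2).
    { apply Rle_trans with (Rabs k * ((K + Rabs k * M) * / x) * / x); [|right; field; lra].
      apply Rmult_le_compat_r; [lra|]. apply Rmult_le_compat_l; auto. }
    assert (Rabs (n x) * / x ^ 2 <= M * / x ^ 2) by (apply Rmult_le_compat_r; lra).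
    unfold C, Rdiv. lra.
  - exists c, (C + M). split; [lra|]. intros x Hx. specialize (Hc x Hx). rewrite pow_1 in Hc.
    assert (Hi : 0 < / x). { apply Rinv_0_lt_compat; lra. }
    replace (j x - (c + k * u * ln x)) with ((p x - c) + n x * / x) by (unfold p; ring).
    eapply Rle_trans; [apply Rabs_triang|]. rewrite Rabs_mult, (Rabs_pos_eq (/ x)) by lra.
    specialize (Bn x). assert (Rabs (n x) * / x <= M * / x) by (apply Rmult_le_compat_r; lra). unfold Rdiv in *. lra.
Qed.

Section Curve.
Variable k : R.
Hypothesis k_neq : k <> 0.
Let kap : R := k ^ 2 / 8.
Let w1 := kw1 kap.
Let w2 := kw2 kap.

Lemma kap_pos : 0 < kap.
Proof. unfold kap. nra. Qed.

Lemma lz_sys_kap : lz_sys kap w1 w2.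
Proof. apply lz_sys_kummer. Qed.

Lemma Ci_kap : (Ci * k ^ 2 / 8)%C = (Ci * kap)%C.
Proof. unfold kap. apply C_ext; simpl; field. Qed.

Lemma psi1_w x : psi1 k x = w1 x.
Proof. unfold psi1, w1, kw1, mu. rewrite Ci_kap. reflexivity. Qed.

Lemma psi2_w x : psi2 k x = (Ci * (k / 2)%R * w2 x)%C.
Proof.
  unfold psi2, w2, kw2, mu. rewrite Ci_kap. generalize (kummer (1 / 2 + Ci * kap) (3 / 2) (zeta x)) (Cexp (- zeta x / 2)); intros u v.
  replace (RtoC (k / 2)) with (k / 2)%C by (apply C_ext; simpl; field). field.
Qed.

Definition gammaP x := (- (Ci * k) * (w1 x * w2 x))%C.
Definition normalP x := (- Ci * (w1 x * w1 x - (2 * kap)%R * (w2 x * w2 x)))%C.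
Definition dvecP x := (- (w1 x * w1 x + (2 * kap)%R * (w2 x * w2 x)))%C.
Definition gamma3 x := Cmod (w1 x) ^ 2 - 2 * kap * Cmod (w2 x) ^ 2.
Definition normal3 x := - k * Re (Cconj (w1 x) * w2 x)%C.
Definition dvec3 x := k * Im (Cconj (w1 x) * w2 x)%C.

Lemma perp_gamma x : perp (gamma k x) = gammaP x.
Proof.
  unfold gamma, perp, vec; cbn [fst]. rewrite psi1_w, psi2_w. unfold gammaP.
  replace (RtoC (k / 2)) with (k / 2)%C by (apply C_ext; simpl; field). field.
Qed.

Lemma third_gamma x : third (gamma k x) = gamma3 x.
Proof.
  unfold gamma, third, vec; cbn [snd]. rewrite psi1_w, psi2_w. unfold gamma3.
  rewrite !Cmod_mult, Cmod_Ci, Cmod_R, Rmult_1_l, Rpow_mult_distr, pow2_abs. unfold kap. field.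
Qed.

Lemma perp_dvec x : perp (dvec k x) = dvecP x.
Proof.
  unfold dvec, perp, vec; cbn [fst]. rewrite psi1_w, psi2_w. unfold dvecP.
  replace (RtoC (2 * kap)) with (k / 2 * (k / 2))%C by (unfold kap; apply C_ext; simpl; field).
  replace (RtoC (k / 2)) with (k / 2)%C by (apply C_ext; simpl; field).
  transitivity (- (w1 x * w1 x - Ci * Ci * (k / 2 * (k / 2)) * (w2 x * w2 x)))%C; [ring | rewrite Ci2; ring].
Qed.

Lemma third_dvec x : third (dvec k x) = dvec3 x.
Proof.
  unfold dvec, third, vec; cbn [snd]. rewrite psi1_w, psi2_w. unfold dvec3.
  destruct (w1 x) as [a b], (w2 x) as [c d]. unfold Re, Im; simpl. field.
Qed.

Lemma cderiv_gammaP x : cderiv gammaP x (k * normalP x)%C.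
Proof.
  unfold gammaP. eapply cderiv_eq.
  - apply cderiv_scal, cderiv_mult; [exact (lz_d1 kap w1 w2 lz_sys_kap x) | exact (lz_d2 kap w1 w2 lz_sys_kap x)].
  - unfold normalP. ring.
Qed.

Lemma cderiv_normalP x : cderiv normalP x (- k * gammaP x - x * dvecP x)%C.
Proof.
  unfold normalP. eapply cderiv_eq.
  - apply cderiv_scal, cderiv_minus; [| apply cderiv_scal]; apply cderiv_mult;
    first [exact (lz_d1 kap w1 w2 lz_sys_kap x) | exact (lz_d2 kap w1 w2 lz_sys_kap x)].
  - unfold gammaP, dvecP. cbv beta.
    replace (RtoC x) with (2 * (x / 2)%R)%C by (rewrite <- RtoC_mult; f_equal; field).
    set (y := RtoC (x / 2)). set (p := w1 x). set (q := w2 x).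
    transitivity (- (Ci * Ci) * (2 * y * (p * p + (2 * kap)%R * (q * q))) + 4 * Ci * (2 * kap)%R * p * q)%C; [ring|].
    replace (4 * Ci * (2 * kap)%R * p * q)%C with (- k * (- (Ci * k) * (p * q)))%C. rewrite Ci2; ring.
    unfold kap. replace (RtoC (2 * (k ^ 2 / 8))) with (k * k / 4)%C by (apply C_ext; simpl; field). field.
Qed.

Lemma cderiv_dvecP x : cderiv dvecP x (x * normalP x)%C.
Proof.
  unfold dvecP. eapply cderiv_eq.
  - apply cderiv_opp, cderiv_plus; [| apply cderiv_scal]; apply cderiv_mult;
    first [exact (lz_d1 kap w1 w2 lz_sys_kap x) | exact (lz_d2 kap w1 w2 lz_sys_kap x)].
  - unfold normalP. cbv beta.
    replace (RtoC x) with (2 * (x / 2)%R)%C by (rewrite <- RtoC_mult; f_equal; field). ring.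
Qed.

(** Real and imaginary part of this product are, up to the factors - k and k, the third components
    of normal and binormal; one complex equation yields both derivatives. *)
Let m x := (Cconj (w1 x) * w2 x)%C.

Lemma cderiv_m x : cderiv m x (- (Ci * x) * m x + gamma3 x)%C.
Proof.
  unfold m. eapply cderiv_eq.
  - apply cderiv_mult; [apply cderiv_conj; exact (lz_d1 kap w1 w2 lz_sys_kap x) | exact (lz_d2 kap w1 w2 lz_sys_kap x)].
  - unfold gamma3. rewrite RtoC_minus, !RtoC_mult, !Cmod2_conj.
    replace (RtoC x) with (2 * (x / 2)%R)%C by (rewrite <- RtoC_mult; f_equal; field).
    rewrite Cminus_conj, !Cmult_conj, Cconj_Ci, !Cconj_RtoC. ring.
Qed.

Lemma is_derive_gamma3 x : is_derive gamma3 x (k * normal3 x).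
Proof.
  unfold gamma3. eapply is_derive_eq.
  - apply @is_derive_minus; [|apply is_derive_scal]; apply is_derive_Cmod2;
    [exact (lz_d1 kap w1 w2 lz_sys_kap x) | exact (lz_d2 kap w1 w2 lz_sys_kap x)].
  - unfold normal3. generalize (w1 x) (w2 x); intros [a b] [c d]. unfold minus; unfold plus, opp, kap, Re, Im; simpl. field.
Qed.

Lemma is_derive_normal3 x : is_derive normal3 x (- k * gamma3 x - x * dvec3 x).
Proof.
  unfold normal3. eapply is_derive_eq; [apply is_derive_scal; exact (proj1 (cderiv_m x))|].
  fold (m x). unfold dvec3. fold (m x). generalize (m x) (gamma3 x); intros [a b] c. unfold Re, Im; simpl. ring.
Qed.

Lemma is_derive_dvec3 x : is_derive dvec3 x (x * normal3 x).
Proof.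
  unfold dvec3. eapply is_derive_eq; [apply is_derive_scal; exact (proj2 (cderiv_m x))|].
  unfold normal3. fold (m x). generalize (m x) (gamma3 x); intros [a b] c. unfold Re, Im; simpl. ring.
Qed.

(** For k nonzero, kap > 0 and the conserved form is definite, which bounds w1 and w2 on the whole
    line. *)
Lemma curve_bounds : exists M, 0 <= M /\ forall x,
  Cmod (gammaP x) <= M /\ Cmod (normalP x) <= M /\ Cmod (dvecP x) <= M /\ Rabs (gamma3 x) <= M /\ Rabs (normal3 x) <= M /\ Rabs (dvec3 x) <= M.
Proof.
  assert (Hk := kap_pos). assert (Hk2 := Rabs_pos k).
  set (b := 1 + / kap). assert (Hb : 1 <= b) by (unfold b; generalize (Rinv_0_lt_compat _ Hk); lra).
  assert (B1 : forall x, Cmod (w1 x) <= 1 /\ Cmod (w2 x) <= b).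
  { intros x. assert (E := lz_conserved kap w1 w2 lz_sys_kap x). fold w1 w2 in E.
    generalize (Cmod_ge_0 (w1 x)) (Cmod_ge_0 (w2 x)); intros P1 P2.
    assert (Q2 := pow2_ge_0 (Cmod (w2 x))). assert (Q1 := pow2_ge_0 (Cmod (w1 x))). split; [nra|].
    assert (Cmod (w2 x) ^ 2 <= / kap). { apply Rmult_le_reg_l with kap; auto. rewrite Rinv_r by lra. nra. }
    unfold b in *. generalize (Rinv_0_lt_compat _ Hk); nra. }
  exists ((1 + Rabs k) * b + (1 + 2 * kap * b ^ 2)). split; [nra|]. intros x. destruct (B1 x) as [H1 H2].
  assert (E := lz_conserved kap w1 w2 lz_sys_kap x). fold w1 w2 in E.
  generalize (Cmod_ge_0 (w1 x)) (Cmod_ge_0 (w2 x)); intros P1 P2.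
  assert (G0 : 0 <= (1 + Rabs k) * b) by nra.
  assert (S12 : Cmod (w1 x) * Cmod (w1 x) + 2 * kap * (Cmod (w2 x) * Cmod (w2 x)) = 1) by (rewrite <- E; ring).
  assert (Hm : Cmod (m x) <= b). { unfold m. rewrite Cmod_mult, Cmod_conj. nra. }
  assert (Hkb : 0 <= 2 * kap * b ^ 2) by nra.
  repeat split.
  - unfold gammaP. rewrite Cmod_mult, Cmod_opp, !Cmod_mult, Cmod_Ci, Cmod_R.
    assert (Cmod (w1 x) * Cmod (w2 x) <= b) by nra.
    assert (Rabs k * (Cmod (w1 x) * Cmod (w2 x)) <= Rabs k * b) by (apply Rmult_le_compat_l; auto). lra.
  - unfold normalP. rewrite Cmod_mult, Cmod_opp, Cmod_Ci, Rmult_1_l. eapply Rle_trans; [apply Cmod_minus|].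
    rewrite !Cmod_mult, Cmod_RtoC by lra. lra.
  - unfold dvecP. rewrite Cmod_opp. eapply Rle_trans; [apply Cmod_triangle|].
    rewrite !Cmod_mult, Cmod_RtoC by lra. lra.
  - unfold gamma3. apply Rabs_le. nra.
  - unfold normal3. fold (m x). rewrite Rabs_mult, Rabs_Ropp. generalize (Cmod_Re (m x)); intros.
    assert (Rabs k * Rabs (Re (m x)) <= Rabs k * b) by (apply Rmult_le_compat_l; lra). lra.
  - unfold dvec3. fold (m x). rewrite Rabs_mult. generalize (Cmod_Im (m x)); intros.
    assert (Rabs k * Rabs (Im (m x)) <= Rabs k * b) by (apply Rmult_le_compat_l; lra). lra.
Qed.

End Curve.

Lemma is_derive_RInt_0 (f : R -> R) x : (forall t, continuous f t) -> is_derive (fun y => RInt f 0 y) x (f x).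
Proof.
  intros Hc. apply @is_derive_RInt with (a := 0); [|apply Hc].
  apply filter_forall. intros y. apply @RInt_correct, @ex_RInt_continuous. intros; apply Hc.
Qed.

Lemma RInt_C (f : R -> C) a b : (forall t, ccont f t) ->
  RInt (V := C_R_CompleteNormedModule) f a b = (RInt (fun t => Re (f t)) a b, RInt (fun t => Im (f t)) a b).
Proof.
  intros Hc. apply is_RInt_unique. apply (is_RInt_fct_extend_pair f a b).
  - apply @RInt_correct, @ex_RInt_continuous. intros t _; exact (proj1 (Hc t)).
  - apply @RInt_correct, @ex_RInt_continuous. intros t _; exact (proj2 (Hc t)).
Qed.

(** Two error scales: products of bounded oscillating factors keep the error O(1/x) of [app1], while
    a factor growing like ln x costs at most x^(1/2) and leads to the error x^(-1/2) of [app2]. *)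
Definition app1 (f F : R -> C) : Prop := exists K, 0 <= K /\ forall x, 1 <= x -> Cmod (f x - F x)%C <= K / x.
Definition app2 (f F : R -> C) : Prop := exists K, 0 <= K /\ forall x, 1 <= x -> Cmod (f x - F x)%C <= K * Rpower x (- (1 / 2)).

Lemma app1_plus f F g G : app1 f F -> app1 g G -> app1 (fun x => f x + g x)%C (fun x => F x + G x)%C.
Proof.
  intros (K & HK & H) (L & HL & H'). exists (K + L). split; [lra|]. intros x Hx.
  replace (f x + g x - (F x + G x))%C with ((f x - F x) + (g x - G x))%C by ring.
  eapply Rle_trans; [apply Cmod_triangle|]. specialize (H x Hx). specialize (H' x Hx). unfold Rdiv in *. lra.
Qed.

Lemma app1_scal (c : C) f F : app1 f F -> app1 (fun x => c * f x)%C (fun x => c * F x)%C.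
Proof.
  intros (K & HK & H). exists (Cmod c * K). split; [apply Rmult_le_pos; [apply Cmod_ge_0 | auto]|]. intros x Hx.
  replace (c * f x - c * F x)%C with (c * (f x - F x))%C by ring. rewrite Cmod_mult. unfold Rdiv. rewrite Rmult_assoc.
  apply Rmult_le_compat_l; [apply Cmod_ge_0 | apply H, Hx].
Qed.

Lemma app1_ext f F g G : (forall x, f x = g x) -> (forall x, F x = G x) -> app1 f F -> app1 g G.
Proof. intros E1 E2 (K & HK & H). exists K. split; auto. intros. rewrite <- E1, <- E2. auto. Qed.

Lemma app1_conj f F : app1 f F -> app1 (fun x => Cconj (f x)) (fun x => Cconj (F x)).
Proof. intros (K & HK & H). exists K. split; auto. intros. rewrite <- Cminus_conj, Cmod_conj. auto. Qed.

Lemma app1_unique f (a b : C) : app1 f (fun _ => a) -> app1 f (fun _ => b) -> a = b.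
Proof.
  intros (K & HK & H) (L & HL & H').
  assert (E : Cmod (a - b)%C = 0).
  { apply (zero_of_inv_bound _ (K + L)). intros x Hx. rewrite Rabs_pos_eq by apply Cmod_ge_0.
    replace (a - b)%C with ((f x - b) - (f x - a))%C by ring. eapply Rle_trans; [apply Cmod_minus|].
    specialize (H x Hx). specialize (H' x Hx). unfold Rdiv in *. lra. }
  apply Cmod_eq_0 in E. replace a with (a - b + b)%C by ring. rewrite E. ring.
Qed.

Lemma app2_plus f F g G : app2 f F -> app2 g G -> app2 (fun x => f x + g x)%C (fun x => F x + G x)%C.
Proof.
  intros (K & HK & H) (L & HL & H'). exists (K + L). split; [lra|]. intros x Hx.
  replace (f x + g x - (F x + G x))%C with ((f x - F x) + (g x - G x))%C by ring.
  eapply Rle_trans; [apply Cmod_triangle|]. specialize (H x Hx). specialize (H' x Hx). lra.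
Qed.

Lemma app2_scal (c : C) f F : app2 f F -> app2 (fun x => c * f x)%C (fun x => c * F x)%C.
Proof.
  intros (K & HK & H). exists (Cmod c * K). split; [apply Rmult_le_pos; [apply Cmod_ge_0 | auto]|]. intros x Hx.
  replace (c * f x - c * F x)%C with (c * (f x - F x))%C by ring. rewrite Cmod_mult. rewrite Rmult_assoc.
  apply Rmult_le_compat_l; [apply Cmod_ge_0 | apply H, Hx].
Qed.

Lemma app2_ext f F g G : (forall x, f x = g x) -> (forall x, 1 <= x -> F x = G x) -> app2 f F -> app2 g G.
Proof. intros E1 E2 (K & HK & H). exists K. split; auto. intros. rewrite <- E1, <- E2; auto. Qed.

Lemma app1_mult_phase f (p : R -> C) (A B : C) g (q : R -> C) : (forall x, Cmod (p x) = 1) -> (forall x, Cmod (q x) = 1) ->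
  app1 f (fun x => p x * A)%C -> app1 g (fun x => q x * B)%C -> app1 (fun x => f x * g x)%C (fun x => p x * q x * (A * B))%C.
Proof.
  intros Hp Hq (K & HK & H) (L & HL & H'). exists (K * (Cmod B + L) + Cmod A * L).
  generalize (Cmod_ge_0 A) (Cmod_ge_0 B); intros.
  split. { apply Rplus_le_le_0_compat; apply Rmult_le_pos; lra. }
  intros x Hx. specialize (H x Hx). specialize (H' x Hx).
  replace (f x * g x - p x * q x * (A * B))%C with ((f x - p x * A) * g x + p x * A * (g x - q x * B))%C by ring.
  eapply Rle_trans; [apply Cmod_triangle|]. rewrite !Cmod_mult, Hp, Rmult_1_l.
  assert (Hi := Rinv_unit x Hx).
  assert (Cmod (g x) <= Cmod B + L).
  { replace (g x) with ((g x - q x * B) + q x * B)%C at 1 by ring. eapply Rle_trans; [apply Cmod_triangle|].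
    rewrite Cmod_mult, Hq. unfold Rdiv in H'. nra. }
  replace ((K * (Cmod B + L) + Cmod A * L) / x) with (K / x * (Cmod B + L) + Cmod A * (L / x)) by (field; lra).
  apply Rplus_le_compat.
  - apply Rmult_le_compat; auto; apply Cmod_ge_0.
  - apply Rmult_le_compat_l; auto.
Qed.

Lemma app2_mult_phase f g (p : R -> C) (A a b : C) : (forall x, Cmod (p x) = 1) ->
  app1 f (fun x => p x * A)%C -> app1 g (fun x => a + b * ln x)%C ->
  app2 (fun x => f x * g x)%C (fun x => p x * (A * a + A * b * ln x))%C.
Proof.
  intros Hp (K & HK & H) (L & HL & H'). exists (K * (Cmod a + 2 * Cmod b + L) + Cmod A * L).
  generalize (Cmod_ge_0 A) (Cmod_ge_0 a) (Cmod_ge_0 b); intros.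
  split. { apply Rplus_le_le_0_compat; apply Rmult_le_pos; lra. }
  intros x Hx. specialize (H x Hx). specialize (H' x Hx).
  replace (f x * g x - p x * (A * a + A * b * ln x))%C
    with ((f x - p x * A) * g x + p x * A * (g x - (a + b * ln x)))%C by ring.
  eapply Rle_trans; [apply Cmod_triangle|]. rewrite !Cmod_mult, Hp, Rmult_1_l.
  assert (Hi := Rinv_unit x Hx).
  assert (Hi2 := inv_le_rpower x Hx). assert (Hl := ln_le_sqrt x Hx).
  assert (Hr := Rpower_ge_1 x (1 / 2) Hx ltac:(lra)).
  assert (Er : / x * Rpower x (1 / 2) = Rpower x (- (1 / 2))).
  { rewrite <- (Rpower_1 x) at 1 by lra. rewrite <- Rpower_Ropp, <- Rpower_plus. f_equal. field. }
  assert (G : Cmod (g x) <= (Cmod a + 2 * Cmod b + L) * Rpower x (1 / 2)).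
  { replace (g x) with ((g x - (a + b * ln x)) + (a + b * ln x))%C at 1 by ring.
    eapply Rle_trans; [apply Cmod_triangle|].
    assert (Cmod (a + b * ln x)%C <= Cmod a + Cmod b * (2 * Rpower x (1 / 2))).
    { eapply Rle_trans; [apply Cmod_triangle|]. rewrite Cmod_mult, Cmod_R, (Rabs_pos_eq (ln x)) by lra.
      apply Rplus_le_compat_l, Rmult_le_compat_l; lra. }
    unfold Rdiv in H'. nra. }
  set (r := Rpower x (- (1 / 2))) in *.
  apply Rle_trans with (K / x * ((Cmod a + 2 * Cmod b + L) * Rpower x (1 / 2)) + Cmod A * (L / x)).
  - apply Rplus_le_compat. apply Rmult_le_compat; auto; apply Cmod_ge_0. apply Rmult_le_compat_l; auto.
  - replace (K / x * ((Cmod a + 2 * Cmod b + L) * Rpower x (1 / 2))) with (K * (Cmod a + 2 * Cmod b + L) * r)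
      by (rewrite <- Er; field; lra).
    assert (Cmod A * (L / x) <= Cmod A * (L * r)).
    { apply Rmult_le_compat_l; auto. apply Rmult_le_compat_l; auto. }
    lra.
Qed.

Section Plus.
Variable k : R.
Hypothesis k_neq : k <> 0.
Let kap : R := k ^ 2 / 8.
Let w1 := kw1 kap.
Let w2 := kw2 kap.

Definition Jp x := perp (J k x).
Definition J3 x := third (J k x).

Lemma ccont_dvecP x : ccont (dvecP k) x.
Proof. eapply cderiv_ccont, cderiv_dvecP. Qed.

Lemma continuous_dvec3 x : continuous (dvec3 k) x.
Proof. apply @ex_derive_continuous. eexists. apply is_derive_dvec3. Qed.

Lemma Jp_eq x : Jp x = (RInt (fun t => - Re (dvecP k t)) 0 x, RInt (fun t => - Im (dvecP k t)) 0 x).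
Proof.
  unfold Jp, J, RInt3, perp at 1, vec. cbn [fst].
  rewrite (RInt_ext (V := C_R_CompleteNormedModule) _ (fun t => - dvecP k t)%C).
  - rewrite (RInt_C (fun t => - dvecP k t)%C); [reflexivity|]. intros; apply ccont_opp, ccont_dvecP.
  - intros t _. rewrite <- perp_dvec. reflexivity.
Qed.

Lemma J3_eq x : J3 x = RInt (fun t => - dvec3 k t) 0 x.
Proof.
  unfold J3, J, RInt3, third at 1, vec. cbn [snd]. apply RInt_ext.
  intros t _. rewrite <- third_dvec. reflexivity.
Qed.

Lemma cderiv_Jp x : cderiv Jp x (- dvecP k x)%C.
Proof.
  apply cderiv_ext with (fun x => (RInt (fun t => - Re (dvecP k t)) 0 x, RInt (fun t => - Im (dvecP k t)) 0 x)).
  { intros t. symmetry. apply Jp_eq. }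
  split; simpl.
  - apply (is_derive_RInt_0 (fun t => - Re (dvecP k t))). intros t. exact (proj1 (ccont_opp (dvecP k) t (ccont_dvecP t))).
  - apply (is_derive_RInt_0 (fun t => - Im (dvecP k t))). intros t. exact (proj2 (ccont_opp (dvecP k) t (ccont_dvecP t))).
Qed.

Lemma is_derive_J3 x : is_derive J3 x (- dvec3 k x).
Proof.
  apply is_derive_ext with (fun x => RInt (fun t => - dvec3 k t) 0 x).
  { intros t. symmetry. apply J3_eq. }
  apply (is_derive_RInt_0 (fun t => - dvec3 k t)). intros t. exact (continuous_opp (dvec3 k) t (continuous_dvec3 t)).
Qed.

Lemma Jp_0 : Jp 0 = 0%C.
Proof. rewrite Jp_eq. rewrite !RInt_point. reflexivity. Qed.

Lemma J3_0 : J3 0 = 0.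
Proof. rewrite J3_eq. apply @RInt_point. Qed.

Lemma raw_asymptotics : exists (up cc : C) (u3 c3 : R),
  app1 (fun x => x * gammaP k x - k * dvecP k x)%C (fun x => x * up)%C /\
  app1 (fun x => RtoC (x * gamma3 k x - k * dvec3 k x)) (fun x => RtoC (x * u3)) /\
  app1 Jp (fun x => cc + k * up * ln x)%C /\
  app1 (fun x => RtoC (J3 x)) (fun x => RtoC (c3 + k * u3 * ln x)) /\
  app1 (gammaP k) (fun _ => up) /\ app1 (fun x => RtoC (gamma3 k x)) (fun _ => RtoC u3).
Proof.
  destruct (curve_bounds k k_neq) as (M & HM & HB).
  (* The frame equations hold coordinate by coordinate, so one real statement is applied to the two
     horizontal coordinates and to the vertical one. *)
  assert (F : forall g n d j : R -> R, (forall x, is_derive g x (k * n x)) -> (forall x, is_derive d x (x * n x)) ->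
     (forall x, is_derive n x (- k * g x - x * d x)) -> (forall x, is_derive j x (- d x)) ->
     (forall x, Rabs (g x) <= M) -> (forall x, Rabs (n x) <= M) -> (forall x, Rabs (d x) <= M) ->
     exists u c K, 0 <= K /\ forall x, 1 <= x -> Rabs (x * g x - k * d x - x * u) <= K / x /\ Rabs (j x - (c + k * u * ln x)) <= K / x
       /\ Rabs (g x - u) <= K / x).
  { intros g n d j Hg Hd Hn Hj Bg Bn Bd.
    destruct (frame_limit k M g n d HM Hg Hd Hn Bg Bn) as (u & K & HK & Hu).
    destruct (frame_primitive k M u K g n d j HM HK Hn Hj Bn Bd Hu) as (c & K' & HK' & Hc).
    assert (Hk := Rabs_pos k).
    exists u, c, (K + K' + Rabs k * M). split; [nra|]. intros x Hx.
    assert (Hi := Rinv_unit x Hx).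
    specialize (Hu x Hx). specialize (Hc x Hx). assert (0 <= Rabs k * M) by nra.
    split; [|split].
    - eapply Rle_trans; [exact Hu|]. unfold Rdiv. apply Rmult_le_compat_r; lra.
    - eapply Rle_trans; [exact Hc|]. unfold Rdiv. apply Rmult_le_compat_r; lra.
    - replace (g x - u) with ((x * g x - k * d x - x * u) * / x + k * d x * / x) by (field; lra).
      eapply Rle_trans; [apply Rabs_triang|]. rewrite !Rabs_mult, (Rabs_pos_eq (/ x)) by lra.
      assert (Hux : Rabs (x * g x - k * d x - x * u) <= K). { eapply Rle_trans; [exact Hu|]. unfold Rdiv. nra. }
      unfold Rdiv. rewrite <- Rmult_plus_distr_r. apply Rmult_le_compat_r; [lra|].
      specialize (Bd x). assert (Rabs k * Rabs (d x) <= Rabs k * M) by (apply Rmult_le_compat_l; auto). lra. }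
  assert (Fr := F (fun x => Re (gammaP k x)) (fun x => Re (normalP k x)) (fun x => Re (dvecP k x)) (fun x => Re (Jp x))).
  destruct Fr as (u1 & c1 & K1 & HK1 & H1).
  { intros x. eapply is_derive_eq; [exact (proj1 (cderiv_gammaP k x)) | unfold Re; simpl; ring]. }
  { intros x. eapply is_derive_eq; [exact (proj1 (cderiv_dvecP k x)) | unfold Re; simpl; ring]. }
  { intros x. eapply is_derive_eq; [exact (proj1 (cderiv_normalP k x)) | unfold Re; simpl; ring]. }
  { intros x. eapply is_derive_eq; [exact (proj1 (cderiv_Jp x)) | unfold Re; simpl; ring]. }
  1-3: intros x; eapply Rle_trans; [apply Cmod_Re | apply HB].
  assert (Fi := F (fun x => Im (gammaP k x)) (fun x => Im (normalP k x)) (fun x => Im (dvecP k x)) (fun x => Im (Jp x))).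
  destruct Fi as (u2 & c2 & K2 & HK2 & H2).
  { intros x. eapply is_derive_eq; [exact (proj2 (cderiv_gammaP k x)) | unfold Im; simpl; ring]. }
  { intros x. eapply is_derive_eq; [exact (proj2 (cderiv_dvecP k x)) | unfold Im; simpl; ring]. }
  { intros x. eapply is_derive_eq; [exact (proj2 (cderiv_normalP k x)) | unfold Im; simpl; ring]. }
  { intros x. eapply is_derive_eq; [exact (proj2 (cderiv_Jp x)) | unfold Im; simpl; ring]. }
  1-3: intros x; eapply Rle_trans; [apply Cmod_Im | apply HB].
  destruct (F (gamma3 k) (normal3 k) (dvec3 k) J3) as (u3 & c3 & K3 & HK3 & H3).
  { apply is_derive_gamma3. } { apply is_derive_dvec3. } { apply is_derive_normal3. } { apply is_derive_J3. }
  1-3: intros; apply HB.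
  exists (u1, u2), (c1, c2), u3, c3.
  assert (P : forall f G, (forall x, 1 <= x -> Rabs (Re (f x - G x)%C) <= K1 / x /\ Rabs (Im (f x - G x)%C) <= K2 / x) -> app1 f G).
  { intros f G H. exists (K1 + K2). split; [lra|]. intros x Hx. destruct (H x Hx).
    eapply Rle_trans; [apply Cmod_le_abs|]. unfold Rdiv in *; lra. }
  assert (Q : forall f G : R -> R, (forall x, 1 <= x -> Rabs (f x - G x) <= K3 / x) -> app1 (fun x => RtoC (f x)) (fun x => RtoC (G x))).
  { intros f G H. exists K3. split; [lra|]. intros x Hx. rewrite <- RtoC_minus, Cmod_R. auto. }
  split; [|split; [|split; [|split; [|split]]]].
  - apply P. intros x Hx. destruct (H1 x Hx) as [E1 _]. destruct (H2 x Hx) as [E2 _].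
    split; [eapply Rle_trans; [|exact E1] | eapply Rle_trans; [|exact E2]]; right; f_equal; unfold Re, Im; simpl; ring.
  - apply Q. intros x Hx. apply H3, Hx.
  - apply P. intros x Hx. destruct (H1 x Hx) as (_ & E1 & _). destruct (H2 x Hx) as (_ & E2 & _).
    split; [eapply Rle_trans; [|exact E1] | eapply Rle_trans; [|exact E2]]; right; f_equal; unfold Re, Im; simpl; ring.
  - apply Q. intros x Hx. apply H3, Hx.
  - apply P. intros x Hx. destruct (H1 x Hx) as (_ & _ & E1). destruct (H2 x Hx) as (_ & _ & E2).
    split; [eapply Rle_trans; [|exact E1] | eapply Rle_trans; [|exact E2]]; right; f_equal; unfold Re, Im; simpl; ring.
  - apply Q. intros x Hx. apply H3, Hx.
Qed.

End Plus.

(** * Identification of the limits *)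

Section Ident.
Variables (k kap g u3 c3 : R) (w1 w2 Jp : R -> C) (J3 : R -> R) (A B up cc : C).
Hypothesis k_neq : k <> 0.
Hypothesis Hkap : kap = k ^ 2 / 8.
Hypothesis Hs : lz_sys kap w1 w2.
Hypothesis g_pos : 0 < g.
Hypothesis Ig : is_CInt (fun x => RtoC (gw 1 x)) (RtoC g).
Hypothesis HA : app1 w1 (fun x => phase kap x * A)%C.
Hypothesis HB : app1 w2 (fun x => Cconj (phase kap x) * B)%C.
Hypothesis dJp : forall x, cderiv Jp x (w1 x * w1 x + (2 * kap)%R * (w2 x * w2 x))%C.
Hypothesis dJ3 : forall x, is_derive J3 x (- (k * Im (Cconj (w1 x) * w2 x)%C)).
Hypothesis Jp0 : Jp 0 = 0%C.
Hypothesis J30 : J3 0 = 0.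
Hypothesis aJp : app1 Jp (fun x => cc + k * up * ln x)%C.
Hypothesis aJ3 : app1 (fun x => RtoC (J3 x)) (fun x => RtoC (c3 + k * u3 * ln x)).
Hypothesis aup : app1 (fun x => - (Ci * k) * (w1 x * w2 x))%C (fun _ => up).
Hypothesis au3 : app1 (fun x => RtoC (Cmod (w1 x) ^ 2 - 2 * kap * Cmod (w2 x) ^ 2)) (fun _ => RtoC u3).

Let z : C := ((1 / 2)%R + Ci * kap)%C.
Let z' : C := (1 - Ci * kap)%C.

Lemma kap_gt_0 : 0 < kap.
Proof. rewrite Hkap. assert (0 < k ^ 2) by (apply pow2_gt_0; auto). lra. Qed.

Lemma exists_K : exists K, 0 <= K /\ forall x, 1 <= x ->
  Cmod (w1 x - phase kap x * A)%C <= K / x /\ Cmod (w2 x - Cconj (phase kap x) * B)%C <= K / x.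
Proof.
  destruct HA as (K & HK & H). destruct HB as (L & HL & H'). exists (K + L). split; [lra|]. intros x Hx.
  assert (0 < / x) by (apply Rinv_0_lt_compat; lra).
  split; [eapply Rle_trans; [apply H, Hx|] | eapply Rle_trans; [apply H', Hx|]]; unfold Rdiv; apply Rmult_le_compat_r; lra.
Qed.

Lemma app1_w1w2 : app1 (fun x => w1 x * w2 x)%C (fun _ => A * B)%C.
Proof.
  assert (H := app1_mult_phase w1 (phase kap) A B w2 (fun x => Cconj (phase kap x)) (Cmod_phase kap) (fun x => eq_trans (Cmod_conj _) (Cmod_phase kap x)) HA HB).
  eapply app1_ext; [| |exact H]; intros x; cbv beta; auto.
  rewrite (Cmult_comm (phase kap x)), phase_conj. ring.
Qed.

Lemma up_eq : up = (- (Ci * k) * (A * B))%C.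
Proof. apply (app1_unique _ _ _ aup). apply app1_scal, app1_w1w2. Qed.

Lemma amplitudes : Cmod A ^ 2 = (1 + exp (- (PI * k ^ 2 / 4))) / 2 /\ 2 * kap * Cmod B ^ 2 = (1 - exp (- (PI * k ^ 2 / 4))) / 2.
Proof.
  destruct exists_K as (K & HK & H).
  assert (EA := amplitude_A g g_pos Ig kap w1 w2 A B K Hs HK H).
  assert (S := amplitude_sum kap w1 w2 A B K Hs HK H).
  replace (2 * PI * kap) with (PI * k ^ 2 / 4) in EA by (rewrite Hkap; field). split; [exact EA | lra].
Qed.

Lemma sq_app1 (f p : R -> C) (D : C) : (forall x, Cmod (p x) = 1) -> app1 f (fun x => p x * D)%C ->
  app1 (fun x => RtoC (Cmod (f x) ^ 2)) (fun _ => RtoC (Cmod D ^ 2)).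
Proof.
  intros Hp H.
  assert (H2 := app1_mult_phase f p D (Cconj D) (fun x => Cconj (f x)) (fun x => Cconj (p x)) Hp (fun x => eq_trans (Cmod_conj _) (Hp x)) H).
  assert (Hc : app1 (fun x => Cconj (f x)) (fun x => Cconj (p x) * Cconj D)%C).
  { eapply app1_ext; [| |apply app1_conj, H]; intros x; cbv beta; auto. apply Cmult_conj. }
  specialize (H2 Hc). eapply app1_ext; [| |exact H2]; intros x; cbv beta.
  - symmetry. apply Cmod2_conj.
  - rewrite <- (Cmod2_conj (p x)), Hp, <- Cmod2_conj, <- RtoC_mult. f_equal. ring.
Qed.

Lemma u3_eq : u3 = exp (- (PI * k ^ 2 / 4)).
Proof.
  destruct amplitudes as [EA EB].
  assert (E : RtoC u3 = (Cmod A ^ 2 - 2 * kap * Cmod B ^ 2)%R).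
  { apply (app1_unique _ _ _ au3).
    eapply app1_ext; [| |apply app1_plus; [exact (sq_app1 w1 (phase kap) A (Cmod_phase kap) HA) |
       apply (app1_scal (- (2 * kap))%R); exact (sq_app1 w2 (fun x => Cconj (phase kap x)) B (fun x => eq_trans (Cmod_conj _) (Cmod_phase kap x)) HB)]];
    intros x; cbv beta; rewrite <- RtoC_mult, <- RtoC_plus; f_equal; ring. }
  apply RtoC_inj in E. rewrite E, EA, EB. field.
Qed.

(* Variation of constants for the variational system, in the basis (w1, w2), (- 2 kap conj w2, conj w1) of the
   homogeneous solutions: the coefficients are, up to quadratic terms in w, the components of J. *)
Definition vcP x := ((Jp x - w1 x * w2 x) * (/ (2 * kap))%R)%C.
Definition vcQ x : C := ((Cmod (w1 x) ^ 2 - 2 * kap * Cmod (w2 x) ^ 2 - 1) / (4 * kap), 2 / k * J3 x).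

Lemma two_kap_neq : RtoC (2 * kap) <> 0%C.
Proof. apply RtoC_neq_0. generalize kap_gt_0; lra. Qed.

Lemma cderiv_vcP x : cderiv vcP x (2 * (w2 x * w2 x))%C.
Proof.
  assert (Hk := kap_gt_0). unfold vcP. eapply cderiv_eq.
  - apply (cderiv_mult _ (fun _ => RtoC (/ (2 * kap)))); [|apply cderiv_const]. apply cderiv_minus; [apply dJp|].
    apply cderiv_mult; [exact (lz_d1 kap w1 w2 Hs x) | exact (lz_d2 kap w1 w2 Hs x)].
  - cbv beta. rewrite RtoC_inv by lra. field. apply two_kap_neq.
Qed.

Lemma cderiv_vcQ x : cderiv vcQ x (- 2 * (Cconj (w1 x) * w2 x))%C.
Proof.
  assert (Hk := kap_gt_0).
  assert (D1 := is_derive_Cmod2 _ _ _ (lz_d1 kap w1 w2 Hs x)). assert (D2 := is_derive_Cmod2 _ _ _ (lz_d2 kap w1 w2 Hs x)).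
  assert (E : forall t, / (4 * kap) * (Cmod (w1 t) ^ 2 - 2 * kap * Cmod (w2 t) ^ 2 - 1) = Re (vcQ t)).
  { intros t. unfold vcQ, Re; cbn [fst]. field. lra. }
  split.
  - apply is_derive_ext with (fun t => / (4 * kap) * (Cmod (w1 t) ^ 2 - 2 * kap * Cmod (w2 t) ^ 2 - 1)).
    { exact E. }
    eapply is_derive_eq.
    + apply is_derive_scal. apply @is_derive_minus; [|apply @is_derive_const].
      apply @is_derive_minus; [exact D1 | apply is_derive_scal; exact D2].
    + generalize (w1 x) (w2 x); intros [a b] [c d]. unfold minus; unfold plus, opp, zero, Re, Im; simpl. field. lra.
  - apply is_derive_ext with (fun t => 2 / k * J3 t). { intros t. reflexivity. }
    eapply is_derive_eq. apply is_derive_scal, dJ3.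
    generalize (w1 x) (w2 x); intros [a b] [c d]. unfold Re, Im; simpl. field. auto.
Qed.

(** The constant terms of the two variation coefficients at infinity. The unknown constants of J
    enter only here: cc through p0, and c3 through the imaginary part of q0. *)
Let p0 : C := ((cc - A * B) * (/ (2 * kap))%R)%C.
Let q0 : C := ((u3 - 1) / (4 * kap), 2 / k * c3).

Lemma app1_vcP : app1 vcP (fun x => p0 + - (4 * Ci) * (A * B) * ln x)%C.
Proof.
  assert (Hk := kap_gt_0).
  assert (H := app1_scal (/ (2 * kap))%R _ _ (app1_plus _ _ _ _ aJp (app1_scal (-(1)) _ _ app1_w1w2))).
  eapply app1_ext; [| |exact H]; intros x; cbv beta.
  - unfold vcP. ring.
  - unfold p0. rewrite up_eq. rewrite RtoC_inv by lra.
    apply (Cmult_cancel_r (2 * kap)%R); [apply two_kap_neq|].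
    transitivity ((cc - A * B) - Ci * (k * k) * (A * B) * ln x)%C; [field; apply two_kap_neq|].
    transitivity ((cc - A * B) - 4 * Ci * (2 * kap)%R * (A * B) * ln x)%C; [|field; apply two_kap_neq].
    replace (k * k)%C with (4 * (2 * kap)%R)%C. ring. rewrite Hkap. apply C_ext; simpl; field.
Qed.

Lemma app1_vcQ : app1 vcQ (fun x => q0 + 2 * Ci * u3 * ln x)%C.
Proof.
  assert (Hk := kap_gt_0).
  assert (H := app1_plus _ _ _ _ (app1_scal (/ (4 * kap))%R _ _ (app1_plus _ _ _ _ au3 (app1_scal (-(1)) _ _ (sq_app1 (fun _ => 1%C) (fun _ => 1%C) 1 (fun _ => Cmod_1) 
     ltac:(exists 0; split; [lra|]; intros x Hx; replace (1 - 1 * 1)%C with (RtoC 0) by ring; rewrite Cmod_0; unfold Rdiv; lra)))))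
     (app1_scal (Ci * (2 / k)%R) _ _ aJ3)).
  eapply app1_ext; [| |exact H]; intros x; cbv beta; rewrite Cmod_1.
  - unfold vcQ. apply C_ext; simpl; field; lra.
  - unfold q0. apply C_ext; simpl; field; auto; lra.
Qed.

Definition var1 x := (w1 x * vcQ x + - (2 * kap)%R * (Cconj (w2 x) * vcP x))%C.
Definition var2 x := (w2 x * vcQ x + Cconj (w1 x) * vcP x)%C.

Lemma conserved_complex x : (w1 x * Cconj (w1 x) + (2 * kap)%R * (w2 x * Cconj (w2 x)) = 1)%C.
Proof. rewrite <- !Cmod2_conj, <- RtoC_mult, <- RtoC_plus. f_equal. apply (lz_conserved kap w1 w2 Hs). Qed.

(** Differentiating the coefficients contributes -2 w2 (|w1|^2 + 2 kap |w2|^2), and the bracket is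
    the conserved quantity 1. In the second component the two contributions cancel. *)
Lemma cderiv_var1 x : cderiv var1 x (Ci * (x / 2)%R * var1 x - (2 * kap)%R * var2 x - 2 * w2 x)%C.
Proof.
  assert (E := conserved_complex x).
  unfold var1, var2. eapply cderiv_eq.
  - apply cderiv_plus; [apply cderiv_mult; [exact (lz_d1 kap w1 w2 Hs x) | apply cderiv_vcQ]|].
    apply cderiv_scal. apply cderiv_mult; [apply cderiv_conj; exact (lz_d2 kap w1 w2 Hs x) | apply cderiv_vcP].
  - rewrite Cminus_conj, !Cmult_conj, Cconj_Ci, !Cconj_RtoC.
    generalize (vcQ x) (vcP x); intros q p. set (y := RtoC (x / 2)). set (K := RtoC (2 * kap)) in *.
    set (a := w1 x) in *. set (b := w2 x) in *. set (a' := Cconj a) in *. set (b' := Cconj b) in *.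
    transitivity (Ci * y * (a * q + - K * (b' * p)) - K * (b * q + a' * p) - 2 * b * (a * a' + K * (b * b')))%C; [ring|].
    rewrite E. ring.
Qed.

Lemma cderiv_var2 x : cderiv var2 x (var1 x - Ci * (x / 2)%R * var2 x)%C.
Proof.
  unfold var1, var2. eapply cderiv_eq.
  - apply cderiv_plus; [apply cderiv_mult; [exact (lz_d2 kap w1 w2 Hs x) | apply cderiv_vcQ]|].
    apply cderiv_mult; [apply cderiv_conj; exact (lz_d1 kap w1 w2 Hs x) | apply cderiv_vcP].
  - rewrite Cminus_conj, !Cmult_conj, Cconj_Ci, !Cconj_RtoC.
    generalize (vcQ x) (vcP x); intros q p. ring.
Qed.

Lemma vcP_0 : vcP 0 = 0%C.
Proof. unfold vcP. destruct Hs as (_ & E & _). rewrite Jp0, E. ring. Qed.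

Lemma vcQ_0 : vcQ 0 = 0%C.
Proof.
  assert (Hk := kap_gt_0). unfold vcQ. destruct Hs as (E1 & E2 & _). rewrite E1, E2, J30, Cmod_1, Cmod_0.
  apply C_ext; simpl; field; auto; lra.
Qed.

Lemma var1_0 : var1 0 = 0%C.
Proof. unfold var1. rewrite vcP_0, vcQ_0. ring. Qed.

Lemma var2_0 : var2 0 = 0%C.
Proof. unfold var2. rewrite vcP_0, vcQ_0. ring. Qed.

Lemma u3_amplitudes : (RtoC u3 = A * Cconj A - (2 * kap)%R * (B * Cconj B))%C.
Proof.
  destruct amplitudes as [EA EB]. rewrite <- !Cmod2_conj, <- RtoC_mult, <- RtoC_minus. f_equal. rewrite u3_eq, EA, EB. field.
Qed.

Lemma amplitudes_conserved : (A * Cconj A + (2 * kap)%R * (B * Cconj B) = 1)%C.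
Proof.
  destruct amplitudes as [EA EB]. rewrite <- !Cmod2_conj, <- RtoC_mult, <- RtoC_plus. f_equal. rewrite EA, EB. field.
Qed.

Let D1 : C := (A * q0 + - (2 * kap)%R * (Cconj B * p0) + Ci * A * ln 2)%C.
Let D2 : C := (B * q0 + Cconj A * p0 - Ci * B * ln 2)%C.

Lemma ln_x_half x : 1 <= x -> RtoC (ln x) = ((ln (x ^ 2 / 2)%R + ln 2) / 2)%C.
Proof. intros Hx. rewrite ln_half_sqr by lra. apply C_ext; simpl; field. Qed.

(** The coefficient of ln x is 2 i A (|A|^2 + 2 kap |B|^2) = 2 i A. Passing from ln x to ln (x^2/2)
    halves it and moves the term i A ln 2 into [D1]. *)
Lemma app2_var1 : app2 var1 (fun x => phase kap x * (D1 + Ci * A * ln (x ^ 2 / 2)%R))%C.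
Proof.
  assert (Hc : app1 (fun x => Cconj (w2 x)) (fun x => phase kap x * Cconj B)%C).
  { eapply app1_ext; [| |apply app1_conj, HB]; intros x; cbv beta; auto. rewrite Cmult_conj, Cconj_conj. reflexivity. }
  assert (H1 := app2_mult_phase _ _ (phase kap) _ _ _ (Cmod_phase kap) HA app1_vcQ).
  assert (H2 := app2_scal (- (2 * kap)%R) _ _ (app2_mult_phase _ _ (phase kap) _ _ _ (Cmod_phase kap) Hc app1_vcP)).
  eapply app2_ext; [| |apply (app2_plus _ _ _ _ H1 H2)]; intros x; cbv beta; [reflexivity|]. intros Hx.
  rewrite ln_x_half by auto. rewrite u3_amplitudes. unfold D1. assert (E := amplitudes_conserved).
  set (K := RtoC (2 * kap)) in *. set (l := RtoC (ln (x ^ 2 / 2))). set (l2 := RtoC (ln 2)). set (p := phase kap x).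
  set (A' := Cconj A) in *. set (B' := Cconj B) in *.
  transitivity (p * (A * q0 + - K * (B' * p0) + Ci * A * l2 * (A * A' + K * (B * B')) + Ci * A * l * (A * A' + K * (B * B'))))%C.
  - field.
  - rewrite E. ring.
Qed.

Lemma app2_var2 : app2 var2 (fun x => Cconj (phase kap x) * (D2 + - (Ci * B) * ln (x ^ 2 / 2)%R))%C.
Proof.
  assert (Hc : app1 (fun x => Cconj (w1 x)) (fun x => Cconj (phase kap x) * Cconj A)%C).
  { eapply app1_ext; [| |apply app1_conj, HA]; intros x; cbv beta; auto. rewrite Cmult_conj. reflexivity. }
  assert (Hp : forall x, Cmod (Cconj (phase kap x)) = 1) by (intros; rewrite Cmod_conj; apply Cmod_phase).
  assert (H1 := app2_mult_phase _ _ (fun x => Cconj (phase kap x)) _ _ _ Hp HB app1_vcQ).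
  assert (H2 := app2_mult_phase _ _ (fun x => Cconj (phase kap x)) _ _ _ Hp Hc app1_vcP).
  eapply app2_ext; [| |apply (app2_plus _ _ _ _ H1 H2)]; intros x; cbv beta; [reflexivity|]. intros Hx.
  rewrite ln_x_half by auto. rewrite u3_amplitudes. unfold D2. assert (E := amplitudes_conserved).
  set (K := RtoC (2 * kap)) in *. set (l := RtoC (ln (x ^ 2 / 2))). set (l2 := RtoC (ln 2)). set (p := Cconj (phase kap x)).
  set (A' := Cconj A) in *. set (B' := Cconj B) in *.
  transitivity (p * (B * q0 + A' * p0 - Ci * B * l2 * (A * A' + K * (B * B')) - Ci * B * l * (A * A' + K * (B * B'))))%C.
  - field.
  - rewrite E. ring.
Qed.

Lemma AG_neq : (A * CGamma z)%C <> 0%C.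
Proof.
  destruct exists_K as (K & HK & H).
  unfold z. rewrite (lz_A_Gamma kap w1 w2 A B g K Hs HK (fun x Hx => proj1 (H x Hx)) (fun x Hx => proj2 (H x Hx)) Ig).
  repeat apply Cmult_neq_0; apply RtoC_neq_0.
  - generalize (sqrt_lt_R0 2); lra. - lra. - generalize (exp_pos (- (PI * kap / 2))); lra.
Qed.

Lemma BG_neq : (B * CGamma z')%C <> 0%C.
Proof.
  destruct exists_K as (K & HK & H).
  unfold z'. rewrite (lz_B_Gamma kap w1 w2 A B g K Hs HK (fun x Hx => proj1 (H x Hx)) (fun x Hx => proj2 (H x Hx)) Ig).
  apply Cmult_neq_0; [apply RtoC_neq_0; lra | apply Cexp_neq_0].
Qed.

Let psi : C := digamma z.
Let psi' : C := digamma z'.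

(** The amplitudes of the variational solution, on one side built from the constants of J, are on
    the other side given by the transform. Dividing by Gamma, nonzero by [AG_neq] and [BG_neq],
    makes the digamma values appear. *)
Lemma D_values : D1 = (A * (- (Ci * psi) - (PI / 2)%R))%C /\ D2 = (B * (Ci * psi' - (PI / 2)%R))%C.
Proof.
  destruct exists_K as (K & HK & H). destruct app2_var1 as (K1 & HK1 & H1). destruct app2_var2 as (K2 & HK2 & H2).
  assert (Ha : forall x, 1 <= x -> Cmod (var1 x - phase kap x * (D1 + Ci * A * ln (x ^ 2 / 2)%R))%C <= (K1 + K2) * Rpower x (- (1 / 2))).
  { intros x Hx. eapply Rle_trans; [apply H1, Hx|]. apply Rmult_le_compat_r; [left; apply exp_pos | lra]. }
  assert (Hb : forall x, 1 <= x -> Cmod (var2 x - Cconj (phase kap x) * (D2 + - (Ci * B) * ln (x ^ 2 / 2)%R))%C <= (K1 + K2) * Rpower x (- (1 / 2))).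
  { intros x Hx. eapply Rle_trans; [apply H2, Hx|]. apply Rmult_le_compat_r; [left; apply exp_pos | lra]. }
  assert (HK3 : 0 <= K1 + K2) by lra.
  assert (G1 := lz_D1_Gamma kap w1 w2 A B g K Hs HK (fun x Hx => proj1 (H x Hx)) (fun x Hx => proj2 (H x Hx)) Ig
     var1 var2 D1 D2 (K1 + K2) HK3 cderiv_var1 cderiv_var2 var1_0 var2_0 Ha Hb).
  assert (G2 := lz_D2_Gamma kap w1 w2 A B g K Hs HK (fun x Hx => proj1 (H x Hx)) (fun x Hx => proj2 (H x Hx)) Ig
     var1 var2 D1 D2 (K1 + K2) HK3 cderiv_var1 cderiv_var2 var1_0 var2_0 Ha Hb).
  cbv zeta in G1, G2. fold z in G1. fold z' in G2.
  assert (N1 := AG_neq). assert (N2 := BG_neq).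
  assert (N3 : CGamma z <> 0%C) by (intros E; apply N1; rewrite E; ring).
  assert (N4 : CGamma z' <> 0%C) by (intros E; apply N2; rewrite E; ring).
  split.
  - apply (Cmult_cancel_r (CGamma z)); auto. rewrite G1. unfold psi, digamma. field. auto.
  - apply (Cmult_cancel_r (CGamma z')); auto. rewrite G2. unfold psi', digamma. field. auto.
Qed.

(** The definitions of [D1], [D2] form a linear system for q0 and p0 with determinant |A|^2 + 2 kap
    |B|^2 = 1. The combination A D2 - B D1 eliminates q0. *)
Lemma p0_eq : p0 = (A * B * (Ci * (2 * ln 2 + psi' + psi)))%C.
Proof.
  destruct D_values as [E1 E2]. assert (E := amplitudes_conserved).
  assert (F : (A * D2 - B * D1 = p0 - 2 * Ci * (A * B) * ln 2)%C).
  { transitivity ((A * Cconj A + (2 * kap)%R * (B * Cconj B)) * p0 - 2 * Ci * (A * B) * ln 2)%C; [unfold D1, D2; ring | rewrite E; ring]. }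
  replace p0 with (A * D2 - B * D1 + 2 * Ci * (A * B) * ln 2)%C by (rewrite F; ring).
  rewrite E1, E2. ring.
Qed.

(** The complementary combination, conj A D1 + 2 kap conj B D2, eliminates p0. *)
Lemma q0_eq : q0 = (A * Cconj A * (- (Ci * psi) - (PI / 2)%R - Ci * ln 2) + (2 * kap)%R * (B * Cconj B) * (Ci * psi' - (PI / 2)%R + Ci * ln 2))%C.
Proof.
  destruct D_values as [E1 E2]. assert (E := amplitudes_conserved).
  assert (F : (Cconj A * D1 + (2 * kap)%R * Cconj B * D2 = q0 + (A * Cconj A) * Ci * ln 2 - (2 * kap)%R * (B * Cconj B) * Ci * ln 2)%C).
  { transitivity ((A * Cconj A + (2 * kap)%R * (B * Cconj B)) * q0 + (A * Cconj A) * Ci * ln 2 - (2 * kap)%R * (B * Cconj B) * Ci * ln 2)%C; [unfold D1, D2; ring | rewrite E; ring]. }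
  replace q0 with (Cconj A * D1 + (2 * kap)%R * Cconj B * D2 - ((A * Cconj A) * Ci * ln 2 - (2 * kap)%R * (B * Cconj B) * Ci * ln 2))%C by (rewrite F; ring).
  rewrite E1, E2. ring.
Qed.

(** From cc = A B + 2 kap p0 and A B = (i/k) up: the summand A B is the origin of the term i/k. *)
Lemma cc_eq : cc = (up * (Ci / k - k / 4 * (2 * ln 2 + psi' + psi)))%C.
Proof.
  assert (Hk := kap_gt_0). assert (Nk := RtoC_neq_0 k k_neq).
  assert (E : cc = (A * B + (2 * kap)%R * p0)%C). { unfold p0. rewrite RtoC_inv by lra. field. apply two_kap_neq. }
  rewrite E, p0_eq, up_eq. replace (RtoC (2 * kap)) with (k * k / 4)%C by (rewrite Hkap; apply C_ext; simpl; field).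
  set (s := (2 * ln 2 + psi' + psi)%C).
  transitivity (A * B * (- (Ci * Ci)) + k * k / 4 * (A * B * (Ci * s)))%C; [rewrite Ci2; ring | field; auto].
Qed.

Lemma c3_eq : c3 = k / 4 * ((1 - exp (- (PI * k ^ 2 / 4))) * (ln 2 + Re psi') - (1 + exp (- (PI * k ^ 2 / 4))) * (ln 2 + Re psi)).
Proof.
  assert (Hk := kap_gt_0). assert (E := f_equal Im q0_eq). rewrite <- !Cmod2_conj in E.
  destruct amplitudes as [EA EB].
  assert (E' : 2 / k * c3 = Cmod A ^ 2 * (- Re psi - ln 2) + 2 * kap * Cmod B ^ 2 * (Re psi' + ln 2)).
  { transitivity (Im q0); [reflexivity|]. rewrite E. generalize (Cmod A) (Cmod B); intros a b.
    destruct psi as [p1 p2], psi' as [p3 p4]. unfold Re, Im; simpl. ring. }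
  rewrite EA, EB in E'.
  transitivity (k / 2 * (2 / k * c3)); [field; auto|]. rewrite E'. field.
Qed.

(** The product of the two Gamma identities, with sqrt 2 sqrt 2 g^2 = pi. The phase is - i e^(i
    pi/4) = e^(- i pi/4), and the two factors e^(- pi kap/2) combine to e^(- pi k^2/8). *)
Lemma up_value : up = u_perp 1 k.
Proof.
  destruct exists_K as (K & HK & H).
  assert (EA := lz_A_Gamma kap w1 w2 A B g K Hs HK (fun x Hx => proj1 (H x Hx)) (fun x Hx => proj2 (H x Hx)) Ig).
  assert (EB := lz_B_Gamma kap w1 w2 A B g K Hs HK (fun x Hx => proj1 (H x Hx)) (fun x Hx => proj2 (H x Hx)) Ig).
  fold z in EA. fold z' in EB.
  assert (N1 := AG_neq). assert (N2 := BG_neq).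
  assert (N3 : CGamma z <> 0%C) by (intros E; apply N1; rewrite E; ring).
  assert (N4 : CGamma z' <> 0%C) by (intros E; apply N2; rewrite E; ring).
  assert (N5 : RtoC (sqrt 2) <> 0%C) by (apply RtoC_neq_0; generalize (sqrt_lt_R0 2); lra).
  rewrite up_eq. unfold u_perp.
  replace (1 / 2 + Ci * k ^ 2 / 8)%C with z by (unfold z; rewrite Hkap; apply C_ext; simpl; field).
  replace (1 - Ci * k ^ 2 / 8)%C with z' by (unfold z'; rewrite Hkap; apply C_ext; simpl; field).
  apply (Cmult_cancel_r (sqrt 2 * CGamma z * CGamma z')); [repeat apply Cmult_neq_0; auto|].
  transitivity (k * PI * exp (- (PI * k ^ 2 / 8))%R * Cexp (- (PI * Ci / 4)))%C; [|field; auto].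
  transitivity (- (Ci * k) * sqrt 2 * ((A * CGamma z) * (B * CGamma z')))%C; [ring|].
  rewrite EA, EB.
  assert (S2 : (sqrt 2 * sqrt 2 = 2)%C) by (rewrite <- RtoC_mult, sqrt_sqrt by lra; reflexivity).
  assert (G2 : (g * g = PI / 2)%C).
  { rewrite <- RtoC_mult. replace (g * g) with (g ^ 2) by ring. rewrite (gauss_sqr g g_pos Ig). apply C_ext; simpl; field. }
  rewrite <- Cexp_RtoC.
  transitivity (k * (sqrt 2 * sqrt 2) * (g * g) * (- Ci * (Cexp (- (PI * kap / 2))%R * Cexp (- ((1 / 2)%R + Ci * kap) * (Ci * (-1 * (PI / 2))%R)))))%C; [ring|].
  rewrite S2, G2.
  assert (EI : (- Ci = Cexp (- (Ci * (PI / 2)%R)))%C).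
  { apply C_ext; unfold Cexp; simpl.
    - replace (- (0 * 0 + 1 * (PI / 2))) with (- (PI / 2)) by ring. rewrite cos_neg, cos_PI2. ring.
    - replace (- (0 * 0 + 1 * (PI / 2))) with (- (PI / 2)) by ring.
      replace (- (0 * (PI / 2) - 1 * 0)) with 0 by ring. rewrite sin_neg, sin_PI2, exp_0. ring. }
  rewrite EI. rewrite <- (Cexp_RtoC (- (PI * k ^ 2 / 8))).
  transitivity (k * PI * (Cexp (- (Ci * (PI / 2)%R)) * (Cexp (- (PI * kap / 2))%R * Cexp (- ((1 / 2)%R + Ci * kap) * (Ci * (-1 * (PI / 2))%R)))))%C.
  { field. }
  rewrite <- !(Cmult_assoc (RtoC k * RtoC PI)). f_equal. rewrite <- !Cexp_add. f_equal. rewrite Hkap.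
  apply C_ext; simpl; field.
Qed.

End Ident.

(** The last clause says that the limiting direction is a unit vector: |u_perp|^2 = 4 |A|^2 (2 kap
    |B|^2) = 1 - e^2, where e is the third component. *)
Lemma lz_limits (k : R) : k <> 0 ->
  app1 (fun x => x * gammaP k x - k * dvecP k x)%C (fun x => x * u_perp 1 k)%C /\
  app1 (fun x => RtoC (x * gamma3 k x - k * dvec3 k x)) (fun x => RtoC (x * exp (- (PI * k ^ 2 / 4)))) /\
  app1 (Jp k) (fun x => perp (C_const 1 k) + k * u_perp 1 k * ln x)%C /\
  app1 (fun x => RtoC (J3 k x)) (fun x => RtoC (third (C_const 1 k) + k * exp (- (PI * k ^ 2 / 4)) * ln x)) /\
  Cmod (u_perp 1 k) ^ 2 + exp (- (PI * k ^ 2 / 4)) ^ 2 = 1.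
Proof.
  intros Hk. set (kap := k ^ 2 / 8).
  destruct (raw_asymptotics k Hk) as (up & cc & u3 & c3 & R1 & R2 & R3 & R4 & R5 & R6).
  destruct gauss_const_exists as (g & Hg & Ig).
  assert (Hs := lz_sys_kap k).
  destruct (lz_asymptotics kap _ _ Hs) as (A & B & K & HK & H).
  assert (HA : app1 (kw1 kap) (fun x => phase kap x * A)%C) by (exists K; split; [exact HK | intros x Hx; exact (proj1 (H x Hx))]).
  assert (HB : app1 (kw2 kap) (fun x => Cconj (phase kap x) * B)%C) by (exists K; split; [exact HK | intros x Hx; exact (proj2 (H x Hx))]).
  assert (dJp : forall x, cderiv (Jp k) x (kw1 kap x * kw1 kap x + (2 * kap)%R * (kw2 kap x * kw2 kap x))%C).
  { intros x. eapply cderiv_eq; [exact (cderiv_Jp k x)|]. unfold dvecP. fold kap. ring. }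
  assert (dJ3 : forall x, is_derive (J3 k) x (- (k * Im (Cconj (kw1 kap x) * kw2 kap x)%C))) by (intros x; exact (is_derive_J3 k x)).
  assert (Eu := up_value k kap g (kw1 kap) (kw2 kap) A B up eq_refl Hs Hg Ig HA HB R5).
  assert (E3 := u3_eq k kap g u3 (kw1 kap) (kw2 kap) A B eq_refl Hs Hg Ig HA HB R6).
  assert (Ec := cc_eq k kap g u3 c3 (kw1 kap) (kw2 kap) (Jp k) (J3 k) A B up cc Hk eq_refl Hs Hg Ig HA HB dJp dJ3 (Jp_0 k) (J3_0 k) R3 R4 R5 R6).
  assert (Ed := c3_eq k kap g u3 c3 (kw1 kap) (kw2 kap) (Jp k) (J3 k) A B up cc Hk eq_refl Hs Hg Ig HA HB dJp dJ3 (Jp_0 k) (J3_0 k) R3 R4 R5 R6).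
  assert (Z1 : (1 / 2 + Ci * k ^ 2 / 8)%C = ((1 / 2)%R + Ci * kap)%C) by (unfold kap; apply C_ext; simpl; field).
  assert (Z2 : (1 - Ci * k ^ 2 / 8)%C = (1 - Ci * kap)%C) by (unfold kap; apply C_ext; simpl; field).
  assert (Pc : perp (C_const 1 k) = cc). { unfold C_const, perp, vec; cbn [fst]. rewrite Z1, Z2, <- Eu, Ec. reflexivity. }
  assert (Tc : third (C_const 1 k) = c3). { unfold C_const, third, vec; cbn [snd]. rewrite Z1, Z2, Ed. reflexivity. }
  rewrite Pc, Tc, <- Eu, <- E3.
  split; [exact R1 | split; [exact R2 | split; [exact R3 | split; [exact R4|]]]].
  rewrite E3. rewrite (up_eq k kap (kw1 kap) (kw2 kap) A B up HA HB R5).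
  destruct (amplitudes k kap g (kw1 kap) (kw2 kap) A B eq_refl Hs Hg Ig HA HB) as [EA EB].
  rewrite Cmod_mult, Cmod_opp, !Cmod_mult, Cmod_Ci, Cmod_R, Rmult_1_l, !Rpow_mult_distr, pow2_abs.
  replace (k ^ 2 * (Cmod A ^ 2 * Cmod B ^ 2)) with (4 * Cmod A ^ 2 * (2 * kap * Cmod B ^ 2)) by (unfold kap; field).
  rewrite EA, EB. field.
Qed.

(** * The limits at both ends *)

Section Parity.
Variable k : R.

Lemma zeta_opp x : zeta (- x) = zeta x.
Proof. rewrite !zeta_eq. do 3 f_equal. ring. Qed.

Lemma kw1_opp kap x : kw1 kap (- x) = kw1 kap x.
Proof. unfold kw1. rewrite zeta_opp. reflexivity. Qed.

Lemma kw2_opp kap x : kw2 kap (- x) = (- kw2 kap x)%C.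
Proof. unfold kw2. rewrite zeta_opp, RtoC_opp. ring. Qed.

Lemma gammaP_opp x : gammaP k (- x) = (- gammaP k x)%C.
Proof. unfold gammaP. rewrite kw1_opp, kw2_opp. ring. Qed.
Lemma dvecP_opp x : dvecP k (- x) = dvecP k x.
Proof. unfold dvecP. rewrite kw1_opp, kw2_opp. ring. Qed.
Lemma gamma3_opp x : gamma3 k (- x) = gamma3 k x.
Proof. unfold gamma3. rewrite kw1_opp, kw2_opp, Cmod_opp. reflexivity. Qed.
Lemma dvec3_opp x : dvec3 k (- x) = - dvec3 k x.
Proof.
  unfold dvec3. rewrite kw1_opp, kw2_opp. generalize (kw1 (k ^ 2 / 8) x) (kw2 (k ^ 2 / 8) x); intros [a b] [c d].
  unfold Im; simpl; ring.
Qed.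

Lemma is_derive_opp_id x : is_derive Ropp x (-1).
Proof. auto_derive; auto. Qed.

Lemma Jp_opp x : Jp k (- x) = (- Jp k x)%C.
Proof.
  assert (D : forall t, cderiv (fun t => Jp k (- t) + Jp k t)%C t 0).
  { intros t. eapply cderiv_eq; [apply cderiv_plus; [apply (cderiv_comp (Jp k) Ropp); [apply cderiv_Jp | apply is_derive_opp_id] | apply cderiv_Jp]|].
    rewrite dvecP_opp. apply C_ext; simpl; ring. }
  assert (E : (Jp k (- x) + Jp k x = Jp k (- 0) + Jp k 0)%C).
  { destruct (Rle_dec 0 x); [symmetry|];
    apply (cderiv_zero_eq (fun t => Jp k (- t) + Jp k t)%C (fun _ => 0%C)); auto; lra. }
  rewrite Ropp_0, Jp_0 in E. replace (Jp k (- x)) with (Jp k (- x) + Jp k x - Jp k x)%C by ring. rewrite E. ring.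
Qed.

Lemma J3_opp x : J3 k (- x) = J3 k x.
Proof.
  assert (D : forall t, is_derive (fun t => J3 k (- t) - J3 k t) t 0).
  { intros t. eapply is_derive_eq.
    - apply @is_derive_minus; [exact (is_derive_comp (J3 k) Ropp t _ _ (is_derive_J3 k (- t)) (is_derive_opp_id t)) | apply is_derive_J3].
    - rewrite dvec3_opp. unfold minus; unfold plus, opp, scal; simpl; unfold mult; simpl. ring. }
  assert (E : J3 k (- x) - J3 k x = J3 k (- 0) - J3 k 0).
  { destruct (Rle_dec 0 x); [symmetry|];
    apply (is_derive_zero_eq (fun t => J3 k (- t) - J3 k t) (fun _ => 0)); auto; lra. }
  rewrite Ropp_0 in E. lra.
Qed.

Hypothesis k_neq : k <> 0.

Lemma u_perp_opp : u_perp (-1) k = (- u_perp 1 k)%C.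
Proof. unfold u_perp. replace (RtoC (-1)) with (- (1))%C by (apply C_ext; simpl; ring). ring. Qed.

Lemma perp_C_opp : perp (C_const (-1) k) = (- perp (C_const 1 k))%C.
Proof. unfold C_const, perp, vec; cbn [fst]. rewrite u_perp_opp. ring. Qed.

Lemma third_C_opp : third (C_const (-1) k) = third (C_const 1 k).
Proof. reflexivity. Qed.

(** The Kummer series depend on x^2, so w1 is even and w2 odd. Hence gamma and J have odd horizontal
    and even vertical parts, d the opposite, and the horizontal parts of u and C change sign with
    [sg]. *)
Lemma two_sided (sg : R) : sg = 1 \/ sg = -1 -> exists K, 0 <= K /\ forall x, 1 <= sg * x ->
  Cmod (x * gammaP k x - k * dvecP k x - x * u_perp sg k)%C <= K / Rabs x /\
  Rabs (x * gamma3 k x - k * dvec3 k x - x * exp (- (PI * k ^ 2 / 4))) <= K / Rabs x /\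
  Cmod (Jp k x - (perp (C_const sg k) + k * u_perp sg k * ln (Rabs x)))%C <= K / Rabs x /\
  Rabs (J3 k x - (third (C_const sg k) + k * exp (- (PI * k ^ 2 / 4)) * ln (Rabs x))) <= K / Rabs x.
Proof.
  intros Hsg.
  destruct (lz_limits k k_neq) as ((K1 & P1 & H1) & (K2 & P2 & H2) & (K3 & P3 & H3) & (K4 & P4 & H4) & _).
  exists (K1 + K2 + K3 + K4). split; [lra|].
  assert (Main : forall x, 1 <= x ->
    Cmod (x * gammaP k x - k * dvecP k x - x * u_perp 1 k)%C <= (K1 + K2 + K3 + K4) / x /\
    Rabs (x * gamma3 k x - k * dvec3 k x - x * exp (- (PI * k ^ 2 / 4))) <= (K1 + K2 + K3 + K4) / x /\
    Cmod (Jp k x - (perp (C_const 1 k) + k * u_perp 1 k * ln x))%C <= (K1 + K2 + K3 + K4) / x /\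
    Rabs (J3 k x - (third (C_const 1 k) + k * exp (- (PI * k ^ 2 / 4)) * ln x)) <= (K1 + K2 + K3 + K4) / x).
  { intros x Hx. assert (0 < / x) by (apply Rinv_0_lt_compat; lra).
    specialize (H1 x Hx). specialize (H2 x Hx). specialize (H3 x Hx). specialize (H4 x Hx).
    rewrite <- RtoC_minus, Cmod_R in H2, H4.
    assert (M : forall Ki, Ki <= K1 + K2 + K3 + K4 -> Ki / x <= (K1 + K2 + K3 + K4) / x).
    { intros Ki Hi. unfold Rdiv. apply Rmult_le_compat_r; lra. }
    split; [|split; [|split]].
    - eapply Rle_trans; [exact H1 | apply M; lra].
    - eapply Rle_trans; [exact H2 | apply M; lra].
    - eapply Rle_trans; [exact H3 | apply M; lra].
    - eapply Rle_trans; [exact H4 | apply M; lra]. }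
  intros x Hx. destruct Hsg as [-> | ->].
  - rewrite (Rabs_pos_eq x) by lra. apply Main. lra.
  - rewrite (Rabs_left x) by lra. specialize (Main (- x) ltac:(lra)).
    rewrite gammaP_opp, dvecP_opp, gamma3_opp, dvec3_opp, Jp_opp, J3_opp in Main. rewrite u_perp_opp, perp_C_opp, third_C_opp.
    rewrite RtoC_opp in Main. destruct Main as (M1 & M2 & M3 & M4).
    split; [|split; [|split]].
    + eapply Rle_trans; [|exact M1]. right; f_equal. ring.
    + eapply Rle_trans; [|exact M2]. right. rewrite <- Rabs_Ropp. f_equal. ring.
    + eapply Rle_trans; [|exact M3]. right. rewrite <- Cmod_opp. f_equal. ring.
    + exact M4.
Qed.

End Parity.

(** * The clothoid *)

Lemma norm_R3_eq (v : R3) : norm v = sqrt (Cmod (perp v) ^ 2 + third v ^ 2).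
Proof.
  destruct v as [[a b] t].
  change (sqrt (sqrt (Rabs a ^ 2 + Rabs b ^ 2) ^ 2 + Rabs t ^ 2) = sqrt (sqrt (a ^ 2 + b ^ 2) ^ 2 + t ^ 2)).
  rewrite !pow2_abs. reflexivity.
Qed.

Lemma norm_R3_le (v : R3) : norm v <= Cmod (perp v) + Rabs (third v).
Proof.
  rewrite norm_R3_eq. generalize (Cmod_ge_0 (perp v)) (Rabs_pos (third v)); intros.
  apply Rsqr_incr_0_var; [|lra]. rewrite Rsqr_sqrt by nra. unfold Rsqr.
  rewrite <- (pow2_abs (third v)). nra.
Qed.

Section Integral.
Variables (k a c : R).

(** The primitive uses (y gamma - k d)' = gamma, in which the two normal terms cancel, and J' = -
    d. *)
Lemma perp_integral x y :
  perp (RInt3 (fun y => minus (scal a (gamma k y)) (scal c (dvec k y))) x y) =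
  (a * (y * gammaP k y - k * dvecP k y) + c * Jp k y - (a * (x * gammaP k x - k * dvecP k x) + c * Jp k x))%C.
Proof.
  set (F := fun y : R => (a * (y * gammaP k y - k * dvecP k y) + c * Jp k y)%C).
  set (f := fun y : R => (a * gammaP k y - c * dvecP k y)%C).
  assert (D : forall t, cderiv F t (f t)).
  { intros t. unfold F, f. eapply cderiv_eq.
    - apply cderiv_plus; apply cderiv_scal; [apply cderiv_minus; [apply (cderiv_mult (fun t => RtoC t)); [apply cderiv_RtoC, @is_derive_id | apply cderiv_gammaP] | apply cderiv_scal, cderiv_dvecP] | apply cderiv_Jp].
    - cbv beta. change (RtoC one) with (RtoC 1). ring. }
  assert (Cf : forall t, ccont f t).
  { intros t. unfold f. apply ccont_minus; apply ccont_mult; try apply ccont_const; eapply cderiv_ccont; [apply cderiv_gammaP | apply cderiv_dvecP]. }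
  unfold RInt3, perp at 1, vec. cbn [fst].
  rewrite (RInt_ext (V := C_R_CompleteNormedModule) _ f).
  2:{ intros t _. unfold f. rewrite <- perp_gamma, <- perp_dvec.
      destruct (gamma k t) as [[g1 g2] g3'], (dvec k t) as [[d1 d2] d3'].
      apply C_ext.
      - change (a * g1 + - (c * d1) = a * g1 - 0 * g2 + - (c * d1 - 0 * d2)). ring.
      - change (a * g2 + - (c * d2) = a * g2 + 0 * g1 + - (c * d2 + 0 * d1)). ring. }
  change (a * (y * gammaP k y - k * dvecP k y) + c * Jp k y)%C with (F y).
  change (a * (x * gammaP k x - k * dvecP k x) + c * Jp k x)%C with (F x).
  rewrite (RInt_C f x y Cf). apply C_ext; cbn [fst snd].
  - apply (is_RInt_unique (V := R_CompleteNormedModule) (fun t => Re (f t)) x y (Re (F y) - Re (F x))).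
    apply (is_RInt_derive (fun t => Re (F t)) (fun t => Re (f t))); intros t _; [exact (proj1 (D t)) | exact (proj1 (Cf t))].
  - apply (is_RInt_unique (V := R_CompleteNormedModule) (fun t => Im (f t)) x y (Im (F y) - Im (F x))).
    apply (is_RInt_derive (fun t => Im (F t)) (fun t => Im (f t))); intros t _; [exact (proj2 (D t)) | exact (proj2 (Cf t))].
Qed.

Lemma third_integral x y :
  third (RInt3 (fun y => minus (scal a (gamma k y)) (scal c (dvec k y))) x y) =
  a * (y * gamma3 k y - k * dvec3 k y) + c * J3 k y - (a * (x * gamma3 k x - k * dvec3 k x) + c * J3 k x).
Proof.
  set (F := fun y => a * (y * gamma3 k y - k * dvec3 k y) + c * J3 k y).
  set (f := fun y => a * gamma3 k y - c * dvec3 k y).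
  assert (D : forall t, is_derive F t (f t)).
  { intros t. unfold F, f. eapply is_derive_eq.
    - apply @is_derive_plus; apply is_derive_scal; [apply @is_derive_minus; [apply (is_derive_mult (fun t => t) (gamma3 k) t 1); [apply @is_derive_id | apply is_derive_gamma3 | apply Rmult_comm] | apply is_derive_scal, is_derive_dvec3] | apply is_derive_J3].
    - unfold minus; unfold plus, opp, mult; simpl. ring. }
  assert (Cf : forall t, continuous f t).
  { intros t. apply (continuous_minus (fun y => a * gamma3 k y) (fun y => c * dvec3 k y)).
    - apply (continuous_mult (fun _ => a) (gamma3 k)); [apply continuous_const|]. apply @ex_derive_continuous. eexists. apply is_derive_gamma3.
    - apply (continuous_mult (fun _ => c) (dvec3 k)); [apply continuous_const|]. apply @ex_derive_continuous. eexists. apply is_derive_dvec3. }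
  unfold RInt3, third at 1, vec. cbn [snd].
  rewrite (RInt_ext _ f).
  2:{ intros t _. unfold f. rewrite <- third_gamma, <- third_dvec. reflexivity. }
  apply is_RInt_unique. apply (is_RInt_derive F f); intros t _; auto.
Qed.

End Integral.

(** The set of distances is nonempty and bounded below by 0, so its infimum is finite and [real]
    does not return its default value. *)
Lemma dist_to_line_le (x p u : R3) (t : R) : 0 <= dist_to x (line p u) <= norm (minus x (plus p (scal t u))).
Proof.
  unfold dist_to.
  set (E := fun t => exists y : R3, line p u y /\ t = norm (minus x y)).
  assert (L : is_lb_Rbar E 0). { intros r (y & _ & ->). simpl. apply norm_ge_0. }
  assert (Mem : E (norm (minus x (plus p (scal t u))))). { eexists; split; [exists t; reflexivity | reflexivity]. }
  assert (G := Glb_Rbar_correct E). destruct G as [G1 G2].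
  assert (G3 := G1 _ Mem). assert (G4 := G2 _ L).
  destruct (Glb_Rbar E); simpl in *; try contradiction. lra.
Qed.

Lemma perp_plus (u v : R3) : perp (plus u v) = (perp u + perp v)%C.
Proof. reflexivity. Qed.
Lemma perp_minus (u v : R3) : perp (minus u v) = (perp u - perp v)%C.
Proof. reflexivity. Qed.
Lemma perp_scal (t : R) (u : R3) : perp (scal t u) = (t * perp u)%C.
Proof.
  destruct u as [[x y] w]. apply C_ext.
  - change (t * x = t * x - 0 * y). ring.
  - change (t * y = t * y + 0 * x). ring.
Qed.
Lemma third_plus (u v : R3) : third (plus u v) = third u + third v.
Proof. reflexivity. Qed.
Lemma third_minus (u v : R3) : third (minus u v) = third u - third v.
Proof. reflexivity. Qed.
Lemma third_scal (t : R) (u : R3) : third (scal t u) = t * third u.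
Proof. reflexivity. Qed.

Lemma rho_pos a c : a ^ 2 + c ^ 2 > 0 -> 0 < rho a c.
Proof. intros H. apply sqrt_lt_R0. lra. Qed.

Lemma chi_neq_0 a b c d : Delta_abcd a b c d <> 0 -> chi a b c d <> 0.
Proof.
  intros H. unfold chi, Rdiv. apply Rmult_integral_contrapositive. split.
  - now apply Ropp_neq_0_compat.
  - apply Rinv_neq_0_compat. apply Rgt_not_eq, exp_pos.
Qed.

Definition lam (a b c d s : R) : R :=
  a / rho a c * (s + (a * b + c * d) / rho a c ^ 2)
  - c * Delta_abcd a b c d / rho a c ^ 3 * ln (Rabs (sqrt (rho a c) * (s + (a * b + c * d) / rho a c ^ 2))).

(** In the scaled variable the factor of u is a xi from gamma plus c chi ln |xi| from J. The minus
    sign in chi = - Delta / rho^(3/2) accounts for the sign of the logarithm. *)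
Lemma lam_eq a b c d s : 0 < rho a c ->
  lam a b c d s = Rpower (rho a c) (- (3 / 2)) * (a * xi a b c d s + c * chi a b c d * ln (Rabs (xi a b c d s))).
Proof.
  intros Hr. unfold lam, chi, xi. set (r := rho a c) in *. set (t := s + _). set (l := ln _). set (D := Delta_abcd a b c d).
  assert (E1 : Rpower r (- (3 / 2)) * sqrt r = / r).
  { rewrite <- Rpower_sqrt by auto. rewrite <- Rpower_plus. replace (- (3 / 2) + / 2) with (- (1)) by field.
    rewrite Rpower_Ropp, Rpower_1; auto. }
  assert (E2 : Rpower r (- (3 / 2)) * / Rpower r (3 / 2) = / r ^ 3).
  { rewrite <- Rpower_Ropp, <- Rpower_plus. replace (- (3 / 2) + - (3 / 2)) with (- INR 3) by (simpl; field).
    rewrite Rpower_Ropp, Rpower_pow; auto. }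
  transitivity (a * (Rpower r (- (3 / 2)) * sqrt r) * t - c * D * (Rpower r (- (3 / 2)) * / Rpower r (3 / 2)) * l).
  - rewrite E1, E2. unfold Rdiv. ring.
  - unfold Rdiv. ring.
Qed.

Lemma clothoid_asymptotics a b c d sg : a ^ 2 + c ^ 2 > 0 -> Delta_abcd a b c d <> 0 -> sg = 1 \/ sg = -1 ->
  exists K, 0 <= K /\ forall s, 1 <= sg * xi a b c d s ->
   norm (minus (clothoid a b c d s) (plus (b_const sg a b c d) (scal (lam a b c d s) (u_dir sg (chi a b c d)))))
   <= K / Rabs (xi a b c d s).
Proof.
  intros Hac HD Hsg. assert (Hr := rho_pos a c Hac). assert (Hk := chi_neq_0 a b c d HD).
  destruct (two_sided (chi a b c d) Hk sg Hsg) as (K & HK & H).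
  set (k := chi a b c d) in *. set (p := Rpower (rho a c) (- (3 / 2))).
  assert (Hp : 0 < p) by apply exp_pos.
  exists (p * (2 * (Rabs c + Rabs a) * K)).
  assert (Hc := Rabs_pos c). assert (Ha := Rabs_pos a).
  split. { apply Rmult_le_pos; [lra|]. apply Rmult_le_pos; [lra | auto]. }
  intros s Hx. destruct (H _ Hx) as (H1 & H2 & H3 & H4). rewrite lam_eq by auto. fold k p.
  set (x := xi a b c d s) in *. set (x0 := xi a b c d 0).
  set (e := exp (- (PI * k ^ 2 / 4))) in *.
  assert (HX : 0 < / Rabs x). { apply Rinv_0_lt_compat. apply Rabs_pos_lt. intros Z. rewrite Z in Hx. lra. }
  eapply Rle_trans; [apply norm_R3_le|].
  assert (EP : perp (minus (clothoid a b c d s) (plus (b_const sg a b c d) (scal (p * (a * x + c * k * ln (Rabs x))) (u_dir sg k)))) =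
    (p * (c * (Jp k x - (perp (C_const sg k) + k * u_perp sg k * ln (Rabs x))) + a * (x * gammaP k x - k * dvecP k x - x * u_perp sg k)))%C).
  { unfold clothoid, b_const. fold k p x x0.
    rewrite !perp_minus, !perp_plus, !perp_scal, perp_integral, !perp_minus, !perp_scal, !perp_minus, !perp_scal, perp_gamma, perp_dvec.
    change (perp (u_dir sg k)) with (u_perp sg k). change (perp (J k x0)) with (Jp k x0).
    rewrite !RtoC_mult, RtoC_plus, !RtoC_mult. ring. }
  assert (ET : third (minus (clothoid a b c d s) (plus (b_const sg a b c d) (scal (p * (a * x + c * k * ln (Rabs x))) (u_dir sg k)))) =
    p * (c * (J3 k x - (third (C_const sg k) + k * e * ln (Rabs x))) + a * (x * gamma3 k x - k * dvec3 k x - x * e))).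
  { unfold clothoid, b_const. fold k p x x0.
    rewrite !third_minus, !third_plus, !third_scal, third_integral, !third_minus, !third_scal, !third_minus, !third_scal, third_gamma, third_dvec.
    change (third (u_dir sg k)) with e. change (third (J k x0)) with (J3 k x0). ring. }
  rewrite EP, ET. rewrite Cmod_mult, Cmod_RtoC, Rabs_mult, (Rabs_pos_eq p) by lra.
  replace (p * (2 * (Rabs c + Rabs a) * K) / Rabs x) with (p * (2 * (Rabs c + Rabs a) * K * / Rabs x)) by (unfold Rdiv; ring).
  rewrite <- Rmult_plus_distr_l. apply Rmult_le_compat_l; [lra|].
  set (q := K / Rabs x) in *.
  assert (B1 : Cmod (c * (Jp k x - (perp (C_const sg k) + k * u_perp sg k * ln (Rabs x))) + a * (x * gammaP k x - k * dvecP k x - x * u_perp sg k))%C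
     <= Rabs c * q + Rabs a * q).
  { eapply Rle_trans; [apply Cmod_triangle|]. rewrite !Cmod_mult, !Cmod_R.
    apply Rplus_le_compat; apply Rmult_le_compat_l; assumption. }
  assert (B2 : Rabs (c * (J3 k x - (third (C_const sg k) + k * e * ln (Rabs x))) + a * (x * gamma3 k x - k * dvec3 k x - x * e)) <= Rabs c * q + Rabs a * q).
  { eapply Rle_trans; [apply Rabs_triang|]. rewrite !Rabs_mult.
    apply Rplus_le_compat; apply Rmult_le_compat_l; assumption. }
  apply Rle_trans with ((Rabs c * q + Rabs a * q) + (Rabs c * q + Rabs a * q)); [lra|]. right. unfold q, Rdiv. ring.
Qed.

Lemma xi_large a b c d sg : 0 < rho a c -> sg = 1 \/ sg = -1 ->
  exists M, 1 <= M /\ forall s, M < sg * s -> 1 <= sg * xi a b c d s /\ sqrt (rho a c) / 2 * Rabs s <= Rabs (xi a b c d s).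
Proof.
  intros Hr Hsg. unfold xi. set (q := (a * b + c * d) / rho a c ^ 2). set (w := sqrt (rho a c)).
  assert (Hw : 0 < w) by now apply sqrt_lt_R0.
  assert (Hq := Rabs_pos q). assert (Hi : 0 < / w) by now apply Rinv_0_lt_compat.
  (* Beyond this bound |s + q| exceeds both |s|/2 and 1/w, so |xi| >= 1 and |xi| is comparable to
     |s|. *)
  exists (1 + 2 * Rabs q + 2 * / w). split; [lra|]. intros s Hs.
  assert (Hsq : Rabs sg = 1). { destruct Hsg as [-> | ->]; [apply Rabs_R1 | rewrite Rabs_left; lra]. }
  assert (Hsq2 : Rabs (sg * q) = Rabs q) by (rewrite Rabs_mult, Hsq; ring).
  assert (B := Rle_abs (- (sg * q))). rewrite Rabs_Ropp, Hsq2 in B.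
  assert (Es : sg * s = Rabs s).
  { destruct Hsg as [-> | ->]; [rewrite Rabs_pos_eq; lra | rewrite Rabs_left; lra]. }
  assert (L : Rabs s / 2 <= sg * (s + q)) by lra.
  assert (L2 : / w <= sg * (s + q)) by lra.
  assert (E1 : sg * (w * (s + q)) = w * (sg * (s + q))) by ring.
  split.
  - rewrite E1. rewrite <- (Rinv_r w) by lra. apply Rmult_le_compat_l; lra.
  - rewrite Rabs_mult, (Rabs_pos_eq w) by lra. unfold Rdiv. rewrite Rmult_assoc. apply Rmult_le_compat_l; [lra|].
    rewrite Rmult_comm. apply Rle_trans with (1 := L). apply Rle_trans with (Rabs (sg * (s + q))); [apply Rle_abs|].
    rewrite Rabs_mult, Hsq. lra.
Qed.

Lemma clothoid_bigO a b c d sg : a ^ 2 + c ^ 2 > 0 -> Delta_abcd a b c d <> 0 -> sg = 1 \/ sg = -1 ->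
  exists K M, forall s, M < sg * s ->
   norm (minus (clothoid a b c d s) (plus (b_const sg a b c d) (scal (lam a b c d s) (u_dir sg (chi a b c d)))))
   <= K * Rabs (/ Rabs s).
Proof.
  intros Hac HD Hsg. assert (Hr := rho_pos a c Hac).
  destruct (clothoid_asymptotics a b c d sg Hac HD Hsg) as (K & HK & H).
  destruct (xi_large a b c d sg Hr Hsg) as (M & HM & HX).
  assert (Hw : 0 < sqrt (rho a c)) by now apply sqrt_lt_R0.
  exists (K * (2 / sqrt (rho a c))), M. intros s Hs. destruct (HX s Hs) as [X1 X2].
  assert (Hs0 : 0 < Rabs s). { apply Rabs_pos_lt. intros ->. lra. }
  eapply Rle_trans; [apply H, X1|]. rewrite Rabs_inv, Rabs_Rabsolu.
  unfold Rdiv at 1. rewrite Rmult_assoc. apply Rmult_le_compat_l; auto.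
  replace (2 / sqrt (rho a c) * / Rabs s) with (/ (sqrt (rho a c) / 2 * Rabs s)) by (field; lra).
  apply Rinv_le_contravar; auto. apply Rmult_lt_0_compat; lra.
Qed.

Lemma norm_u_dir sg k : k <> 0 -> sg = 1 \/ sg = -1 -> norm (u_dir sg k) = 1.
Proof.
  intros Hk Hsg. rewrite norm_R3_eq. change (perp (u_dir sg k)) with (u_perp sg k).
  change (third (u_dir sg k)) with (exp (- (PI * k ^ 2 / 4))).
  destruct (lz_limits k Hk) as (_ & _ & _ & _ & E).
  replace (Cmod (u_perp sg k)) with (Cmod (u_perp 1 k)).
  - rewrite E. apply sqrt_1.
  - destruct Hsg as [-> | ->]; auto. rewrite u_perp_opp, Cmod_opp. reflexivity.
Qed.

(** Both directions are unit vectors with opposite horizontal parts and common height e, so their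
    inner product is e^2 - (1 - e^2) = cos (2 acos e). As e > 0, 2 acos e stays in [0, pi], where
    [acos] inverts [cos]. *)
Lemma angle_u_dir k : k <> 0 ->
  cos (angle (u_dir 1 k) (u_dir (-1) k)) = 2 * exp (- (PI * k ^ 2 / 2)) - 1 /\
  angle (u_dir 1 k) (u_dir (-1) k) = 2 * acos (exp (- (PI * k ^ 2 / 4))).
Proof.
  intros Hk. unfold angle. rewrite !norm_u_dir by auto.
  destruct (lz_limits k Hk) as (_ & _ & _ & _ & E).
  set (e := exp (- (PI * k ^ 2 / 4))) in *.
  assert (He : 0 < e) by apply exp_pos.
  assert (He1 : e <= 1). { unfold e. rewrite <- exp_0. apply exp_le_compat. assert (0 < PI) by apply PI_RGT_0. nra. }
  assert (Ee : exp (- (PI * k ^ 2 / 2)) = e ^ 2). { unfold e. rewrite exp_pow_INR. f_equal. simpl. field. }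
  assert (EI : inner (u_dir 1 k) (u_dir (-1) k) / (1 * 1) = 2 * e ^ 2 - 1).
  { unfold inner. change (perp (u_dir 1 k)) with (u_perp 1 k). change (perp (u_dir (-1) k)) with (u_perp (-1) k).
    change (third (u_dir 1 k)) with e. change (third (u_dir (-1) k)) with e. rewrite u_perp_opp.
    rewrite Cmod_sqr in E. change (Re (- u_perp 1 k)%C) with (- Re (u_perp 1 k)). change (Im (- u_perp 1 k)%C) with (- Im (u_perp 1 k)).
    field_simplify. nra. }
  rewrite EI, Ee.
  assert (HB : -1 <= 2 * e ^ 2 - 1 <= 1) by nra.
  split; [apply cos_acos, HB|].
  assert (Ha := acos_bound e).
  assert (H2 : acos e <= PI / 2).
  { destruct (Rle_dec (acos e) (PI / 2)) as [|N]; auto. exfalso.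
    assert (C : cos (acos e) < 0) by (apply cos_lt_0; lra). rewrite cos_acos in C by lra. lra. }
  assert (E2 : cos (2 * acos e) = 2 * e ^ 2 - 1). { rewrite cos_2a_cos, cos_acos by lra. ring. }
  rewrite <- E2. apply acos_cos. lra.
Qed.

Theorem theorem2 (a b c d : R) (Hac : a ^ 2 + c ^ 2 > 0) (HDelta : Delta_abcd a b c d <> 0) :
  let k := chi a b c d in
  let r := clothoid a b c d in
  let u_p := u_dir 1 k in
  let u_m := u_dir (-1) k in
  let b_p := b_const 1 a b c d in
  let b_m := b_const (-1) a b c d in
  let lam := fun s : R =>
    a / rho a c * (s + (a * b + c * d) / rho a c ^ 2)
    - c * Delta_abcd a b c d / rho a c ^ 3
      * ln (Rabs (sqrt (rho a c) * (s + (a * b + c * d) / rho a c ^ 2))) in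
  let Theta := angle u_p u_m in
  (is_bigO (Rbar_locally p_infty)
     (fun s => minus (r s) (plus b_p (scal (lam s) u_p))) (fun s => / Rabs s)
   /\ is_bigO (Rbar_locally m_infty)
     (fun s => minus (r s) (plus b_m (scal (lam s) u_m))) (fun s => / Rabs s))
  /\ (is_bigO (Rbar_locally p_infty)
        (fun s => dist_to (r s) (line b_p u_p)) (fun s => / Rabs s)
      /\ is_bigO (Rbar_locally m_infty)
        (fun s => dist_to (r s) (line b_m u_m)) (fun s => / Rabs s))
  /\ (cos Theta = 2 * exp (- (PI * k ^ 2 / 2)) - 1
      /\ Theta = 2 * acos (exp (- (PI * k ^ 2 / 4)))).
Proof.
  intros k r u_p u_m b_p b_m lam Theta.
  destruct (clothoid_bigO a b c d 1 Hac HDelta (or_introl eq_refl)) as (Kp & Mp & Hp).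
  destruct (clothoid_bigO a b c d (-1) Hac HDelta (or_intror eq_refl)) as (Km & Mm & Hm).
  assert (Hp' : forall s, Mp < s -> norm (minus (r s) (plus b_p (scal (lam s) u_p))) <= Kp * Rabs (/ Rabs s)).
  { intros s Hs. apply Hp. lra. }
  assert (Hm' : forall s, s < - Mm -> norm (minus (r s) (plus b_m (scal (lam s) u_m))) <= Km * Rabs (/ Rabs s)).
  { intros s Hs. apply Hm. lra. }
  split; [split; [exists Kp, Mp; exact Hp' | exists Km, (- Mm); exact Hm'] | split].
  - split; [exists Kp, Mp; intros s Hs | exists Km, (- Mm); intros s Hs].
    + change (Rabs (dist_to (r s) (line b_p u_p)) <= Kp * Rabs (/ Rabs s)).
      destruct (dist_to_line_le (r s) b_p u_p (lam s)) as [D0 D1]. rewrite Rabs_pos_eq by auto.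
      exact (Rle_trans _ _ _ D1 (Hp' s Hs)).
    + change (Rabs (dist_to (r s) (line b_m u_m)) <= Km * Rabs (/ Rabs s)).
      destruct (dist_to_line_le (r s) b_m u_m (lam s)) as [D0 D1]. rewrite Rabs_pos_eq by auto.
      exact (Rle_trans _ _ _ D1 (Hm' s Hs)).
  - apply angle_u_dir, chi_neq_0, HDelta.
Qed.
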